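(* Suppose $d$ is a positive integer. For each $n\in\mathbb{N}$, suppose $L_n:=(L_{n1},L_{n2},\ldots,L_{nd})$ is an element of $\mathbb{N}^d$, and suppose $X^{(n)}:=\left(X_k^{(n)},\,k\in B(L_n)\right)$ is an array of (real-valued) random variables such that for each $k\in B(L_n)$, $EX_k^{(n)}=0$ and $E\left(X_k^{(n)}\right)^2<\infty$, and for at least one $k\in B(L_n)$, $E\left(X_k^{(n)}\right)^2>0$. For each $m\in\mathbb{N}$ define $$\alpha(m):=\sup_{n\in\mathbb{N}}\alpha(X^{(n)},m),\qquad \rho'(m):=\sup_{n\in\mathbb{N}}\rho'(X^{(n)},m),$$ and suppose that the mixing assumptions $$\alpha(m)\to 0\ \text{ as } m\to\infty\qquad\text{and}\qquad \lim_{m\to\infty}\rho'(m)<1$$ hold. For each $n\in\mathbb{N}$, define the random sum $S(X^{(n)},L_n):=\sum_{k\in B(L_n)}X_k^{(n)}$ and the quantity $\sigma_n^2:=E\left(S(X^{(n)},L_n)\right)^2$ (with $\sigma_n\ge 0$). Suppose there exists a positive constant $C$ such that for every $n\in\mathbb{N}$ and every nonempty set $S\subseteq B(L_n)$, $$E\left(\sum_{k\in S}X_k^{(n)}\right)^2\ \ge\ C\cdot\sum_{k\in S}E\left(X_k^{(n)}\right)^2 .$$ Suppose the Lindeberg condition $$\forall\,\varepsilon>0,\quad \lim_{n\to\infty}\frac{1}{\sigma_n^2}\sum_{k\in B(L_n)}E\left[\left(X_k^{(n)}\right)^2 I\left(\left|X_k^{(n)}\right|>\varepsilon\sigma_n\right)\right]=0$$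 holds. Then $$\sigma_n^{-1}S(X^{(n)},L_n)\Rightarrow N(0,1)\quad\text{as } n\to\infty .$$
   Context: $\mathbb{N}=\{1,2,3,\ldots\}$. All random variables are real-valued and defined on a probability space $(\Omega,\mathcal{F},P)$. No stationarity is assumed. $I(\cdot)$ denotes the indicator of an event, $\Rightarrow$ denotes convergence in distribution, and $N(0,1)$ is the standard normal law. Box: for $L=(L_1,\ldots,L_d)\in\mathbb{N}^d$, $B(L):=\{k=(k_1,\ldots,k_d)\in\mathbb{N}^d:\ \forall u\in\{1,\ldots,d\},\ 1\le k_u\le L_u\}$. Dependence coefficients of $\sigma$-fields: for $\sigma$-fields $\mathcal{A},\mathcal{B}\subseteq\mathcal{F}$, $$\alpha(\mathcal{A},\mathcal{B}):=\sup_{A\in\mathcal{A},\,B\in\mathcal{B}}|P(A\cap B)-P(A)P(B)|,$$ $$\rho(\mathcal{A},\mathcal{B}):=\sup|\mathrm{Corr}(f,g)|,\quad f\in L^2_{\mathrm{real}}(\mathcal{A}),\ g\in L^2_{\mathrm{real}}(\mathcal{B}),$$ where $L^2_{\mathrm{real}}(\mathcal{A})$ is the set of real-valued square-integrable $\mathcal{A}$-measurable random variables (and the correlation is taken to be $0$ if $f$ or $g$ is a.s. constant). Dependence coefficients of random fields: for a random field $X=(X_k,\,k\in\mathbb{Z}^d)$ and $n\in\mathbb{N}$: (i) $\alpha(X,n):=\sup\alpha(\sigma(X_k,k\in Q),\sigma(X_k,k\in S))$, the supremum being over all pairs of nonempty, disjoint sets $Q,S\subset\mathbb{Z}^d$ for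 which there exist $u\in\{1,\ldots,d\}$ and $j\in\mathbb{Z}$ such that $Q\subset\{k\in\mathbb{Z}^d:k_u\le j\}$ and $S\subset\{k\in\mathbb{Z}^d:k_u\ge j+n\}$. (ii) $\rho'(X,n):=\sup\rho(\sigma(X_k,k\in Q),\sigma(X_k,k\in S))$, the supremum being over all pairs of nonempty, finite, disjoint sets $Q,S\subset\mathbb{Z}^d$ for which there exist $u\in\{1,\ldots,d\}$ and nonempty disjoint sets $A,B\subset\mathbb{Z}$ with $\min_{a\in A,\,b\in B}|a-b|\ge n$ such that $Q\subset\{k\in\mathbb{Z}^d:k_u\in A\}$ and $S\subset\{k\in\mathbb{Z}^d:k_u\in B\}$. For a finite collection $X=(X_k,\,k\in B(L))$ with $L\in\mathbb{N}^d$, the coefficients $\alpha(X,n)$ and $\rho'(X,n)$ are defined as those of the random field $\widetilde{X}=(X_k,\,k\in\mathbb{Z}^d)$ obtained by setting $X_k:=0$ for $k\in\mathbb{Z}^d\setminus B(L)$. *)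

(* Defs.v *)
From HB Require Import structures.
From mathcomp Require Import all_boot all_order all_algebra.
From mathcomp Require Import all_classical all_reals all_analysis.
From mathcomp Require Import finmap measurable_realfun.

Set Implicit Arguments.
Unset Strict Implicit.
Unset Printing Implicit Defensive.

Import Order.TTheory GRing.Theory Num.Theory.
Import numFieldNormedType.Exports.

Local Open Scope classical_set_scope.
Local Open Scope ring_scope.

Notation lattice d := {ffun 'I_d -> int}.

Definition box (d : nat) (L : 'I_d -> nat) : set (lattice d) :=
  [set k : lattice d | forall u, 1 <= k u <= (L u)%:Z].

Lemma finite_box (d : nat) (L : 'I_d -> nat) : finite_set (box L).
Proof.
pose g (a : {dffun forall u : 'I_d, 'I_(L u).+1}) : lattice d :=
  [ffun u => (a u : nat)%:Z].
apply: (@sub_finite_set _ _ (range g)); last first.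
  exact: finite_image finite_finset.
move=> k kL; exists [ffun u => inord `|k u|%N] => //.
apply/ffunP => u; rewrite !ffunE /=; have /andP[k1 kLu] := kL u.
have k0 : 0 <= k u by apply: le_trans k1.
by rewrite inordK ?gez0_abs// ltnS -lez_nat gez0_abs.
Qed.

Section dependence_coefficients.
Context {R : realType} {disp : measure_display} {T : measurableType disp}.
Variable P : probability T R.

Definition alpha_coef (A B : set (set T)) : \bar R :=
  ereal_sup [set `|P (AB.1 `&` AB.2) - P AB.1 * P AB.2|%E
            | AB in [set AB | A AB.1 /\ B AB.2]].

Definition L2_real (A : set (set T)) : set (T -> R) :=
  [set f | f \in Lfun P 2%:E /\
           preimage_set_system setT f measurable `<=` A].

(* Since 0^-1 = 0, this is 0 when f or g has variance 0, i.e. is a.s.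
   constant. *)
Definition Corr (f g : T -> R) : R :=
  fine (covariance P f g) /
  (Num.sqrt (fine 'V_P[f]) * Num.sqrt (fine 'V_P[g])).

Definition rho_coef (A B : set (set T)) : \bar R :=
  ereal_sup [set `|Corr fg.1 fg.2|%:E
            | fg in [set fg | L2_real A fg.1 /\ L2_real B fg.2]].

End dependence_coefficients.

Definition sigma_field (R : realType) (disp : measure_display)
    (T : measurableType disp) (d : nat) (X : lattice d -> T -> R)
    (Q : set (lattice d)) : set (set T) :=
  <<s \bigcup_(k in Q) preimage_set_system setT (X k) measurable >>.

Definition half_space_separated (d n : nat) (Q S : set (lattice d)) : Prop :=
  exists (u : 'I_d) (j : int),
    Q `<=` [set k : lattice d | k u <= j] /\
    S `<=` [set k : lattice d | j + n%:Z <= k u].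

Definition slab_separated (d n : nat) (Q S : set (lattice d)) : Prop :=
  exists (u : 'I_d) (A B : set int),
    [/\ A !=set0, B !=set0 & A `&` B = set0] /\
    [/\ forall a b, A a -> B b -> n%:Z <= `|a - b|,
        Q `<=` [set k : lattice d | A (k u)]
      & S `<=` [set k : lattice d | B (k u)]].

Section field_coefficients.
Context {R : realType} {disp : measure_display} {T : measurableType disp}.
Variable P : probability T R.
Variables (d : nat) (X : lattice d -> T -> R).

Definition alpha_field (n : nat) : \bar R :=
  ereal_sup [set alpha_coef P (sigma_field X QS.1) (sigma_field X QS.2)
            | QS in [set QS | [/\ QS.1 !=set0, QS.2 !=set0,
                                  QS.1 `&` QS.2 = set0
                                & half_space_separated n QS.1 QS.2]]].

Definition rho'_field (n : nat) : \bar R :=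
  ereal_sup [set rho_coef P (sigma_field X QS.1) (sigma_field X QS.2)
            | QS in [set QS | [/\ QS.1 !=set0 /\ QS.2 !=set0,
                                  finite_set QS.1 /\ finite_set QS.2,
                                  QS.1 `&` QS.2 = set0
                                & slab_separated n QS.1 QS.2]]].

End field_coefficients.

Section arrays.
Context {R : realType} {disp : measure_display} {T : measurableType disp}.
Context {P : probability T R}.
Variables (d : nat).
Implicit Types (L : 'I_d -> nat) (X : lattice d -> {RV P >-> R}).

(* An array (X_k, k \in B(L)) is given by a family indexed by all of Z^d, of
   which only the members with k in the box are ever used. *)
Definition zero_extension L X (k : lattice d) : T -> R :=
  if k \in box L then X k else cst 0.

Definition alpha_array (L : nat -> 'I_d -> nat)
    (X : nat -> lattice d -> {RV P >-> R}) (m : nat) : \bar R :=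
  ereal_sup (range (fun n => alpha_field P (zero_extension (L n) (X n)) m)).

Definition rho'_array (L : nat -> 'I_d -> nat)
    (X : nat -> lattice d -> {RV P >-> R}) (m : nat) : \bar R :=
  ereal_sup (range (fun n => rho'_field P (zero_extension (L n) (X n)) m)).

Definition partial_sum X (S : set (lattice d)) (w : T) : R :=
  \sum_(k \in S) X k w.

Definition sigma_sum L X : R :=
  Num.sqrt (fine 'E_P[fun w => partial_sum X (box L) w ^+ 2]).

Definition normalized_sum L X (w : T) : R :=
  (sigma_sum L X)^-1 * partial_sum X (box L) w.

Lemma measurable_normalized_sum L X :
  measurable_fun [set: T] (normalized_sum L X).
Proof.
apply: measurable_funM => //.
rewrite /partial_sum (_ : (fun w => _) =
    (fun w => \sum_(k <- fset_set (box L)) X k w)).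
  by apply: measurable_sum => k.
by apply/funext => w; rewrite fsbig_finite//; exact: finite_box.
Qed.

HB.instance Definition _ L X := @isMeasurableFun.Build _ _ _ _
  (normalized_sum L X) (measurable_normalized_sum L X).

Definition lindeberg_sum (eps : R) L X : \bar R :=
  ((sigma_sum L X ^+ 2)^-1%:E * \sum_(k \in box L)
     'E_P[fun w => (X k w ^+ 2 *
            \1_[set w | (eps * sigma_sum L X < `|X k w|)%R] w)%R])%E.

End arrays.

(* Convergence of the distribution functions at every continuity point of the
   limit distribution function. *)
Definition cvg_in_distribution (R : realType) (disp : measure_display)
    (T : measurableType disp) (P : probability T R)
    (Y : nat -> {RV P >-> R}) (mu : probability (measurableTypeR R) R) : Prop :=
  forall x : R, {for x, continuous (fun y : R => mu `]-oo, y]%classic)} ->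
    cdf (Y n) x @[n --> \oo] --> mu `]-oo, x]%classic.

Arguments cvg_in_distribution {R disp T} P Y mu.

(* Main.v *)
(* Characteristic functions are handled through the real functions
   E cos(t Y + theta). The condition rho' < 1 gives two moment bounds for sums of
   centered variables over any finite set of sites: E(sum)^2 <= c sum E X^2 and
   E(sum)^4 <= c (sum E X^4 + (sum E X^2)^2). Both come from choosing signs: for
   families indexed by well separated slabs some signed sum has small moments,
   and the correlation bound compares the signed sum with the unsigned one; this
   is applied direction by direction, within each residue class of sites.

   Normalize so that the sum has variance 1; the lower variance bound makes the
   sum of the variances at most 1/C. Truncate at a small level. In each direction
   cut the box into a bounded number of pieces carrying little variance,
   separated by removed gaps of width m and negligible variance; positions of
   large mass only matter at sites exceptional in every direction, and there
   are boundedly many of those. The moment bounds show that removing and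
   truncating changes the sum little in L^2. As the number of blocks is fixed
   before m, alpha-mixing factorizes the characteristic function of the blocked
   sum, and expanding each factor to second order yields exp(- t^2 w / 2) with w
   the sum of the block variances. Comparing both expansions at a small t shows that w is
   close to 1, although the blocks need not be uncorrelated. *)

Require Import Defs.
From HB Require Import structures.
From mathcomp Require Import all_boot all_order all_algebra.
From mathcomp Require Import all_classical all_reals all_analysis.
From mathcomp Require Import finmap measurable_realfun ring lra zify.

Set Implicit Arguments.
Unset Strict Implicit.
Unset Printing Implicit Defensive.

Import Order.TTheory GRing.Theory Num.Theory.
Import numFieldNormedType.Exports.

Local Open Scope classical_set_scope.
Local Open Scope ring_scope.

(** * Expectations of real random variables *)

Section mean.
Context {R : realType} {disp : measure_display} {T : measurableType disp}.
Variable P : probability T R.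
Implicit Types f g : T -> R.

(** The constants can be chosen in one order only. No rate is assumed for [alpha], so the number of
    blocks has to be fixed before the gap width [m]. The cuts therefore follow the accumulated
    variance and not the geometry of the box; a block may be large in size and is small only in
    variance. Its Gaussian approximation is a Lyapunov bound: the fourth moment inequality gives
    fourth moments of order (truncation level squared + block variance) times variance, summable
    over the blocks with a small factor. The two mixing coefficients have separate tasks. Arbitrary
    sign patterns need index sets that interlace, which [rho'] allows; factorization may only use
    half-spaces, so blocks are separated by thresholds of a single coordinate. As [rho' < 1] bounds
    correlations without making them small, the sum of the block variances is identified through
    characteristic functions instead of covariances. The phase [theta] makes the real quantities E
    cos(t Y + theta) carry both the real and the imaginary part of the characteristic function. *)

Definition mean f : R := \int[P]_w f w.

Definition L1 f : Prop := P.-integrable setT (EFin \o f).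

Definition L2 f : Prop := measurable_fun setT f /\ L1 (fun w => f w ^+ 2).

Definition Bd f : Prop :=
  measurable_fun setT f /\ exists M, forall w, `|f w| <= M.

Lemma eq_mean f g : f =1 g -> mean f = mean g.
Proof. by move=> /funext ->. Qed.

Lemma L1D f g : L1 f -> L1 g -> L1 (fun w => f w + g w).
Proof. by move=> f1 g1; exact: (integrableD measurableT f1 g1). Qed.

Lemma L1B f g : L1 f -> L1 g -> L1 (fun w => f w - g w).
Proof. by move=> f1 g1; exact: (integrableB measurableT f1 g1). Qed.

Lemma L1Z (a : R) f : L1 f -> L1 (fun w => a * f w).
Proof.
move=> f1; rewrite /L1 (_ : _ \o _ = (fun w => a%:E * (f w)%:E)%E)//.
exact: integrableZl.
Qed.

Lemma L1_le f g : measurable_fun setT f -> L1 g -> (forall w, `|f w| <= g w) ->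
  L1 f.
Proof.
move=> mf g1 fg; apply: (le_integrable measurableT _ _ g1).
  exact/measurable_EFinP.
by move=> w _ /=; rewrite lee_fin (le_trans (fg w))// ler_norm.
Qed.

Lemma L1_norm f : L1 f -> L1 (fun w => `|f w|).
Proof. by move=> f1; exact: (integrable_norm f1). Qed.

Lemma Bd_L1 f : Bd f -> L1 f.
Proof.
move=> [mf [M fM]]; apply: (@measurable_bounded_integrable _ _ R P) => //.
  by rewrite (le_lt_trans (probability_le1 P measurableT))// ltry.
exists M; split; first exact: num_real.
by move=> x Mx w _; exact: le_trans (fM w) (ltW Mx).
Qed.

Lemma Bd_cst (c : R) : Bd (fun=> c).
Proof. by split => //; exists `|c|. Qed.

Lemma BdD f g : Bd f -> Bd g -> Bd (fun w => f w + g w).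
Proof.
move=> [mf [M fM]] [mg [N gN]]; split; first exact: measurable_funD.
by exists (M + N) => w; rewrite (le_trans (ler_normD _ _))// lerD.
Qed.

Lemma BdN f : Bd f -> Bd (fun w => - f w).
Proof.
move=> [mf [M fM]]; split; first exact: measurableT_comp.
by exists M => w; rewrite normrN.
Qed.

Lemma BdM f g : Bd f -> Bd g -> Bd (fun w => f w * g w).
Proof.
move=> [mf [M fM]] [mg [N gN]]; split; first exact: measurable_funM.
by exists (M * N) => w; rewrite normrM ler_pM.
Qed.

Lemma BdX f n : Bd f -> Bd (fun w => f w ^+ n).
Proof.
move=> Bf; elim: n => [|n IH]; first exact: Bd_cst.
by under eq_fun do rewrite exprS; exact: BdM.
Qed.

Lemma Bd_norm f : Bd f -> Bd (fun w => `|f w|).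
Proof.
move=> [mf [M fM]]; split; first exact: measurableT_comp.
by exists M => w; rewrite normr_id.
Qed.

Lemma Bd_sum (I : eqType) (s : seq I) (A : pred I) (f : I -> T -> R) :
  (forall i, i \in s -> A i -> Bd (f i)) -> Bd (fun w => \sum_(i <- s | A i) f i w).
Proof.
elim: s => [|i s IH] Bf.
  by under eq_fun do rewrite big_nil; exact: Bd_cst.
under eq_fun do rewrite big_cons.
have Bs : Bd (fun w => \sum_(j <- s | A j) f j w).
  by apply: IH => j js; apply: Bf; rewrite inE js orbT.
by case: (boolP (A i)) => // Ai /=; apply: BdD => //; apply: Bf => //; rewrite mem_head.
Qed.

Lemma Bd_comp f (h : R -> R) : measurable_fun setT f ->
  measurable_fun setT h -> (forall x, `|h x| <= 1) -> Bd (fun w => h (f w)).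
Proof.
by move=> mf mh h1; split; [exact: (measurableT_comp mh mf)|exists 1 => w].
Qed.

Lemma Bd_cos f : measurable_fun setT f -> Bd (fun w => cos (f w)).
Proof.
move=> mf; apply: Bd_comp => //; last by move=> x; rewrite ler_norml cos_geN1 cos_le1.
by apply: continuous_measurable_fun; exact: continuous_cos.
Qed.

Lemma Bd_sin f : measurable_fun setT f -> Bd (fun w => sin (f w)).
Proof.
move=> mf; apply: Bd_comp => //; last by move=> x; rewrite ler_norml sin_geN1 sin_le1.
by apply: continuous_measurable_fun; exact: continuous_sin.
Qed.

Lemma Bd_L2 f : Bd f -> L2 f.
Proof. by move=> Bf; split; [case: Bf|apply: Bd_L1; exact: BdX]. Qed.

Lemma L2_L1M f g : L2 f -> L2 g -> L1 (fun w => f w * g w).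
Proof.
move=> [mf f2] [mg g2]; apply: (@L1_le _ (fun w => f w ^+ 2 + g w ^+ 2)).
- exact: measurable_funM.
- exact: L1D.
- by move=> w; rewrite ler_norml; apply/andP; split; nra.
Qed.

Lemma L2_L1 f : L2 f -> L1 f.
Proof.
move=> f2; have := L2_L1M f2 (Bd_L2 (Bd_cst 1)).
by under eq_fun do rewrite mulr1.
Qed.

Lemma L2Z (a : R) f : L2 f -> L2 (fun w => a * f w).
Proof.
move=> [mf f2]; split; first exact: measurable_funM.
by under eq_fun do rewrite exprMn; exact: L1Z.
Qed.

Lemma L2D f g : L2 f -> L2 g -> L2 (fun w => f w + g w).
Proof.
move=> f2 g2; split.
  by apply: measurable_funD; [case: f2|case: g2].
rewrite (_ : (fun w => _) = (fun w => f w ^+ 2 + (2 * (f w * g w) + g w ^+ 2))).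
  apply: L1D; first by case: f2.
  by apply: L1D; [exact/L1Z/L2_L1M|case: g2].
by apply/funext => w; ring.
Qed.

Lemma L2N f : L2 f -> L2 (fun w => - f w).
Proof. by move=> /(L2Z (-1)); under eq_fun do rewrite mulN1r. Qed.

Lemma L2B f g : L2 f -> L2 g -> L2 (fun w => f w - g w).
Proof. by move=> f2 g2; apply: L2D => //; exact: L2N. Qed.

Lemma L2_sum (I : eqType) (s : seq I) (A : pred I) (f : I -> T -> R) :
  (forall i, i \in s -> A i -> L2 (f i)) -> L2 (fun w => \sum_(i <- s | A i) f i w).
Proof.
elim: s => [|i s IH] Bf.
  by under eq_fun do rewrite big_nil; apply/Bd_L2/Bd_cst.
under eq_fun do rewrite big_cons.
have Bs : L2 (fun w => \sum_(j <- s | A j) f j w).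
  by apply: IH => j js; apply: Bf; rewrite inE js orbT.
by case: (boolP (A i)) => // Ai /=; apply: L2D => //; apply: Bf => //; rewrite mem_head.
Qed.

Lemma L2_cst (c : R) : L2 (fun=> c).
Proof. exact/Bd_L2/Bd_cst. Qed.

Lemma L2_sqr f : L2 f -> L1 (fun w => f w ^+ 2).
Proof. by case. Qed.

Lemma L2_measurable f : L2 f -> measurable_fun setT f.
Proof. by case. Qed.

Lemma L1_sum (I : eqType) (s : seq I) (A : pred I) (f : I -> T -> R) :
  (forall i, i \in s -> A i -> L1 (f i)) -> L1 (fun w => \sum_(i <- s | A i) f i w).
Proof.
elim: s => [|i s IH] Bf.
  by under eq_fun do rewrite big_nil; apply/Bd_L1/Bd_cst.
under eq_fun do rewrite big_cons.
have Bs : L1 (fun w => \sum_(j <- s | A j) f j w).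
  by apply: IH => j js; apply: Bf; rewrite inE js orbT.
by case: (boolP (A i)) => // Ai /=; apply: L1D => //; apply: Bf => //; rewrite mem_head.
Qed.

Lemma mean_cst (c : R) : mean (fun=> c) = c.
Proof. by rewrite /mean Rintegral_cst//= probability_setT/= mulr1. Qed.

Lemma meanD f g : L1 f -> L1 g -> mean (fun w => f w + g w) = mean f + mean g.
Proof. by move=> f1 g1; rewrite /mean RintegralD. Qed.

Lemma meanB f g : L1 f -> L1 g -> mean (fun w => f w - g w) = mean f - mean g.
Proof. by move=> f1 g1; rewrite /mean RintegralB. Qed.

Lemma meanZ (a : R) f : L1 f -> mean (fun w => a * f w) = a * mean f.
Proof. by move=> f1; rewrite /mean RintegralZl. Qed.

Lemma mean_le f g : L1 f -> L1 g -> (forall w, f w <= g w) -> mean f <= mean g.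
Proof. by move=> f1 g1 fg; apply: le_Rintegral. Qed.

Lemma mean_ge0 f : (forall w, 0 <= f w) -> 0 <= mean f.
Proof. by move=> f0; apply: Rintegral_ge0. Qed.

Lemma mean_norm f : L1 f -> `|mean f| <= mean (fun w => `|f w|).
Proof. by move=> f1; apply: le_normr_Rintegral. Qed.

Lemma mean_norm_le f g : L1 f -> L1 g -> (forall w, `|f w| <= g w) ->
  `|mean f| <= mean g.
Proof.
move=> f1 g1 fg; apply: (le_trans (mean_norm f1)).
by apply: mean_le => //; exact: L1_norm.
Qed.

Lemma mean_sum (I : eqType) (s : seq I) (A : pred I) (f : I -> T -> R) :
  (forall i, i \in s -> A i -> L1 (f i)) ->
  mean (fun w => \sum_(i <- s | A i) f i w) = \sum_(i <- s | A i) mean (f i).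
Proof.
elim: s => [|i s IH] Bf.
  by under eq_fun do rewrite big_nil; rewrite big_nil mean_cst.
have Bf' j : j \in s -> A j -> L1 (f j).
  by move=> js; apply: Bf; rewrite inE js orbT.
under eq_fun do rewrite big_cons.
rewrite big_cons; case: (boolP (A i)) => [Ai|_] /=; last exact: IH.
rewrite meanD ?IH//; last exact: L1_sum.
by apply: Bf => //; rewrite mem_head.
Qed.

Lemma mean_center_sqr f : L2 f ->
  mean (fun w => (f w - mean f) ^+ 2) = mean (fun w => f w ^+ 2) - mean f ^+ 2.
Proof.
move=> f2; set c := mean f; have f1 := L2_L1 f2.
rewrite (@eq_mean _ (fun w => f w ^+ 2 + (- (2 * c) * f w + c ^+ 2))); last first.
  by move=> w /=; ring.
have c1 : L1 (fun=> c ^+ 2) by exact/Bd_L1/Bd_cst.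
have f1' : L1 (fun w => - (2 * c) * f w) by exact: L1Z.
rewrite meanD//; [|exact: L2_sqr|exact: L1D].
by rewrite meanD// meanZ// mean_cst -/c; lra.
Qed.

Lemma mean_sqr_le f : L2 f -> mean f ^+ 2 <= mean (fun w => f w ^+ 2).
Proof.
move=> f2; rewrite -subr_ge0 -mean_center_sqr//.
by apply: mean_ge0 => w; exact: sqr_ge0.
Qed.

Lemma mean_center f : L1 f -> mean (fun w => f w - mean f) = 0.
Proof.
by move=> f1; rewrite meanB ?mean_cst ?subrr//; exact/Bd_L1/Bd_cst.
Qed.

Lemma mean_sqrD f g : L2 f -> L2 g -> mean (fun w => (f w + g w) ^+ 2) =
  mean (fun w => f w ^+ 2) + 2 * mean (fun w => f w * g w) +
  mean (fun w => g w ^+ 2).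
Proof.
move=> f2 g2; have fg1 := L2_L1M f2 g2; case: (f2) => _ ff; case: (g2) => _ gg.
rewrite (@eq_mean _ (fun w => f w ^+ 2 + 2 * (f w * g w) + g w ^+ 2)).
  by rewrite !meanD ?meanZ//; first exact: L1Z; apply: L1D => //; exact: L1Z.
by move=> w /=; ring.
Qed.

Lemma mean_sqrB f g : L2 f -> L2 g -> mean (fun w => (f w - g w) ^+ 2) =
  mean (fun w => f w ^+ 2) - 2 * mean (fun w => f w * g w) +
  mean (fun w => g w ^+ 2).
Proof.
move=> f2 g2; rewrite mean_sqrD//; last exact: L2N.
rewrite (@eq_mean (fun w => f w * - g w) (fun w => -1 * (f w * g w))); last first.
  by move=> w; rewrite mulrN mulN1r.
rewrite meanZ; last exact: L2_L1M.
rewrite (@eq_mean (fun w => (- g w) ^+ 2) (fun w => g w ^+ 2)); first by ring.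
by move=> w; rewrite sqrrN.
Qed.

End mean.

(** Measurability for the sigma-field generated by [G]: the type [g_sigma_algebraType G] carries
    that sigma-field, so the closure lemmas for [measurable_fun] apply. [G] is a generating system,
    not the sigma-field. *)
Definition Gmeas (R : realType) (T : pointedType) (G : set (set T)) (f : T -> R) :=
  measurable_fun (setT : set (g_sigma_algebraType G))
    (f : g_sigma_algebraType G -> R).

(** * Moment bounds under the maximal correlation condition *)

Section rho.
Context {R : realType} {disp : measure_display} {T : measurableType disp}.
Variable P : probability T R.
Implicit Types (f g : T -> R) (G : set (set T)).

Local Notation mean := (mean P).
Local Notation L2 := (L2 P).

Lemma Gmeas_sub G1 G2 f : G1 `<=` G2 -> Gmeas G1 f -> Gmeas G2 f.
Proof.
move=> G12 mf _ B mB; apply: (sub_sigma_algebra2 G12).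
exact: mf.
Qed.

Lemma GmeasD G f g : Gmeas G f -> Gmeas G g -> Gmeas G (fun w => f w + g w).
Proof. by move=> mf mg; exact: measurable_funD. Qed.

Lemma GmeasM G f g : Gmeas G f -> Gmeas G g -> Gmeas G (fun w => f w * g w).
Proof. by move=> mf mg; exact: measurable_funM. Qed.

Lemma Gmeas_comp G (h : R -> R) f :
  measurable_fun setT h -> Gmeas G f -> Gmeas G (fun w => h (f w)).
Proof. by move=> mh mf; apply: (measurableT_comp mh mf). Qed.

Lemma Gmeas_cst G (c : R) : Gmeas G (fun=> c).
Proof. exact: measurable_cst. Qed.

Lemma Gmeas_sum (I : eqType) (s : seq I) (A : pred I) G (f : I -> T -> R) :
  (forall i, i \in s -> A i -> Gmeas G (f i)) ->
  Gmeas G (fun w => \sum_(i <- s | A i) f i w).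
Proof.
elim: s => [|i s IH] Bf.
  by under eq_fun do rewrite big_nil; exact: Gmeas_cst.
under eq_fun do rewrite big_cons.
have Bs : Gmeas G (fun w => \sum_(j <- s | A j) f j w).
  by apply: IH => j js; apply: Bf; rewrite inE js orbT.
by case: (boolP (A i)) => // Ai /=; apply: GmeasD => //; apply: Bf => //; rewrite mem_head.
Qed.

Lemma GmeasN G f : Gmeas G f -> Gmeas G (fun w => - f w).
Proof. by move=> mf; apply: (Gmeas_comp (h := -%R)). Qed.

Lemma GmeasB G f g : Gmeas G f -> Gmeas G g -> Gmeas G (fun w => f w - g w).
Proof. by move=> mf mg; apply: GmeasD => //; exact: GmeasN. Qed.

Lemma Gmeas_preimage G f : Gmeas G f ->
  preimage_set_system setT f measurable `<=` <<s G >>.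
Proof. by move=> mf _ [B mB <-]; apply: mf. Qed.

Lemma L2_Lfun f : L2 f -> f \in Lfun P 2%:E.
Proof.
move=> [mf /integrableP[_ f2]]; apply/andP; split; first exact/mem_set.
apply/mem_set; rewrite /= /finite_norm unlock /Lnorm/= ?pnatr_eq0//.
rewrite poweR_lty//; apply: le_lt_trans f2.
apply: ge0_le_integral => //.
- apply/measurable_EFinP.
  apply/(@measurableT_comp _ _ _ _ _ _ (fun x : R => x `^ 2)%R) => //.
  exact/measurableT_comp.
- apply: measurableT_comp => //; apply/measurable_EFinP.
  exact: measurable_funX.
- by move=> w _ /=; rewrite lee_fin normrX powR_mulrn.
Qed.

(** The arithmetic rather than the geometric mean of the two second moments: it follows from the
    bound on the correlation, contains no square root, and still makes sense when a variance
    vanishes. *)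
Definition rho_pair (r : R) G1 G2 := forall f g,
  Gmeas G1 f -> Gmeas G2 g -> L2 f -> L2 g -> mean f = 0 -> mean g = 0 ->
  `|mean (fun w => f w * g w)| <=
    r / 2 * (mean (fun w => f w ^+ 2) + mean (fun w => g w ^+ 2)).

Lemma fine_expectation f : fine 'E_P[f]%E = mean f.
Proof. by rewrite unlock. Qed.

Lemma fine_cov0 f g : mean f = 0 -> mean g = 0 ->
  fine (covariance P f g) = mean (fun w => f w * g w).
Proof.
move=> f0 g0; rewrite unlock !fine_expectation f0 g0.
by apply: eq_mean => w /=; rewrite !fctE/= !subr0.
Qed.

Lemma rho_coef_pair (r : R) G1 G2 : 0 <= r ->
  (rho_coef P <<s G1 >> <<s G2 >> <= r%:E)%E -> rho_pair r G1 G2.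
Proof.
move=> r0 rhor f g mf mg f2 g2 f0 g0.
set a := mean (fun w => f w ^+ 2); set b := mean (fun w => g w ^+ 2).
set c := mean (fun w => f w * g w).
have a0 : 0 <= a by apply: mean_ge0 => w; exact: sqr_ge0.
have b0 : 0 <= b by apply: mean_ge0 => w; exact: sqr_ge0.
have va : fine 'V_P[f]%E = a.
  by rewrite /variance fine_cov0//; apply: eq_mean => w; rewrite expr2.
have vb : fine 'V_P[g]%E = b.
  by rewrite /variance fine_cov0//; apply: eq_mean => w; rewrite expr2.
have corr : `|c / (Num.sqrt a * Num.sqrt b)| <= r.
  rewrite -lee_fin; apply: le_trans rhor; apply: ereal_sup_ubound.
  exists (f, g) => /=; last by rewrite /Corr va vb fine_cov0.
  by do 2 split; [exact: L2_Lfun|exact: Gmeas_preimage|exact: L2_Lfun|exact: Gmeas_preimage].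
have [ab0|ab0] := eqVneq (Num.sqrt a * Num.sqrt b) 0; last first.
  have ab_gt0 : 0 < Num.sqrt a * Num.sqrt b.
    by rewrite lt_neqAle eq_sym ab0 mulr_ge0 ?sqrtr_ge0.
  move: corr; rewrite normrM normfV (gtr0_norm ab_gt0) ler_pdivrMr//.
  move=> /le_trans; apply.
  have := sqr_ge0 (Num.sqrt a - Num.sqrt b).
  have := sqr_sqrtr a0; have := sqr_sqrtr b0.
  by nra.
(* If a variance vanishes, the correlation is 0 by convention and says nothing about [c]. The
   inequality with free weight [l] then forces [c = 0], by weights tending to infinity or to 0. *)
have key (l : R) : 0 < l -> `|c| <= (l * a + l^-1 * b) / 2.
  move=> l0; rewrite /c; apply: (@le_trans _ _
    (mean (fun w => (l / 2) * f w ^+ 2 + (l^-1 / 2) * g w ^+ 2))).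
    apply: mean_norm_le.
    + exact: L2_L1M.
    + by apply: L1D; apply: L1Z; exact: L2_sqr.
    move=> w; rewrite ler_norml.
    have li : l * l^-1 = 1 by rewrite mulfV// gt_eqF.
    have l'0 : 0 < l^-1 by rewrite invr_gt0.
    have H x y : x * y <= l / 2 * x ^+ 2 + l^-1 / 2 * y ^+ 2.
      have : 0 <= l^-1 * (l * x - y) ^+ 2 by rewrite mulr_ge0 ?sqr_ge0// ltW.
      rewrite (_ : _ * _ ^+ 2 = l * l^-1 * (l * x ^+ 2) - 2 * (l * l^-1) * (x * y) + l^-1 * y ^+ 2).
        by rewrite li; lra.
      by ring.
    apply/andP; split; last exact: H.
    have := H (- f w) (g w); rewrite sqrrN mulNr; lra.
  by rewrite meanD ?meanZ ?[in leRHS]mulrDl//; try (apply: L1Z; exact: L2_sqr);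
     try exact: L2_sqr; rewrite -/a -/b; lra.
suff -> : c = 0 by rewrite normr0 mulr_ge0 ?divr_ge0 ?addr_ge0.
apply/eqP; rewrite -normr_eq0 eq_le normr_ge0 andbT.
move/eqP : ab0; rewrite mulf_eq0 !sqrtr_eq0 => /orP[az|bz].
  have a00 : a = 0 by apply/eqP; rewrite eq_le az a0.
  apply/ler_addgt0Pr => e e0; rewrite add0r.
  have [b00|bn0] := eqVneq b 0.
    by have := key 1 ltr01; rewrite a00 b00; lra.
  have bp : 0 < b by rewrite lt_neqAle eq_sym bn0.
  have := key (b / e) (divr_gt0 bp e0).
  rewrite a00 invf_div mulr0 add0r mulrVK ?unitfE//; lra.
have b00 : b = 0 by apply/eqP; rewrite eq_le bz b0.
apply/ler_addgt0Pr => e e0; rewrite add0r.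
have [a00|an0] := eqVneq a 0.
  by have := key 1 ltr01; rewrite a00 b00; lra.
have ap : 0 < a by rewrite lt_neqAle eq_sym an0.
have := key (e / a) (divr_gt0 e0 ap).
rewrite b00 mulr0 addr0 mulrVK ?unitfE//; lra.
Qed.

End rho.

Lemma sqrD_le (R : realFieldType) (a b : R) :
  (a + b) ^+ 2 <= 2 * (a ^+ 2 + b ^+ 2).
Proof. by have := sqr_ge0 (a - b); lra. Qed.

Lemma pow4D_le (R : realFieldType) (a b : R) :
  (a + b) ^+ 4 <= 8 * (a ^+ 4 + b ^+ 4).
Proof.
have h1 := sqrD_le a b; have h2 := sqrD_le (a ^+ 2) (b ^+ 2).
have h3 : ((a + b) ^+ 2) ^+ 2 <= (2 * (a ^+ 2 + b ^+ 2)) ^+ 2.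
  by rewrite ler_pXn2r// ?nnegrE ?sqr_ge0// mulr_ge0// addr_ge0 ?sqr_ge0.
by rewrite exprMn -!exprM in h2 h3 *; lra.
Qed.

(** * Two-term comparison and choice of signs *)

Section rosenthal.
Context {R : realType} {disp : measure_display} {T : measurableType disp}.
Variable P : probability T R.

Local Notation mean := (mean P).
Local Notation L1 := (L1 P).
Local Notation L2 := (L2 P).

(** By the bound on the cross term, [E(U + W)^2] is at most [1 + r] times, and [E(U - W)^2] at least
    [1 - r] times, the sum of the two second moments. *)
Lemma two_point_sqr (r : R) (U W : T -> R) : 0 <= r < 1 -> L2 U -> L2 W ->
  `|mean (fun w => U w * W w)| <=
    r / 2 * (mean (fun w => U w ^+ 2) + mean (fun w => W w ^+ 2)) ->
  mean (fun w => (U w + W w) ^+ 2) <=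
    (1 + r) / (1 - r) * mean (fun w => (U w - W w) ^+ 2).
Proof.
move=> /andP[r0 r1] U2 W2; rewrite mean_sqrD// mean_sqrB//.
set a := mean (fun w => U w ^+ 2); set b := mean (fun w => W w ^+ 2).
set c := mean _; rewrite ler_norml => /andP[c1 c2].
have a0 : 0 <= a by apply: mean_ge0 => w; exact: sqr_ge0.
have b0 : 0 <= b by apply: mean_ge0 => w; exact: sqr_ge0.
have r'0 : 0 < 1 - r by lra.
by rewrite mulrAC ler_pdivlMr//; nra.
Qed.

(* Apply the correlation bound to U|U| and W|W|, and use
   (u|u| - w|w|)^2 <= (u - w)^2 (|u| + |w|)^2. *)
Lemma two_point_pow4 (r : R) (U W : T -> R) G1 G2 : 0 <= r < 1 ->
  Bd U -> Bd W -> Gmeas G1 U -> Gmeas G2 W -> rho_pair P r G1 G2 ->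
  mean (fun w => (U w + W w) ^+ 4) <=
    16 * (mean (fun w => U w ^+ 2) ^+ 2 + mean (fun w => W w ^+ 2) ^+ 2) +
    64 / (1 - r) ^+ 2 * mean (fun w => (U w - W w) ^+ 4).
Proof.
move=> /andP[r0 r1] BU BW mU mW rho.
pose F (V : T -> R) w := V w * `|V w|.
have BF V : Bd V -> Bd (F V) by move=> BV; apply: BdM => //; exact: Bd_norm.
have mF G V : Gmeas G V -> Gmeas G (F V).
  by move=> mV; apply: GmeasM => //; exact: (Gmeas_comp (h := Num.norm)).
have F2 (V : T -> R) w : F V w ^+ 2 = V w ^+ 4.
  by rewrite /F exprMn -normrX ger0_norm ?sqr_ge0//; ring.
have BC V : Bd V -> Bd (fun w => F V w - mean (F V)).
  by move=> BV; apply: BdD; [exact: BF|exact: Bd_cst].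
have M0 V : Bd V -> mean (fun w => F V w - mean (F V)) = 0.
  by move=> BV; rewrite mean_center//; exact/Bd_L1/BF.
have GC G V : Gmeas G V -> Gmeas G (fun w => F V w - mean (F V)).
  by move=> mV; apply: GmeasB; [exact: mF|exact: Gmeas_cst].
(* Centering [F V] costs at most [(E V^2)^2], because [|F V| = V^2]; this is the source of the
   squared second moments in the bound. *)
have low V : Bd V -> mean (fun w => V w ^+ 4) - mean (fun w => V w ^+ 2) ^+ 2 <=
    mean (fun w => (F V w - mean (F V)) ^+ 2).
  move=> BV; rewrite mean_center_sqr; last exact/Bd_L2/BF.
  rewrite (eq_mean _ (F2 V)) lerD2l lerN2 -real_normK ?num_real//.
  rewrite ler_pXn2r ?nnegrE ?normr_ge0//; last by apply: mean_ge0 => w; exact: sqr_ge0.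
  apply: mean_norm_le; [exact/Bd_L1/BF|exact/Bd_L1/BdX|].
  by move=> w; rewrite /F normrM normr_id -expr2 -normrX ger0_norm ?sqr_ge0.
have := rho _ _ (GC _ _ mU) (GC _ _ mW) (Bd_L2 P (BC _ BU)) (Bd_L2 P (BC _ BW))
  (M0 _ BU) (M0 _ BW).
have := mean_sqrB (Bd_L2 P (BC _ BU)) (Bd_L2 P (BC _ BW)).
rewrite (@eq_mean _ _ _ _ (fun w => (_ - _) ^+ 2) (fun w => ((F U w - F W w) -
    mean (fun w => F U w - F W w)) ^+ 2)); last first.
  by move=> w; rewrite meanB; [congr (_ ^+ 2); ring|exact/Bd_L1/BF|exact/Bd_L1/BF].
rewrite mean_center_sqr; last by apply: Bd_L2; apply: BdD; [|apply: BdN]; exact: BF.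
have := low _ BU; have := low _ BW.
set fu := mean (fun w => (F U w - _) ^+ 2); set fw := mean (fun w => (F W w - _) ^+ 2).
set fuw := mean (fun w => _ * _).
set u2 := mean (fun w => U w ^+ 2); set w2 := mean (fun w => W w ^+ 2).
set u4 := mean (fun w => U w ^+ 4); set w4 := mean (fun w => W w ^+ 4).
move=> loww lowu cov; rewrite ler_norml => /andP[rho1 rho2].
set D := mean (fun w => (U w - W w) ^+ 4).
have r'0 : 0 < 1 - r by lra.
(* The weight of the arithmetic-geometric inequality: [4 / l = (1 - r) / 2], so the fourth moments
   produced on the right are absorbed by half of those on the left. *)
pose l := 8 / (1 - r).
have l0 : 0 < l by rewrite divr_gt0.
have BUW : Bd (fun w => U w - W w) by apply: BdD => //; exact: BdN.
have up : mean (fun w => (F U w - F W w) ^+ 2) <=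
    mean (fun w => l / 2 * (U w - W w) ^+ 4 + 4 / l * (U w ^+ 4 + W w ^+ 4)).
  apply: mean_le.
  - by apply/Bd_L1/BdX; apply: BdD; [exact: BF|apply: BdN; exact: BF].
  - apply: Bd_L1; apply: BdD; apply: BdM; try exact: Bd_cst; first exact: BdX.
    by apply: BdD; exact: BdX.
  move=> w; rewrite /F; set u := U w; set v := W w.
  apply: (@le_trans _ _ ((u - v) ^+ 2 * (`|u| + `|v|) ^+ 2)).
    rewrite -exprMn -real_normK ?num_real// -[leRHS]real_normK ?num_real//.
    rewrite ler_pXn2r ?nnegrE ?normr_ge0// ler_norml normrM.
    rewrite (ger0_norm (addr_ge0 (normr_ge0 u) (normr_ge0 v))).
    by apply/andP; split; case: (ler0P u) => hu; case: (ler0P v) => hv;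
       case: (ler0P (u - v)) => huv; nra.
  have l'0 : 0 < l^-1 by rewrite invr_gt0.
  have li : l * l^-1 = 1 by rewrite mulfV// gt_eqF.
  have H x y : x * y <= l / 2 * x ^+ 2 + l^-1 / 2 * y ^+ 2.
    have : 0 <= l^-1 * (l * x - y) ^+ 2 by rewrite mulr_ge0 ?sqr_ge0// ltW.
    rewrite (_ : _ * _ ^+ 2 = l * l^-1 * (l * x ^+ 2) - 2 * (l * l^-1) * (x * y) + l^-1 * y ^+ 2).
      by rewrite li; lra.
    by ring.
  apply: (le_trans (H _ _)); rewrite -!exprM lerD2l.
  rewrite (_ : 4 / l = l^-1 / 2 * 8); last by field; rewrite gt_eqF.
  rewrite -[leRHS]mulrA ler_pM2l ?divr_gt0//.
  have -> : u ^+ 4 = `|u| ^+ 4 by rewrite -normrX ger0_norm// exprn_even_ge0.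
  have -> : v ^+ 4 = `|v| ^+ 4 by rewrite -normrX ger0_norm// exprn_even_ge0.
  have : 0 <= `|u| by []. have : 0 <= `|v| by [].
  move: `|u| `|v| => a b a0 b0.
  exact: pow4D_le.
have : mean (fun w => l / 2 * (U w - W w) ^+ 4 + 4 / l * (U w ^+ 4 + W w ^+ 4)) =
    l / 2 * D + 4 / l * (u4 + w4).
  rewrite meanD ?meanZ ?meanD//; try exact/Bd_L1/BdX.
    by apply: L1D; exact/Bd_L1/BdX.
  by apply: L1Z; exact/Bd_L1/BdX.
  by apply: L1Z; apply: L1D; exact/Bd_L1/BdX.
move=> upE; rewrite {}upE in up.
have h8 : mean (fun w => (U w + W w) ^+ 4) <= 8 * (u4 + w4).
  rewrite -meanD; [|exact/Bd_L1/BdX|exact/Bd_L1/BdX].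
  rewrite -meanZ; last by apply: L1D; exact/Bd_L1/BdX.
  apply: mean_le; first by apply/Bd_L1/BdX; exact: BdD.
    by apply: L1Z; apply: L1D; exact/Bd_L1/BdX.
  by move=> w; exact: pow4D_le.
apply: (le_trans h8).
have sq := sqr_ge0 (mean (fun w => F U w - F W w)).
have l1 : l / 2 = 4 / (1 - r) by rewrite /l; lra.
have l2 : 4 / l = (1 - r) / 2 by rewrite /l; field; rewrite gt_eqF.
rewrite l1 l2 in up.
have main : (1 - r) / 2 * (u4 + w4) <= (1 - r) * (u2 ^+ 2 + w2 ^+ 2) + 4 / (1 - r) * D.
  have := ler_wpM2l (ltW r'0) (lerD lowu loww).
  move: (4 / (1 - r) * D) up cov rho2 sq => z.
  move: (mean (fun w => _ ^+ 2)) (mean (fun w => F U w - F W w) ^+ 2) => A m up cov.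
  move: fu fw fuw {loww lowu rho1 h8} cov => x y v cov rho2 sq.
  move: (u2 ^+ 2) (w2 ^+ 2) u4 w4 up => a b c e up.
  by clear -up cov rho2 sq; lra.
have r''0 : 0 < (1 - r)^-1 by rewrite invr_gt0.
have := ler_wpM2l (ltW r''0) main.
rewrite (_ : (1 - r)^-1 * ((1 - r) / 2 * (u4 + w4)) = (u4 + w4) / 2); last first.
  by field; rewrite gt_eqF.
rewrite (_ : (1 - r)^-1 * ((1 - r) * (u2 ^+ 2 + w2 ^+ 2) + 4 / (1 - r) * D) =
    u2 ^+ 2 + w2 ^+ 2 + 4 / (1 - r) ^+ 2 * D); last first.
  by field; rewrite gt_eqF.
rewrite (_ : 64 / _ * D = 16 * (4 / (1 - r) ^+ 2 * D)); last by ring.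
move: (4 / _ * D) (u2 ^+ 2) (w2 ^+ 2) (u4) (w4) => z a b c e.
by clear; lra.
Qed.

(* The signs are chosen one at a time: the two choices average to the bound, so
   one of them satisfies it. *)
Lemma signs_sqr (I : eqType) (s : seq I) (Y : I -> T -> R) (W : T -> R) :
  uniq s -> L2 W -> (forall i, i \in s -> L2 (Y i)) ->
  exists A : pred I,
    mean (fun w => (W w + \sum_(i <- s) (if A i then Y i w else - Y i w)) ^+ 2) <=
    mean (fun w => W w ^+ 2) + \sum_(i <- s) mean (fun w => Y i w ^+ 2).
Proof.
elim: s W => [|i s IH] W /=.
  move=> _ W2 _; exists xpredT; rewrite big_nil addr0.
  by under eq_fun do rewrite big_nil addr0.
move=> /andP[nis us] W2 Y2.
have Yi2 : L2 (Y i) by apply: Y2; rewrite mem_head.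
have [b bE] : exists b : bool,
    mean (fun w => (W w + (if b then Y i w else - Y i w)) ^+ 2) <=
    mean (fun w => W w ^+ 2) + mean (fun w => Y i w ^+ 2).
  have := mean_sqrD W2 Yi2; have := mean_sqrB W2 Yi2.
  set c := mean (fun w => W w * Y i w) => eB eD.
  have [c0|c0] := leP c 0; first by exists true; rewrite eD; lra.
  by exists false; rewrite eB; lra.
have W'2 : L2 (fun w => W w + (if b then Y i w else - Y i w)).
  by apply: L2D => //; case: {bE} b => //; exact: L2N.
have [|A AE] := IH _ us W'2; first by move=> j js; apply: Y2; rewrite inE js orbT.
exists (fun j => if j == i then b else A j).
rewrite big_cons addrA; apply: le_trans (lerD bE (lexx _)).
apply: le_trans AE; rewrite le_eqVlt; apply/orP; left; apply/eqP.
apply: eq_mean => w; congr (_ ^+ 2); rewrite big_cons eqxx addrA; congr (_ + _).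
apply: eq_big_seq => j js; case: eqP => // ji.
by rewrite -ji js in nis.
Qed.

(** The average over independent fair signs is [W^4 + 6 W^2 Q + 3 Q^2 - 2 \sum Y_i^4] with
    [Q = \sum Y_i^2]. Without the last sum it becomes a potential that does not increase on average
    as the signs are fixed one at a time. *)
Lemma signs_pow4 (I : eqType) (s : seq I) (Y : I -> T -> R) (W : T -> R) :
  uniq s -> Bd W -> (forall i, i \in s -> Bd (Y i)) ->
  exists A : pred I,
    mean (fun w => (W w + \sum_(i <- s) (if A i then Y i w else - Y i w)) ^+ 4) <=
    mean (fun w => W w ^+ 4 + 6 * (W w ^+ 2 * \sum_(i <- s) Y i w ^+ 2) +
                   3 * (\sum_(i <- s) Y i w ^+ 2) ^+ 2).
Proof.
elim: s W => [|i s IH] W /=.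
  move=> _ W2 _; exists xpredT; rewrite le_eqVlt; apply/orP; left; apply/eqP.
  by apply: eq_mean => w; rewrite !big_nil; ring.
move=> /andP[nis us] BW BY.
have BYi : Bd (Y i) by apply: BY; rewrite mem_head.
pose Q w := \sum_(j <- s) Y j w ^+ 2.
have BQ : Bd Q.
  by apply: Bd_sum => j js _; apply: BdX; apply: BY; rewrite inE js orbT.
pose Phi (V : T -> R) w := V w ^+ 4 + 6 * (V w ^+ 2 * Q w) + 3 * Q w ^+ 2.
have BPhi V : Bd V -> Bd (Phi V).
  move=> BV; apply: BdD; [apply: BdD|]; first exact: BdX.
    by apply: BdM; [exact: Bd_cst|apply: BdM => //; exact: BdX].
  by apply: BdM; [exact: Bd_cst|exact: BdX].
set rhs := mean _.
have BYn : Bd (fun w => W w + - Y i w) by apply: BdD => //; exact: BdN.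
have [b bE] : exists b : bool,
    mean (Phi (fun w => W w + (if b then Y i w else - Y i w))) <= rhs.
  have : mean (Phi (fun w => W w + Y i w)) + mean (Phi (fun w => W w + - Y i w)) <=
      2 * rhs.
    have Brhs : Bd (fun w => W w ^+ 4 + 6 * (W w ^+ 2 * \sum_(i <- i :: s) Y i w ^+ 2) +
                   3 * (\sum_(i <- i :: s) Y i w ^+ 2) ^+ 2).
      under eq_fun do rewrite big_cons.
      have BQ' : Bd (fun w => Y i w ^+ 2 + Q w) by apply: BdD => //; exact: BdX.
      apply: BdD; [apply: BdD|]; first exact: BdX.
        by apply: BdM; [exact: Bd_cst|apply: BdM => //; exact: BdX].
      by apply: BdM; [exact: Bd_cst|exact: BdX].
    rewrite -meanD; [|exact/Bd_L1/BPhi/BdD|exact/Bd_L1/BPhi].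
    rewrite -meanZ; last exact: Bd_L1.
    apply: mean_le.
    - by apply: Bd_L1; apply: BdD; apply: BPhi => //; exact: BdD.
    - by apply: L1Z; exact: Bd_L1.
    move=> w; rewrite /Phi !big_cons -/(Q w); move: (W w) (Y i w) => x y.
    have : 0 <= y ^+ 4 by rewrite exprn_even_ge0.
    by move: (Q w) => q; rewrite -subr_ge0 => y4; rewrite -subr_ge0; lra.
  have [h|h] := leP (mean (Phi (fun w => W w + Y i w))) rhs; first by exists true.
  by exists false; lra.
have W'2 : Bd (fun w => W w + (if b then Y i w else - Y i w)).
  by case: {bE} b => //; exact: BdD.
have [|A AE] := IH _ us W'2; first by move=> j js; apply: BY; rewrite inE js orbT.
exists (fun j => if j == i then b else A j).
apply: le_trans bE; apply: le_trans AE; rewrite le_eqVlt; apply/orP; left; apply/eqP.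
apply: eq_mean => w; congr (_ ^+ 4); rewrite big_cons eqxx addrA; congr (_ + _).
apply: eq_big_seq => j js; case: eqP => // ji.
by rewrite -ji js in nis.
Qed.

End rosenthal.

Lemma sqr_sum_le (R : realFieldType) (I : Type) (s : seq I) (a : I -> R) :
  (\sum_(i <- s) a i) ^+ 2 <= (size s)%:R * \sum_(i <- s) a i ^+ 2.
Proof.
elim: s => [|i s IH]; first by rewrite !big_nil expr0n mul0r.
rewrite !big_cons /= -natr1.
move: IH; case: s => [|j s]; first by rewrite !big_nil /=; lra.
set S := \sum_(i <- _) _; set Q := \sum_(i <- _) _.
set n := (size _)%:R => IH.
have n0 : 0 < n by rewrite ltr0n.
suff : 2 * (a i * S) <= n * a i ^+ 2 + Q by lra.
rewrite -(ler_pM2l n0); have := sqr_ge0 (n * a i - S); lra.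
Qed.

Lemma pow4_sum_le (R : realFieldType) (I : Type) (s : seq I) (a : I -> R) :
  (\sum_(i <- s) a i) ^+ 4 <= (size s)%:R ^+ 3 * \sum_(i <- s) a i ^+ 4.
Proof.
have n0 : 0 <= (size s)%:R :> R by [].
have h1 := sqr_sum_le s a; have h2 := sqr_sum_le s (fun i => a i ^+ 2).
have e4 : \sum_(i <- s) a i ^+ 4 = \sum_(i <- s) (a i ^+ 2) ^+ 2.
  by apply: eq_bigr => i _; rewrite -exprM.
rewrite (_ : _ ^+ 4 = ((\sum_(i <- s) a i) ^+ 2) ^+ 2); last by rewrite -exprM.
apply: (@le_trans _ _ (((size s)%:R * \sum_(i <- s) a i ^+ 2) ^+ 2)).
  rewrite ler_pXn2r// ?nnegrE ?sqr_ge0// mulr_ge0// sumr_ge0// => i _.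
  exact: sqr_ge0.
by rewrite exprMn e4 (exprSr _ 2) -mulrA ler_wpM2l ?sqr_ge0.
Qed.

Lemma sum_fibers (V : nmodType) (I J : eqType) (S : seq I) (s : seq J)
    (h : I -> J) (F : I -> V) :
  uniq s -> (forall k, k \in S -> h k \in s) ->
  \sum_(k <- S) F k = \sum_(j <- s) \sum_(k <- S | h k == j) F k.
Proof.
move=> us hS.
under [RHS]eq_bigr do rewrite big_mkcond.
rewrite exchange_big /=; apply: eq_big_seq => k kS.
rewrite (bigD1_seq (h k)) ?hS//= eqxx big1 ?addr0// => j.
by rewrite eq_sym => /negbTE ->.
Qed.

Lemma sum_sqr_le_sqr_sum (R : realDomainType) (I : Type) (s : seq I)
    (a : I -> R) : (forall i, 0 <= a i) ->
  \sum_(i <- s) a i ^+ 2 <= (\sum_(i <- s) a i) ^+ 2.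
Proof.
move=> a0; elim: s => [|i s IH]; first by rewrite !big_nil expr0n.
rewrite !big_cons; have := a0 i; have : 0 <= \sum_(j <- s) a j by exact: sumr_ge0.
by move: IH; move: (\sum_(j <- s) _) (\sum_(j <- s) _) (a i) => x y z; nra.
Qed.

(** * Moment bounds for families with correlations bounded away from 1 *)

Section family.
Context {R : realType} {disp : measure_display} {T : measurableType disp}.
Variable P : probability T R.

Local Notation mean := (mean P).
Local Notation L1 := (L1 P).
Local Notation L2 := (L2 P).

Lemma mean_sum_center_sqr (I : eqType) (s : seq I) (Z : I -> T -> R) :
  (forall i, i \in s -> L2 (Z i)) ->
  mean (fun w => (\sum_(i <- s) Z i w) ^+ 2) =
  mean (fun w => (\sum_(i <- s) (Z i w - mean (Z i))) ^+ 2) +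
  (\sum_(i <- s) mean (Z i)) ^+ 2.
Proof.
move=> Z2; pose S w := \sum_(i <- s) Z i w.
have S2 : L2 S by apply: L2_sum => i js _; exact: Z2.
have mS : mean S = \sum_(i <- s) mean (Z i).
  by rewrite mean_sum// => i js _; exact/L2_L1/Z2.
have -> : (fun w => (\sum_(i <- s) (Z i w - mean (Z i))) ^+ 2) =
    (fun w => (S w - mean S) ^+ 2).
  by apply/funext => w; rewrite sumrB mS.
by rewrite mean_center_sqr// -mS subrK.
Qed.

Variables (I : eqType) (s : seq I) (Y : I -> T -> R).
Variables (G : pred I -> set (set T)) (r : R).
Hypothesis us : uniq s.
Hypothesis r01 : 0 <= r < 1.
Hypothesis rhoG : forall A, has A s -> has (predC A) s ->
  rho_pair P r (G A) (G (predC A)).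

Section sqr.
Variable Z : I -> T -> R.
Hypothesis mZ : forall (A : pred I) i, i \in s -> A i -> Gmeas (G A) (Z i).
Hypothesis Z2 : forall i, i \in s -> L2 (Z i).
Hypothesis Z0 : forall i, i \in s -> mean (Z i) = 0.

Let U (A : pred I) w := \sum_(i <- s | A i) Z i w.

Lemma splitD A w : U A w + U (predC A) w = \sum_(i <- s) Z i w.
Proof. by rewrite [RHS](bigID A). Qed.

Lemma splitB A w : U A w - U (predC A) w =
  \sum_(i <- s) (if A i then Z i w else - Z i w).
Proof.
rewrite [RHS](bigID A) /=; congr (_ + _).
  by apply: eq_bigr => i ->.
by rewrite /U -sumrN; apply: eq_bigr => i /negbTE ->.
Qed.

Let U2 A : L2 (U A).
Proof. by apply: L2_sum => i js _; exact: Z2. Qed.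

Lemma family_cov A : `|mean (fun w => U A w * U (predC A) w)| <=
    r / 2 * (mean (fun w => U A w ^+ 2) + mean (fun w => U (predC A) w ^+ 2)).
Proof.
have r0 : 0 <= r / 2 by case/andP: r01 => ? _; lra.
have rhs0 : 0 <= r / 2 * (mean (fun w => U A w ^+ 2) + mean (fun w => U (predC A) w ^+ 2)).
  by rewrite mulr_ge0// addr_ge0//; apply: mean_ge0 => w; exact: sqr_ge0.
(* The correlation hypothesis has no instance for an empty class, but then the product vanishes. *)
have U0 B : ~~ has B s -> forall w, U B w = 0.
  by move=> /hasPn Bs w; rewrite /U big_seq_cond big1// => i /andP[/Bs /negbTE ->].
have [As|/U0 As] := boolP (has A s); last first.
  rewrite (@eq_mean _ _ _ _ _ (fun=> 0)) ?mean_cst ?normr0// => w.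
  by rewrite As mul0r.
have [Bs|/U0 Bs] := boolP (has (predC A) s); last first.
  rewrite (@eq_mean _ _ _ _ _ (fun=> 0)) ?mean_cst ?normr0// => w.
  by rewrite Bs mulr0.
have mU B : Gmeas (G B) (U B) by apply: Gmeas_sum => i js Bi; exact: mZ.
have mU0 B : mean (U B) = 0.
  rewrite mean_sum; last by move=> i js _; exact/L2_L1/Z2.
  by rewrite big_seq_cond big1// => i /andP[js _]; exact: Z0.
exact: (rhoG As Bs (mU A) (mU _) (U2 A) (U2 _) (mU0 A) (mU0 _)).
Qed.

(** The classes of positive and of negative signs play the roles of [U] and [W] in
    [two_point_sqr]. *)
Lemma family_sqr : mean (fun w => (\sum_(i <- s) Z i w) ^+ 2) <=
  (1 + r) / (1 - r) * \sum_(i <- s) mean (fun w => Z i w ^+ 2).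
Proof.
have [A AE] := signs_sqr us (L2_cst P 0) Z2.
have h := two_point_sqr r01 (U2 A) (U2 (predC A)) (family_cov A).
rewrite (eq_mean _ (g := (fun w => (U A w + U (predC A) w) ^+ 2))); last first.
  by move=> w; rewrite splitD.
apply: (le_trans h); rewrite ler_wpM2l//.
  by case/andP: r01 => ? ?; rewrite divr_ge0//; lra.
move: AE; rewrite (_ : mean (fun=> 0 ^+ 2) = 0) ?add0r; last first.
  by rewrite expr0n mean_cst.
apply: le_trans; rewrite le_eqVlt; apply/orP; left; apply/eqP.
by apply: eq_mean => w; rewrite splitB add0r.
Qed.

End sqr.

(** Setting the other variables to 0 keeps the hypotheses of [family_sqr]. This serves for the
    second moments of the two sign classes in [family_pow4]. *)
Lemma family_sub_sqr (Z : I -> T -> R) (B : pred I) :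
  (forall (A : pred I) i, i \in s -> A i -> Gmeas (G A) (Z i)) ->
  (forall i, i \in s -> L2 (Z i)) -> (forall i, i \in s -> mean (Z i) = 0) ->
  mean (fun w => (\sum_(i <- s | B i) Z i w) ^+ 2) <=
  (1 + r) / (1 - r) * \sum_(i <- s) mean (fun w => Z i w ^+ 2).
Proof.
move=> mZ Z2 Z0; pose Z' i w := if B i then Z i w else 0.
have := @family_sqr Z'; rewrite (_ : (fun w => (\sum_(i <- s) Z' i w) ^+ 2) =
    (fun w => (\sum_(i <- s | B i) Z i w) ^+ 2)); last first.
  by apply/funext => w; rewrite [in RHS]big_mkcond.
have [r0 r1] := andP r01.
move=> h; apply: (le_trans (h _ _ _)).
- move=> A i js Ai; rewrite /Z'; case: (B i); last exact: Gmeas_cst.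
  exact: mZ.
- by move=> i js; rewrite /Z'; case: (B i); [exact: Z2|exact: L2_cst].
- by move=> i js; rewrite /Z'; case: (B i); [exact: Z0|exact: mean_cst].
rewrite ler_wpM2l ?divr_ge0//; [lra|lra|].
apply: ler_sum => i _; rewrite /Z'; case: (B i) => //=.
by rewrite expr0n mean_cst; apply: mean_ge0 => w; exact: sqr_ge0.
Qed.

Hypothesis mY : forall (A : pred I) i, i \in s -> A i -> Gmeas (G A) (Y i).
Hypothesis BY : forall i, i \in s -> Bd (Y i).
Hypothesis Y0 : forall i, i \in s -> mean (Y i) = 0.

Lemma family_pow4 : mean (fun w => (\sum_(i <- s) Y i w) ^+ 4) <=
  400 / (1 - r) ^+ 3 * (\sum_(i <- s) mean (fun w => Y i w ^+ 4) +
    (\sum_(i <- s) mean (fun w => Y i w ^+ 2)) ^+ 2).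
Proof.
have Y2 i : i \in s -> L2 (Y i) by move=> js; exact/Bd_L2/BY.
have [A AE] := signs_pow4 P us (Bd_cst 0) BY.
pose U (A : pred I) w := \sum_(i <- s | A i) Y i w.
have BU B : Bd (U B) by apply: Bd_sum => i js _; exact: BY.
have {}AE : mean (fun w => (U A w - U (predC A) w) ^+ 4) <=
    3 * mean (fun w => (\sum_(i <- s) Y i w ^+ 2) ^+ 2).
  rewrite -meanZ; last first.
    by apply/Bd_L1/BdX; apply: Bd_sum => i js _; exact/BdX/BY.
  rewrite (eq_mean _ (g := fun w => (0 + \sum_(i <- s) (if A i then Y i w else - Y i w)) ^+ 4)).
    apply: (le_trans AE); rewrite le_eqVlt; apply/orP; left; apply/eqP.
    by apply: eq_mean => w; rewrite !expr0n /=; ring.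
  by move=> w; rewrite splitB add0r.
set V := \sum_(i <- s) mean (fun w => Y i w ^+ 2).
set F := \sum_(i <- s) mean (fun w => Y i w ^+ 4).
have V0 : 0 <= V by apply: sumr_ge0 => i _; apply: mean_ge0 => w; exact: sqr_ge0.
have F0 : 0 <= F.
  by apply: sumr_ge0 => i _; apply: mean_ge0 => w; rewrite exprn_even_ge0.
have [r0 r1] := andP r01.
have r'0 : 0 < 1 - r by lra.
(* The choice of signs leaves the second moment of the sum of squares: [family_sqr] treats the
   centered squares, and the squared mean contributes [V ^+ 2]. *)
have sqY : mean (fun w => (\sum_(i <- s) Y i w ^+ 2) ^+ 2) <=
    (1 + r) / (1 - r) * F + V ^+ 2.
  rewrite mean_sum_center_sqr; last by move=> i js; exact/Bd_L2/BdX/BY.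
  rewrite -/V lerD2r.
  apply: (@le_trans _ _ ((1 + r) / (1 - r) *
     \sum_(i <- s) mean (fun w => (Y i w ^+ 2 - mean (fun w => Y i w ^+ 2)) ^+ 2))).
    apply: (@family_sqr (fun i w => Y i w ^+ 2 - mean (fun w => Y i w ^+ 2))).
    - move=> B i js Bi; apply: GmeasB; last exact: Gmeas_cst.
      by rewrite (_ : (fun w => _) = (fun w => Y i w * Y i w))//; apply: GmeasM; exact: mY.
    - by move=> i js; apply: L2B; [exact/Bd_L2/BdX/BY|exact: L2_cst].
    - by move=> i js; apply: mean_center; exact/Bd_L1/BdX/BY.
  rewrite ler_wpM2l ?divr_ge0//; [lra|lra|].
  rewrite /F big_seq [leRHS]big_seq; apply: ler_sum => i js.
  rewrite mean_center_sqr; last exact/Bd_L2/BdX/BY.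
  rewrite (eq_mean _ (g := fun w => Y i w ^+ 4)) ?gerBl ?sqr_ge0//.
  by move=> w; rewrite -exprM.
have key : mean (fun w => (\sum_(i <- s) Y i w) ^+ 4) <=
    16 * (2 * ((1 + r) / (1 - r) * V) ^+ 2) +
    64 / (1 - r) ^+ 2 * mean (fun w => (U A w - U (predC A) w) ^+ 4).
  have m40 : 0 <= mean (fun w => (U A w - U (predC A) w) ^+ 4).
    by apply: mean_ge0 => w; rewrite exprn_even_ge0.
  (* If all signs agree, one class is empty and the signed sum is the sum itself up to sign. *)
  have triv : mean (fun w => (\sum_(i <- s) Y i w) ^+ 4) =
      mean (fun w => (U A w - U (predC A) w) ^+ 4) ->
      mean (fun w => (\sum_(i <- s) Y i w) ^+ 4) <=
    16 * (2 * ((1 + r) / (1 - r) * V) ^+ 2) +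
    64 / (1 - r) ^+ 2 * mean (fun w => (U A w - U (predC A) w) ^+ 4).
    move=> ->; apply: ler_wpDl; first by do 2 apply: mulr_ge0 => //; exact: sqr_ge0.
    apply: ler_peMl => //; rewrite ler_pdivlMr ?exprn_gt0// mul1r.
    by nra.
  have U0 B : ~~ has B s -> forall w, U B w = 0.
    by move=> /hasPn Bs w; rewrite /U big_seq_cond big1// => i /andP[/Bs /negbTE ->].
  have [As|/U0 As] := boolP (has A s); last first.
    apply: triv; apply: eq_mean => w; rewrite As sub0r exprNn -signr_odd mul1r.
    by rewrite -(splitD Y A) -/(U A w) As add0r.
  have [Bs|/U0 Bs] := boolP (has (predC A) s); last first.
    apply: triv; apply: eq_mean => w; rewrite Bs subr0.
    by rewrite -(splitD Y A) -/(U _ w) -/(U (predC A) w) Bs addr0.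
  have mU B : Gmeas (G B) (U B) by apply: Gmeas_sum => i js Bi; exact: mY.
  have := two_point_pow4 r01 (BU A) (BU (predC A)) (mU A) (mU (predC A)) (rhoG As Bs).
  rewrite (eq_mean _ (g := fun w => (\sum_(i <- s) Y i w) ^+ 4)); last first.
    by move=> w; rewrite splitD.
  move=> /le_trans; apply; rewrite lerD2r ler_wpM2l//.
  have sub B : mean (fun w => U B w ^+ 2) ^+ 2 <= ((1 + r) / (1 - r) * V) ^+ 2.
    rewrite ler_pXn2r ?nnegrE//.
    - exact: family_sub_sqr.
    - by apply: mean_ge0 => w; exact: sqr_ge0.
    - by rewrite mulr_ge0 ?divr_ge0//; lra.
  by have := sub A; have := sub (predC A); lra.
apply: (le_trans key).
(* As [1 + r <= 2], the estimates add up to at most [384 a^3 F + 320 a^3 V^2]; 400 is a round bound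
   for both coefficients. *)
set a := (1 - r)^-1.
have a0 : 1 <= a by rewrite /a invf_ge1//; lra.
have ka : (1 + r) / (1 - r) <= 2 * a by rewrite -/a ler_wpM2r//; lra.
have k0 : 0 <= (1 + r) / (1 - r) by rewrite divr_ge0//; lra.
have -> : 64 / (1 - r) ^+ 2 = 64 * a ^+ 2 by rewrite exprVn.
have -> : 400 / (1 - r) ^+ 3 = 400 * a ^+ 3 by rewrite exprVn.
have k2 : ((1 + r) / (1 - r) * V) ^+ 2 <= 4 * a ^+ 2 * V ^+ 2.
  rewrite exprMn ler_wpM2r ?sqr_ge0// (_ : 4 * _ = (2 * a) ^+ 2); last by ring.
  by rewrite ler_pXn2r ?nnegrE//; lra.
have kF : (1 + r) / (1 - r) * F <= 2 * a * F by rewrite ler_wpM2r.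
have a2 : 0 <= a ^+ 2 by exact: sqr_ge0.
have h1 : 64 * a ^+ 2 * mean (fun w => (U A w - U (predC A) w) ^+ 4) <=
    64 * a ^+ 2 * (3 * (2 * a * F + V ^+ 2)).
  by rewrite ler_wpM2l ?mulr_ge0//; lra.
have h2 : a ^+ 2 * V ^+ 2 <= a ^+ 3 * V ^+ 2.
  by rewrite ler_wpM2r ?sqr_ge0// (exprSr a 2) ler_peMr.
have h3 : 0 <= a ^+ 3 * F by rewrite mulr_ge0// exprn_ge0; lra.
have h4 : 0 <= a ^+ 3 * V ^+ 2 by rewrite mulr_ge0 ?sqr_ge0// exprn_ge0; lra.
move: k2 h1 h2 h3 h4; rewrite !mulrDr.
have -> : 64 * a ^+ 2 * (3 * (2 * a * F)) = 384 * (a ^+ 3 * F) by ring.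
have -> : 64 * a ^+ 2 * (3 * V ^+ 2) = 192 * (a ^+ 2 * V ^+ 2) by ring.
have -> : 400 * a ^+ 3 * F = 400 * (a ^+ 3 * F) by ring.
have -> : 400 * a ^+ 3 * V ^+ 2 = 400 * (a ^+ 3 * V ^+ 2) by ring.
have -> : 4 * a ^+ 2 * V ^+ 2 = 4 * (a ^+ 2 * V ^+ 2) by ring.
move: (64 * a ^+ 2 * _) (_ ^+ 2) (a ^+ 2 * _) (a ^+ 3 * _) (a ^+ 3 * _).
by move=> x y z u v; lra.
Qed.

End family.

(** The generating system of [sigma_field X Q], in the form taken by [Gmeas] and [rho_pair]. *)
Definition gen (R : realType) (T : Type) (d : nat) (X : lattice d -> T -> R)
    (Q : set (lattice d)) : set (set T) :=
  \bigcup_(k in Q) preimage_set_system setT (X k) measurable.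

Lemma gen_sub (R : realType) (T : Type) (d : nat) (X : lattice d -> T -> R)
  (Q1 Q2 : set (lattice d)) : Q1 `<=` Q2 -> gen X Q1 `<=` gen X Q2.
Proof. by move=> Q12; exact: bigcup_subset. Qed.

(** * Well separated sites: induction over the directions *)

Section lattice_moments.
Context {R : realType} {disp : measure_display} {T : measurableType disp}.
Variable P : probability T R.

Local Notation mean := (mean P).
Local Notation L2 := (L2 P).

(** The recursion of [spread_pow4] over the directions: the constant of [family_pow4] is applied to
    slab sums, whose fourth moments are bounded with the previous constant and whose second moments
    with [((1 + r) / (1 - r)) ^+ n']. *)
Fixpoint pow4_const (r : R) (n : nat) : R :=
  if n is n'.+1 then
    400 / (1 - r) ^+ 3 * (pow4_const r n' + (((1 + r) / (1 - r)) ^+ n') ^+ 2)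
  else 1.

Variables (d : nat) (X xi : lattice d -> T -> R) (m : nat) (r : R).
Hypothesis m_gt0 : (0 < m)%N.
Hypothesis r01 : 0 <= r < 1.
Hypothesis rhoX : (rho'_field P X m <= r%:E)%E.
Hypothesis mxi : forall k, Gmeas (gen X [set k]) (xi k).

Lemma pow4_const_ge0 n : 0 <= pow4_const r n.
Proof.
have [r0 r1] := andP r01.
elim: n => [|n IH]; first exact: ler01.
apply: mulr_ge0; last by rewrite addr_ge0 ?sqr_ge0.
by apply: divr_ge0; [exact: ler0n|rewrite exprn_ge0//; lra].
Qed.

Definition spread (S : seq (lattice d)) := forall k l u,
  k \in S -> l \in S -> k u <> l u -> m%:Z <= `|k u - l u|.

(** The induction parameter for the directions: every set is determined by all coordinates, fixing
    the coordinate [u] removes [u] from the list, and the empty list leaves at most one site. *)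
Definition determined (us : seq 'I_d) (S : seq (lattice d)) := forall k l,
  k \in S -> l \in S -> (forall u, u \in us -> k u = l u) -> k = l.

Section slabs.
Variables (u : 'I_d) (S : seq (lattice d)).
Hypothesis sepS : spread S.

Let s := undup [seq k u | k : lattice d <- S].
Let G (A : pred int) := gen X [set k : lattice d | k \in S /\ A (k u)].

(** Any sign pattern over the slabs is admissible because [rho'] lets the two sets of coordinates
    interlace: only their distance counts, and [spread] keeps distinct values at least [m] apart. *)
Lemma rho_pair_slabs (A : pred int) : has A s -> has (predC A) s ->
  rho_pair P r (G A) (G (predC A)).
Proof.
move=> /hasP[j js Aj] /hasP[j' js' Aj'].
have [r0 r1] := andP r01.
have sS i : i \in s -> exists2 k, k \in S & k u = i.
  by rewrite mem_undup => /mapP[k kS ->]; exists k.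
apply: rho_coef_pair => //; apply: le_trans rhoX; apply: ereal_sup_ubound.
have [k kS kj] := sS _ js; have [k' kS' kj'] := sS _ js'.
have fin (Q : pred (lattice d)) : finite_set [set k | k \in S /\ Q k].
  apply: (@sub_finite_set _ _ [set` S]); last exact: finite_seq.
  by move=> l [].
exists ([set k : lattice d | k \in S /\ A (k u)],
        [set k : lattice d | k \in S /\ predC A (k u)]) => //=.
split.
- by split; [exists k; rewrite /= kj|exists k'; rewrite /= kj'].
- by split; exact: fin.
- by apply/seteqP; split => // l [[_ Al] [_ /negP]].
exists u, [set i | i \in s /\ A i], [set i | i \in s /\ ~~ A i]; split.
  split; [by exists j|by exists j'|].
  by apply/seteqP; split => // l [[_ Al] [_ /negP]].
split.
- move=> a b [/sS[ka kaS <-] Aa] [/sS[kb kbS <-] Ab]; apply: sepS => //.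
  by move=> ab; rewrite -ab Aa in Ab.
- by move=> l [lS Al] /=; rewrite mem_undup; split => //; exact: map_f.
- by move=> l [lS Al] /=; rewrite mem_undup; split => //; exact: map_f.
Qed.

Lemma Gmeas_slab (f : lattice d -> T -> R) (A : pred int) i :
  (forall k, Gmeas (gen X [set k]) (f k)) -> A i ->
  Gmeas (G A) (fun w => \sum_(k <- S | k u == i) f k w).
Proof.
move=> mf Ai; apply: Gmeas_sum => k kS /eqP ki; apply: Gmeas_sub (mf k).
by apply: gen_sub => _ ->; rewrite /= ki.
Qed.

End slabs.

Lemma spread_filter A S : spread S -> spread [seq k <- S | A k].
Proof.
by move=> sS k l u; rewrite !mem_filter => /andP[_ kS] /andP[_ lS]; exact: sS.
Qed.

Lemma determined_filter u us S i :
  determined (u :: us) S -> determined us [seq k : lattice d <- S | k u == i].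
Proof.
move=> dS k l; rewrite !mem_filter => /andP[/eqP ki kS] /andP[/eqP li lS] kl.
apply: dS => // v; rewrite inE => /orP[/eqP ->|]; last exact: kl.
by rewrite ki li.
Qed.

Lemma determined_nil (S : seq (lattice d)) : uniq S -> determined [::] S ->
  (size S <= 1)%N.
Proof.
move=> uS dS; case: S uS dS => [//|k [//|l S]] /= /andP[kS _] dS.
have kl : k = l by apply: dS => //; rewrite !inE eqxx ?orbT.
by rewrite kl mem_head in kS.
Qed.

Lemma slabs_sum (V : nmodType) u (S : seq (lattice d)) (F : lattice d -> V) :
  \sum_(k <- S) F k =
  \sum_(i <- undup [seq k u | k : lattice d <- S]) \sum_(k <- S | k u == i) F k.
Proof.
apply: (sum_fibers (h := fun k : lattice d => k u)) => [|k kS].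
  exact: undup_uniq.
by rewrite mem_undup; exact: (map_f (fun k : lattice d => k u)).
Qed.

Lemma spread_sqr (us : seq 'I_d) (S : seq (lattice d)) :
  uniq S -> spread S -> determined us S ->
  (forall k, k \in S -> L2 (xi k)) -> (forall k, k \in S -> mean (xi k) = 0) ->
  mean (fun w => (\sum_(k <- S) xi k w) ^+ 2) <=
  ((1 + r) / (1 - r)) ^+ size us * \sum_(k <- S) mean (fun w => xi k w ^+ 2).
Proof.
have [r0 r1] := andP r01.
have kr0 : 0 <= (1 + r) / (1 - r) by rewrite divr_ge0//; lra.
elim: us S => [|u us IH] S uS sS dS xi2 xi0.
  have := determined_nil uS dS.
  case: S {uS sS dS xi2 xi0} => [|k [|//]] _.
    by under eq_fun do rewrite big_nil expr0n; rewrite mean_cst big_nil mulr0.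
  by under eq_fun do rewrite big_seq1; rewrite big_seq1 mul1r.
under eq_fun do rewrite (slabs_sum u).
have := @family_sqr _ _ _ P _ _ _ _ (undup_uniq _) r01 (rho_pair_slabs (u := u) sS)
  (fun i w => \sum_(k <- S | k u == i) xi k w).
move=> h; apply: (le_trans (h _ _ _)).
- by move=> A i _ Ai; exact: Gmeas_slab.
- by move=> i _; apply: L2_sum => k kS _; exact: xi2.
- move=> i _; rewrite mean_sum; last by move=> k kS _; exact/L2_L1/xi2.
  by rewrite big_seq_cond big1// => k /andP[kS _]; exact: xi0.
set kap := (1 + r) / (1 - r) in kr0 IH *.
rewrite exprS -mulrA ler_wpM2l// [in leRHS](slabs_sum u) mulr_sumr.
apply: ler_sum => i _; under eq_fun do rewrite -big_filter.
rewrite -[in leRHS]big_filter; apply: IH.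
- exact: filter_uniq.
- exact: spread_filter.
- exact: determined_filter dS.
- by move=> k; rewrite mem_filter => /andP[_]; exact: xi2.
- by move=> k; rewrite mem_filter => /andP[_]; exact: xi0.
Qed.

(** The form of the bound, fourth moments plus squared variance, reproduces itself in the induction
    because the squared slab variances add up to at most the square of the total. *)
Lemma spread_pow4 (us : seq 'I_d) (S : seq (lattice d)) :
  uniq S -> spread S -> determined us S ->
  (forall k, k \in S -> Bd (xi k)) -> (forall k, k \in S -> mean (xi k) = 0) ->
  mean (fun w => (\sum_(k <- S) xi k w) ^+ 4) <= pow4_const r (size us) *
    (\sum_(k <- S) mean (fun w => xi k w ^+ 4) +
     (\sum_(k <- S) mean (fun w => xi k w ^+ 2)) ^+ 2).
Proof.
have [r0 r1] := andP r01.
have kr0 : 0 <= (1 + r) / (1 - r) by rewrite divr_ge0//; lra.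
elim: us S => [|u us IH] S uS sS dS Bxi xi0.
  have := determined_nil uS dS.
  case: S {uS sS dS Bxi xi0} => [|k [|//]] _.
    under eq_fun do rewrite big_nil expr0n.
    by rewrite mean_cst !big_nil expr0n addr0 mulr0.
  under eq_fun do rewrite big_seq1.
  by rewrite !big_seq1 mul1r lerDl sqr_ge0.
under eq_fun do rewrite (slabs_sum u).
have := @family_pow4 _ _ _ P _ _ (fun i w => \sum_(k <- S | k u == i) xi k w)
  _ _ (undup_uniq _) r01 (rho_pair_slabs (u := u) sS).
move=> h; apply: (le_trans (h _ _ _)).
- by move=> A i _ Ai; exact: Gmeas_slab.
- by move=> i _; apply: Bd_sum => k kS _; exact: Bxi.
- move=> i _; rewrite mean_sum; last by move=> k kS _; exact/Bd_L1/Bxi.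
  by rewrite big_seq_cond big1// => k /andP[kS _]; exact: xi0.
rewrite [pow4_const _ _]/= -[leRHS]mulrA; apply: ler_wpM2l.
  by apply: divr_ge0; [exact: ler0n|rewrite exprn_ge0//; lra].
set s := undup _.
set V2 := \sum_(k <- S) mean (fun w => xi k w ^+ 2).
have V2E : V2 = \sum_(i <- s) \sum_(k <- S | k u == i) mean (fun w => xi k w ^+ 2).
  exact: slabs_sum.
have m2 k : 0 <= mean (fun w => xi k w ^+ 2) by apply: mean_ge0 => w; exact: sqr_ge0.
have m4 k : 0 <= mean (fun w => xi k w ^+ 4).
  by apply: mean_ge0 => w; rewrite exprn_even_ge0.
have fil i (Q : set (T -> R)) : (forall k, k \in S -> Q (xi k)) ->
    forall k, k \in [seq k : lattice d <- S | k u == i] -> Q (xi k).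
  by move=> hQ k; rewrite mem_filter => /andP[_]; exact: hQ.
set kap := (1 + r) / (1 - r) in kr0 *.
set K := pow4_const r (size us).
have K0 : 0 <= K by exact: pow4_const_ge0.
have S4 : \sum_(i <- s) mean (fun w => (\sum_(k <- S | k u == i) xi k w) ^+ 4) <=
    K * (\sum_(k <- S) mean (fun w => xi k w ^+ 4) + V2 ^+ 2).
  apply: (@le_trans _ _ (\sum_(i <- s) K *
      (\sum_(k <- S | k u == i) mean (fun w => xi k w ^+ 4) +
       (\sum_(k <- S | k u == i) mean (fun w => xi k w ^+ 2)) ^+ 2))).
    apply: ler_sum => i _; under eq_fun do rewrite -big_filter.
    rewrite -[in leRHS]big_filter -[X in _ + X ^+ 2]big_filter; apply: IH.
    - exact: filter_uniq.
    - exact: spread_filter.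
    - exact: determined_filter dS.
    - exact: (fil i (@Bd _ _ _)).
    - exact: (fil i (fun f => mean f = 0)).
  rewrite -mulr_sumr ler_wpM2l// big_split/= -slabs_sum lerD2l V2E.
  by apply: sum_sqr_le_sqr_sum => i; exact: sumr_ge0.
have S2 : (\sum_(i <- s) mean (fun w => (\sum_(k <- S | k u == i) xi k w) ^+ 2)) ^+ 2
    <= (kap ^+ size us) ^+ 2 * V2 ^+ 2.
  rewrite -exprMn ler_pXn2r ?nnegrE//.
  - rewrite V2E mulr_sumr; apply: ler_sum => i _.
    under eq_fun do rewrite -big_filter.
    rewrite -[in leRHS]big_filter; apply: spread_sqr.
    - exact: filter_uniq.
    - exact: spread_filter.
    - exact: determined_filter dS.
    - by apply: (fil i L2) => k kS; exact/Bd_L2/Bxi.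
    - exact: (fil i (fun f => mean f = 0)).
  - by apply: sumr_ge0 => i _; apply: mean_ge0 => w; exact: sqr_ge0.
  - by rewrite mulr_ge0 ?exprn_ge0// sumr_ge0.
have F0 : 0 <= \sum_(k <- S) mean (fun w => xi k w ^+ 4) by exact: sumr_ge0.
have := mulr_ge0 (sqr_ge0 (kap ^+ size us)) F0.
move: S4 S2; move: (\sum_(i <- s) _) (_ ^+ 2) => x y S4 S2 h0.
by apply: (le_trans (lerD S4 S2)); lra.
Qed.

End lattice_moments.

(** * Arbitrary finite sets of sites: residue classes *)

Section lattice_bounds.
Context {R : realType} {disp : measure_display} {T : measurableType disp}.
Variable P : probability T R.

Local Notation mean := (mean P).
Local Notation L2 := (L2 P).

(** The bound [m.-1.+1] is [m] for positive [m] and has the successor form that [inord] requires. *)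
Definition residue (d m : nat) (k : lattice d) : {ffun 'I_d -> 'I_m.-1.+1} :=
  [ffun u => inord `|(k u %% m)%Z|%N].

(** Different coordinates that are congruent modulo [m] differ by a nonzero multiple of [m]. *)
Lemma residue_spread (d m : nat) (S : seq (lattice d)) c : (0 < m)%N ->
  spread m [seq k : lattice d <- S | residue m k == c].
Proof.
move=> m0 k l u; rewrite !mem_filter => /andP[/eqP kc _] /andP[/eqP lc _] kl.
have mz : m%:Z != 0 by rewrite eqz_nat -lt0n.
have mod_lt i : (`|(i %% m)%Z|%N < m.-1.+1)%N.
  by rewrite prednK// -ltz_nat gez0_abs ?modz_ge0// ltz_pmod// ltz_nat.
have : (k u = l u %[mod m])%Z.
  have := congr1 (fun f : {ffun 'I_d -> 'I_m.-1.+1} => f u : nat) (etrans kc (esym lc)).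
  rewrite !ffunE !inordK// => /(congr1 Posz).
  by rewrite !gez0_abs// modz_ge0.
move/eqP; rewrite eqz_mod_dvd => /dvdzP[q qE].
rewrite qE normrM (ger0_norm (le0z_nat m)) ler_peMl//.
have : q != 0 by apply: contra_notN kl => /eqP q0; move: qE; rewrite q0 mul0r => /eqP; rewrite subr_eq0 => /eqP.
by rewrite -normr_gt0; lia.
Qed.

(** The factor [m ^ d] is the number of residue classes and comes from Cauchy-Schwarz over the
    classes; [mom4_const] has its cube because fourth powers are summed. *)
Definition var_const (m d : nat) (r : R) : R :=
  (m ^ d)%:R * ((1 + r) / (1 - r)) ^+ d.

Definition mom4_const (m d : nat) (r : R) : R :=
  (m ^ d)%:R ^+ 3 * pow4_const r d.

Lemma var_const_ge0 m d r : 0 <= r < 1 -> 0 <= var_const m d r.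
Proof.
move=> /andP[r0 r1]; apply: mulr_ge0; first exact: ler0n.
by rewrite exprn_ge0// divr_ge0//; lra.
Qed.

Lemma mom4_const_ge0 m d r : 0 <= r < 1 -> 0 <= mom4_const m d r.
Proof.
move=> r01; apply: mulr_ge0; last exact: pow4_const_ge0.
by apply: exprn_ge0; exact: ler0n.
Qed.

Variables (d : nat) (X xi : lattice d -> T -> R) (m : nat) (r : R).
Hypothesis m_gt0 : (0 < m)%N.
Hypothesis r01 : 0 <= r < 1.
Hypothesis rhoX : (rho'_field P X m <= r%:E)%E.
Hypothesis mxi : forall k, Gmeas (gen X [set k]) (xi k).

Let cls (S : seq (lattice d)) c := [seq k : lattice d <- S | residue m k == c].

Let cls_determined S c : determined (enum 'I_d) (cls S c).
Proof. by move=> k l _ _ kl; apply/ffunP => u; apply: kl; rewrite mem_enum. Qed.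

Let size_enum : (size (index_enum {ffun 'I_d -> 'I_m.-1.+1}) = m ^ d)%N.
Proof.
have -> : size (index_enum {ffun 'I_d -> 'I_m.-1.+1}) = #|{: {ffun 'I_d -> 'I_m.-1.+1}}|.
  by rewrite cardE enumT.
by rewrite card_ffun !card_ord prednK.
Qed.

Lemma lattice_sqr (S : seq (lattice d)) : uniq S ->
  (forall k, k \in S -> L2 (xi k)) -> (forall k, k \in S -> mean (xi k) = 0) ->
  mean (fun w => (\sum_(k <- S) xi k w) ^+ 2) <=
  var_const m d r * \sum_(k <- S) mean (fun w => xi k w ^+ 2).
Proof.
move=> uS xi2 xi0.
have cls2 c : L2 (fun w => \sum_(k <- cls S c) xi k w).
  by apply: L2_sum => k; rewrite mem_filter => /andP[_ kS] _; exact: xi2.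
apply: (@le_trans _ _ (mean (fun w => (m ^ d)%:R *
    \sum_c (\sum_(k <- cls S c) xi k w) ^+ 2))).
  apply: mean_le.
  - by apply: L2_sqr; apply: L2_sum => k kS _; exact: xi2.
  - by apply: L1Z; apply: L1_sum => c _ _; exact: L2_sqr.
  move=> w; rewrite (partition_big (residue m) xpredT)//= -size_enum.
  apply: le_trans (sqr_sum_le _ _) _; apply: ler_wpM2l => //.
  by apply: ler_sum => c _; rewrite -big_filter.
rewrite meanZ; last by apply: L1_sum => c _ _; exact: L2_sqr.
rewrite mean_sum; last by move=> c _ _; exact: L2_sqr.
rewrite -mulrA; apply: ler_wpM2l; first exact: ler0n.
rewrite (partition_big (residue m) xpredT)//= mulr_sumr.
apply: ler_sum => c _; rewrite -[in leRHS]big_filter -[in X in _ ^+ X](size_enum_ord d).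
apply: (spread_sqr r01 rhoX mxi) => //.
- exact: filter_uniq.
- exact: residue_spread.
- by move=> k; rewrite mem_filter => /andP[_]; exact: xi2.
- by move=> k; rewrite mem_filter => /andP[_]; exact: xi0.
Qed.

Lemma lattice_pow4 (S : seq (lattice d)) : uniq S ->
  (forall k, k \in S -> Bd (xi k)) -> (forall k, k \in S -> mean (xi k) = 0) ->
  mean (fun w => (\sum_(k <- S) xi k w) ^+ 4) <=
  mom4_const m d r * (\sum_(k <- S) mean (fun w => xi k w ^+ 4) +
     (\sum_(k <- S) mean (fun w => xi k w ^+ 2)) ^+ 2).
Proof.
move=> uS Bxi xi0.
have clsB c : Bd (fun w => \sum_(k <- cls S c) xi k w).
  by apply: Bd_sum => k; rewrite mem_filter => /andP[_ kS] _; exact: Bxi.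
apply: (@le_trans _ _ (mean (fun w => (m ^ d)%:R ^+ 3 *
    \sum_c (\sum_(k <- cls S c) xi k w) ^+ 4))).
  apply: mean_le.
  - by apply/Bd_L1/BdX; apply: Bd_sum => k kS _; exact: Bxi.
  - by apply: L1Z; apply: L1_sum => c _ _; exact/Bd_L1/BdX.
  move=> w; rewrite (partition_big (residue m) xpredT)//= -size_enum.
  apply: le_trans (pow4_sum_le _ _) _; apply: ler_wpM2l.
    by apply: exprn_ge0; exact: ler0n.
  by apply: ler_sum => c _; rewrite -big_filter.
rewrite meanZ; last by apply: L1_sum => c _ _; exact/Bd_L1/BdX.
rewrite mean_sum; last by move=> c _ _; exact/Bd_L1/BdX.
rewrite -[leRHS]mulrA; apply: ler_wpM2l.
  by apply: exprn_ge0; exact: ler0n.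
apply: (@le_trans _ _ (\sum_c pow4_const r d *
   (\sum_(k <- cls S c) mean (fun w => xi k w ^+ 4) +
    (\sum_(k <- cls S c) mean (fun w => xi k w ^+ 2)) ^+ 2))).
  apply: ler_sum => c _; rewrite -[in X in pow4_const _ X](size_enum_ord d).
  apply: (spread_pow4 r01 rhoX mxi) => //.
  - exact: filter_uniq.
  - exact: residue_spread.
  - by move=> k; rewrite mem_filter => /andP[_]; exact: Bxi.
  - by move=> k; rewrite mem_filter => /andP[_]; exact: xi0.
rewrite -mulr_sumr; apply: ler_wpM2l; first exact: pow4_const_ge0.
rewrite big_split /=; apply: lerD.
  rewrite [leRHS](partition_big (residue m) xpredT)//=.
  by apply: ler_sum => c _; rewrite big_filter.
rewrite [in leRHS](partition_big (residue m) xpredT)//=.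
under [in leRHS]eq_bigr do rewrite -big_filter.
apply: sum_sqr_le_sqr_sum => c; apply: sumr_ge0 => k _.
by apply: mean_ge0 => w; exact: sqr_ge0.
Qed.

End lattice_bounds.

(** * Factorization of characteristic functions under strong mixing *)

(** The sum is the integer part of [y]. *)
Lemma count_steps (R : realType) (n : nat) (y : R) : 0 <= y <= n%:R ->
  \sum_(i < n) (i.+1%:R <= y)%R%:R <= y <= \sum_(i < n) (i.+1%:R <= y)%R%:R + 1.
Proof.
elim: n => [|n IH] /andP[y0 yn]; first by rewrite big_ord0; lra.
rewrite big_ord_recr /=.
have [yn'|yn'] := leP y n%:R.
  have := IH; rewrite y0 yn' => /(_ isT).
  suff -> : (n.+1%:R <= y) = false by rewrite addr0.
  by apply/negbTE; rewrite -ltNge (le_lt_trans yn')// ltr_nat.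
rewrite (eq_bigr (fun=> 1)); last first.
  by move=> i _; rewrite (le_trans _ (ltW yn'))// ler_nat.
rewrite sumr_const card_ord -natr1 in yn *.
by case: (leP (n%:R + 1) y) => h /=; lra.
Qed.

Section alpha.
Context {R : realType} {disp : measure_display} {T : measurableType disp}.
Variable P : probability T R.
Implicit Types (f g : T -> R) (G : set (set T)).

Local Notation mean := (mean P).

Let cov f g := mean (fun w => f w * g w) - mean f * mean g.

Lemma Bd_indic (A : set T) : measurable A -> Bd (\1_A : T -> R).
Proof.
move=> mA; split; first exact: measurable_indic.
by exists 1 => w; rewrite indicE; case: (_ \in _); rewrite ?normr1 ?normr0.
Qed.

(* Layer-cake: f is approximated within 1/q by q^-1 \sum_i 1_{f >= (i+1)/q}. *)
Lemma cov_layers (a : R) f g G : Gmeas G f -> Bd f -> Bd g ->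
  (forall w, 0 <= f w <= 1) -> (forall w, `|g w| <= 1) ->
  (forall A, <<s G >> A -> measurable A -> `|cov \1_A g| <= a) ->
  `|cov f g| <= a.
Proof.
move=> mf Bf Bg f01 g1 covA; apply/ler_addgt0Pr => e e0.
(* Twice the approximation error [Q^-1]: once for the mean of the product and once for the product
   of the means. *)
have [q qe] : exists q : nat, 2 / q.+1%:R <= e.
  exists (Num.truncn (2 / e)); rewrite ler_pdivrMr// mulrC -ler_pdivrMr//.
  by rewrite ltW// truncnS_gt.
pose Q : R := q.+1%:R.
have Q0 : 0 < Q by rewrite ltr0n.
pose A (i : nat) : set T := [set w | i.+1%:R <= Q * f w].
have AE i : A i = setT `&` f @^-1` `[i.+1%:R / Q, +oo[%classic.
  apply/seteqP; split => w; rewrite /A /= in_itv/= andbT ler_pdivrMr// mulrC.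
    by split.
  by case.
have mA i : measurable (A i).
  by rewrite AE; case: Bf => + _; apply => //; exact: measurable_itv.
have GA i : <<s G >> (A i).
  by rewrite AE; apply: mf => //; exact: measurable_itv.
pose fq w := Q^-1 * \sum_(i < q.+1) (\1_(A i) w : R).
have BA (i : nat) : Bd (\1_(A i) : T -> R) by exact: Bd_indic.
have Bs : Bd (fun w => \sum_(i < q.+1) (\1_(A i) w : R)) by apply: Bd_sum.
have Bfq : Bd fq by apply: BdM => //; exact: Bd_cst.
have ffq w : `|f w - fq w| <= Q^-1.
  have /andP[f0 f1] := f01 w.
  have /count_steps : 0 <= Q * f w <= q.+1%:R.
    apply/andP; split; first by apply: mulr_ge0 => //; exact: ltW.
    by apply: ler_piMr => //; exact: ltW.
  have SE : \sum_(i < q.+1) (\1_(A i) w : R) = \sum_(i < q.+1) (i.+1%:R <= Q * f w)%R%:R.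
    apply: eq_bigr => i _; rewrite indicE; congr (nat_of_bool _)%:R.
    by apply/idP/idP => [/set_mem|h] //; apply/mem_set.
  rewrite /fq SE.
  set S := \sum_(i < _) _ => /andP[h1 h2].
  have QV : Q * Q^-1 = 1 by rewrite mulfV// gt_eqF.
  have Q'0 : 0 < Q^-1 by rewrite invr_gt0.
  rewrite (_ : f w - _ = Q^-1 * (Q * f w - S)); last first.
    by rewrite mulrBr mulrA [_^-1 * Q]mulrC QV mul1r.
  rewrite normrM (gtr0_norm Q'0); apply: ler_piMr; first exact: ltW.
  by rewrite ler_norml; apply/andP; split; lra.
have covq : `|cov fq g| <= a.
  have -> : cov fq g = Q^-1 * \sum_(i < q.+1) cov \1_(A i) g.
    rewrite /cov /fq meanZ; last exact: Bd_L1.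
    rewrite mean_sum; last by move=> i _ _; exact: Bd_L1.
    rewrite sumrB -mulr_suml mulrBr mulrA; congr (_ - _).
    rewrite -mean_sum; last by move=> i _ _; apply: Bd_L1; exact: BdM.
    rewrite -meanZ; last by apply: Bd_L1; apply: Bd_sum => i _ _; exact: BdM.
    by apply: eq_mean => w; rewrite -mulrA mulr_suml.
  rewrite normrM ger0_norm; last by rewrite invr_ge0 ltW.
  rewrite mulrC ler_pdivrMr//.
  apply: (le_trans (ler_norm_sum _ _ _)).
  apply: (@le_trans _ _ (\sum_(i < q.+1) a)).
    by apply: ler_sum => i _; exact: covA.
  by rewrite sumr_const card_ord mulr_natr.
have Bd1 h : Bd h -> Bd (fun w => h w * g w) by move=> Bh; exact: BdM.
have d1 : `|mean (fun w => f w * g w) - mean (fun w => fq w * g w)| <= Q^-1.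
  rewrite -meanB; [|exact/Bd_L1/Bd1|exact/Bd_L1/Bd1].
  rewrite -[leRHS](mean_cst P); apply: mean_norm_le.
  - by apply: Bd_L1; apply: BdD; [exact: Bd1|apply: BdN; exact: Bd1].
  - exact/Bd_L1/Bd_cst.
  move=> w; rewrite -mulrBl normrM.
  by apply: le_trans (ffq w); exact: ler_piMr.
have d2 : `|mean f - mean fq| <= Q^-1.
  rewrite -meanB; [|exact: Bd_L1|exact: Bd_L1].
  rewrite -[leRHS](mean_cst P); apply: mean_norm_le => //.
  - by apply: Bd_L1; apply: BdD => //; exact: BdN.
  - exact/Bd_L1/Bd_cst.
have mg : `|mean g| <= 1.
  rewrite -[leRHS](mean_cst P); apply: mean_norm_le => //; first exact: Bd_L1.
  exact/Bd_L1/Bd_cst.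
have d3 : `|(mean f - mean fq) * mean g| <= Q^-1.
  by rewrite normrM; apply: le_trans d2; exact: ler_piMr.
rewrite (_ : cov f g = cov fq g + ((mean (fun w => f w * g w) - mean (fun w => fq w * g w))
   - (mean f - mean fq) * mean g)); last by rewrite /cov; ring.
apply: (le_trans (ler_normD _ _)); apply: lerD => //.
apply: (le_trans (ler_normB _ _)); apply: (le_trans (lerD d1 d3)).
by apply: le_trans qe; have -> : Q^-1 + Q^-1 = 2 / Q by ring.
Qed.

Lemma mean_indic (A : set T) : measurable A -> (mean \1_A)%:E = P A.
Proof.
move=> mA; rewrite /mean /Rintegral integral_indic// setIT fineK//.
exact: fin_num_measure.
Qed.

Lemma covC f g : cov f g = cov g f.
Proof.
by rewrite /cov mulrC; congr (_ - _); apply: eq_mean => w; rewrite mulrC.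
Qed.

(** The affine map [h] carries [-1, 1] onto [0, 1] and divides a covariance by 4, which explains the
    constant. Two layer-cake steps then replace both functions by indicators of events in the two
    sigma-fields. *)
Lemma alpha_cov (a : R) f g G1 G2 :
  (alpha_coef P <<s G1 >> <<s G2 >> <= a%:E)%E ->
  Gmeas G1 f -> Gmeas G2 g -> Bd f -> Bd g ->
  (forall w, `|f w| <= 1) -> (forall w, `|g w| <= 1) ->
  `|mean (fun w => f w * g w) - mean f * mean g| <= 4 * a.
Proof.
move=> alph mf mg Bf Bg f1 g1.
pose h (f : T -> R) w := (f w + 1) / 2.
have h01 k w : (forall w, `|k w| <= 1) -> 0 <= h k w <= 1.
  by move=> /(_ w); rewrite ler_norml /h => /andP[k1 k2]; apply/andP; split; lra.
have Bh k : Bd k -> Bd (h k).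
  by move=> Bk; apply: BdM; [apply: BdD => //; exact: Bd_cst|exact: Bd_cst].
have Gh G k : Gmeas G k -> Gmeas G (h k).
  by move=> mk; apply: GmeasM; [apply: GmeasD => //|]; exact: Gmeas_cst.
have n1 (k : T -> R) w : 0 <= k w <= 1 -> `|k w| <= 1.
  by move=> /andP[? ?]; rewrite ger0_norm.
have i01 (A : set T) w : 0 <= (\1_A w : R) <= 1.
  by rewrite indicE; case: (_ \in _); rewrite /= ?lexx ?ler01.
have covh : `|cov (h f) (h g)| <= a.
  apply: (cov_layers (Gh _ _ mf)) => [||w|w|A GA mA].
  - exact: Bh.
  - exact: Bh.
  - exact: h01.
  - by apply: n1; exact: h01.
  rewrite covC; apply: (cov_layers (Gh _ _ mg)) => [||w|w|B GB mB].
  - exact: Bh.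
  - exact: Bd_indic.
  - exact: h01.
  - by apply: n1; exact: i01.
  rewrite covC -lee_fin; apply: le_trans alph; apply: ereal_sup_ubound.
  exists (A, B) => //=; rewrite /cov -!mean_indic//; last exact: measurableI.
  rewrite -EFinM -EFinB /=; congr (`|_ - _|%:E).
  by apply: eq_mean => w; rewrite indicI.
have -> : mean (fun w => f w * g w) - mean f * mean g = 4 * cov (h f) (h g).
  rewrite /cov (@eq_mean _ _ _ _ (fun w => h f w * h g w)
     (fun w => 4^-1 * (f w * g w + (f w + g w + 1)))); last first.
    by move=> w; rewrite /h; field.
  have mh k : Bd k -> mean (h k) = 2^-1 * (mean k + 1).
    move=> Bk; rewrite (@eq_mean _ _ _ _ (h k) (fun w => 2^-1 * (k w + 1))).
      rewrite meanZ ?meanD ?mean_cst//; last by apply: L1D; [exact: Bd_L1|exact/Bd_L1/Bd_cst].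
        exact: Bd_L1.
      exact/Bd_L1/Bd_cst.
    by move=> w; rewrite mulrC.
  have B1 : L1 P (fun=> 1) by exact/Bd_L1/Bd_cst.
  have fgL : L1 P (fun w => f w * g w) by apply: Bd_L1; exact: BdM.
  have fL : L1 P f by exact: Bd_L1.
  have gL : L1 P g by exact: Bd_L1.
  have fg1L : L1 P (fun w => f w + g w) by exact: L1D.
  have fg2L : L1 P (fun w => f w + g w + 1) by exact: L1D.
  rewrite !mh// meanZ; last exact: L1D.
  by rewrite meanD// meanD// meanD// mean_cst; field.
by rewrite normrM ger0_norm// ler_wpM2l.
Qed.

End alpha.

(** * Factorization over the colors of the sites *)

Section factorization.
Context {R : realType} {disp : measure_display} {T : measurableType disp}.
Variable P : probability T R.

Local Notation mean := (mean P).

Lemma alpha_half_spaces (d m : nat) (X : lattice d -> T -> R) (a : R)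
    (u : 'I_d) (j : int) : (0 < m)%N -> (alpha_field P X m <= a%:E)%E ->
  (alpha_coef P <<s gen X [set k | k u <= j]%R >>
                <<s gen X [set k | j + m%:Z <= k u]%R >> <= a%:E)%E.
Proof.
move=> m0; apply: le_trans; apply: ereal_sup_ubound.
exists ([set k : lattice d | k u <= j], [set k : lattice d | j + m%:Z <= k u]) => //=.
split.
- by exists [ffun=> j]; rewrite /= ffunE.
- by exists [ffun=> j + m%:Z]; rewrite /= ffunE.
- apply/seteqP; split => // k [/= kj jk].
  have : j < j + m%:Z by rewrite ltrDl ltz_nat.
  by rewrite ltNge (le_trans jk kj).
- by exists u, j; split.
Qed.

Variables (d m N : nat) (X zeta : lattice d -> T -> R) (a : R).
Hypothesis m_gt0 : (0 < m)%N.
Hypothesis alphaX : (alpha_field P X m <= a%:E)%E.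

Local Notation color := {ffun 'I_d -> 'I_N.+1}.

Variables (S : seq (lattice d)) (c : lattice d -> color).
Hypothesis mzeta : forall k, Gmeas (gen X [set k]) (zeta k).
Hypothesis measurable_zeta : forall k, k \in S -> measurable_fun setT (zeta k).
Hypothesis sepc : forall (u : 'I_d) (b : nat), exists j : int,
  forall k, k \in S ->
    ((c k u < b)%N -> k u <= j) /\ ((b <= c k u)%N -> j + m%:Z <= k u).

Definition block (F : {set color}) w := \sum_(k <- S | c k \in F) zeta k w.

Variables (e err : color -> R).
Hypothesis e01 : forall i, 0 <= e i <= 1.
Hypothesis single : forall i theta,
  `|mean (fun w => cos (block [set i]%SET w + theta)) - cos theta * e i| <= err i.

Lemma measurable_block F : measurable_fun setT (block F).
Proof.
rewrite /block; elim: S measurable_zeta => [|k s IH] mz.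
  by under eq_fun do rewrite big_nil; exact: measurable_cst.
under eq_fun do rewrite big_cons.
have ms : measurable_fun setT (fun w => \sum_(k <- s | c k \in F) zeta k w).
  by apply: IH => l ls; apply: mz; rewrite inE ls orbT.
case: (c k \in F) => //=; apply: measurable_funD => //.
by apply: mz; rewrite mem_head.
Qed.

(** The addition formula for the cosine produces two products, of cosines and of sines, each with
    covariance at most [4 * a]. The threshold [b] on the colors in direction [u] becomes a pair of
    half-spaces at distance [m], as [alpha_field] requires. *)
Lemma block_split (F1 F2 : {set color}) (u : 'I_d) (b : nat) (theta : R) :
  (forall i, i \in F1 -> (i u < b)%N) -> (forall i, i \in F2 -> (b <= i u)%N) ->
  `|mean (fun w => cos (block F1 w + block F2 w + theta)) -
    (mean (fun w => cos (block F1 w + theta)) * mean (fun w => cos (block F2 w)) -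
     mean (fun w => sin (block F1 w + theta)) * mean (fun w => sin (block F2 w)))|
  <= 8 * a.
Proof.
move=> F1b F2b; have [j jP] := sepc u b.
have mcos : measurable_fun setT (cos : R -> R).
  by apply: continuous_measurable_fun; exact: continuous_cos.
have msin : measurable_fun setT (sin : R -> R).
  by apply: continuous_measurable_fun; exact: continuous_sin.
have cos1 (x : R) : `|cos x| <= 1 by rewrite ler_norml cos_geN1 cos_le1.
have sin1 (x : R) : `|sin x| <= 1 by rewrite ler_norml sin_geN1 sin_le1.
have G1 : Gmeas (gen X [set k | k u <= j]) (fun w => block F1 w + theta).
  apply: GmeasD; last exact: Gmeas_cst.
  apply: Gmeas_sum => k kS /F1b kb; apply: (Gmeas_sub _ (@mzeta k)).
  by apply: gen_sub => _ ->; exact: (jP k kS).1.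
have G2 : Gmeas (gen X [set k | j + m%:Z <= k u]) (block F2).
  apply: Gmeas_sum => k kS /F2b kb; apply: (Gmeas_sub _ (@mzeta k)).
  by apply: gen_sub => _ ->; exact: (jP k kS).2.
have m1 : measurable_fun setT (fun w => block F1 w + theta).
  by apply: measurable_funD => //; exact: measurable_block.
have m2 := measurable_block F2.
have al := alpha_half_spaces u j m_gt0 alphaX.
have cc := alpha_cov al (Gmeas_comp mcos G1) (Gmeas_comp mcos G2) (Bd_cos m1) (Bd_cos m2)
  (fun w => cos1 _) (fun w => cos1 _).
have ss := alpha_cov al (Gmeas_comp msin G1) (Gmeas_comp msin G2) (Bd_sin m1) (Bd_sin m2)
  (fun w => sin1 _) (fun w => sin1 _).
rewrite (eq_mean _ (g := fun w => cos (block F1 w + theta) * cos (block F2 w) -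
     sin (block F1 w + theta) * sin (block F2 w))); last first.
  by move=> w; rewrite addrAC cosD.
rewrite meanB; last 2 first.
- by apply: Bd_L1; apply: BdM; exact: Bd_cos.
- by apply: Bd_L1; apply: BdM; exact: Bd_sin.
move: cc ss; rewrite !ler_norml => /andP[? ?] /andP[? ?].
by apply/andP; split; lra.
Qed.

Lemma blockID (F B : {set color}) w :
  block F w = block (F :&: B)%SET w + block (F :\: B)%SET w.
Proof.
rewrite /block (bigID (fun k => c k \in B)) /=; congr (_ + _).
  by apply: eq_bigl => k; rewrite inE.
by apply: eq_bigl => k; rewrite inE andbC.
Qed.

(* With x = U1 + theta fixed, E cos(U2 + x) is close to cos x * e2, uniformly
   in x; hence the errors add up instead of being multiplied. *)
Lemma block_factorization (F : {set color}) (theta : R) :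
  `|mean (fun w => cos (block F w + theta)) - cos theta * \prod_(i in F) e i| <=
  \sum_(i in F) err i + 8 * a * #|F|.-1%:R.
Proof.
have [n] := ubnP #|F|; elim: n F theta => // n IH F theta; rewrite ltnS => Fn.
have [->|[i iF]] := set_0Vmem F.
  rewrite big_set0 big_set0 cards0 mulr0 addr0 mulr1.
  rewrite (eq_mean _ (g := fun=> cos theta)) ?mean_cst ?subrr ?normr0// => w.
  by rewrite /block big1 ?add0r// => k; rewrite inE.
have [F1|] := boolP (#|F| == 1%N).
  have /cards1P[i' Fi] := F1; rewrite {}Fi in iF F1 Fn *.
  by rewrite !big_set1 cards1 mulr0 addr0; exact: single.
move=> Fn1.
have [i' i'F ii'] : exists2 i', i' \in F & i' != i.
  have : (0 < #|(F :\ i)%SET|)%N.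
    by have := cardsD1 i F; rewrite iF; case: #|(F :\ i)%SET| => // h; rewrite h in Fn1.
  by move=> /card_gt0P[i']; rewrite !inE => /andP[h1 h2]; exists i'.
(* Two different colors differ in some coordinate; the larger of the two values there is a threshold
   with members of [F] on both sides. *)
have [u [b [k1 [k2 [k1F k2F k1b k2b]]]]] : exists (u : 'I_d) (b : nat) k1 k2,
    [/\ k1 \in F, k2 \in F, (k1 u < b)%N & (b <= k2 u)%N].
  have [u ui] : exists u, i' u != i u.
    apply/existsP; rewrite -negb_forall; apply: contraNN ii' => /forallP h.
    by apply/eqP/ffunP => u; apply/eqP.
  have [lt|gt|/val_inj/eqP] := ltngtP (i' u) (i u); last by rewrite (negbTE ui).
    by exists u, (i u), i', i.
  by exists u, (i' u), i, i'.
pose B := [set i : color | (i u < b)%N]%SET.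
pose F1 := (F :&: B)%SET; pose F2 := (F :\: B)%SET.
have cF : #|F| = (#|F1| + #|F2|)%N by rewrite cardsID.
have F1p : (0 < #|F1|)%N by apply/card_gt0P; exists k1; rewrite !inE k1F.
have F2p : (0 < #|F2|)%N by apply/card_gt0P; exists k2; rewrite !inE k2F andbT -leqNgt.
have lt1 : (#|F1| < #|F|)%N by rewrite cF -[ltnLHS]addn0 ltn_add2l.
have lt2 : (#|F2| < #|F|)%N by rewrite cF -[ltnLHS]add0n ltn_add2r.
have IH1 t := IH F1 t (leq_trans lt1 Fn).
have IH2 t := IH F2 t (leq_trans lt2 Fn).
have prodE : \prod_(i in F) e i = (\prod_(i in F1) e i) * (\prod_(i in F2) e i).
  exact: big_setID.
have sumE : \sum_(i in F) err i = \sum_(i in F1) err i + \sum_(i in F2) err i.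
  exact: big_setID.
have split := @block_split F1 F2 u b theta.
have {split}/split split : forall l, l \in F1 -> (l u < b)%N.
  by move=> l; rewrite !inE => /andP[].
have {split}/split split : forall l, l \in F2 -> (b <= l u)%N.
  by move=> l; rewrite !inE -leqNgt => /andP[].
set e1 := \prod_(i in F1) e i in prodE IH1 *; set e2 := \prod_(i in F2) e i in prodE IH2 *.
have e201 : 0 <= e2 <= 1.
  apply: (big_ind (fun x => 0 <= x <= 1)); first by rewrite lexx ler01.
    by move=> x y /andP[? ?] /andP[? ?]; rewrite mulr_ge0//= mulr_ile1.
  by move=> l _; exact: e01.
set x1 := \sum_(i in F1) err i in sumE IH1 *; set x2 := \sum_(i in F2) err i in sumE IH2 *.
pose A := 8 * a; rewrite -/A in IH1 IH2 split *.
(* Splitting [F] down to single colors takes [#|F| - 1] cuts, each costing [8 * a]. *)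
have cn : #|F|.-1%:R = #|F1|.-1%:R + #|F2|.-1%:R + 1 :> R.
  by rewrite -natrD natr1 cF -{1}(prednK F1p) -{1}(prednK F2p) addSn addnS.
set n1 : R := #|F1|.-1%:R in cn IH1 *; set n2 : R := #|F2|.-1%:R in cn IH2 *.
have B1c : Bd (fun w => cos (block F1 w + theta)).
  by apply: Bd_cos; apply: measurable_funD => //; exact: measurable_block.
have B1s : Bd (fun w => sin (block F1 w + theta)).
  by apply: Bd_sin; apply: measurable_funD => //; exact: measurable_block.
have B2c : Bd (fun w => cos (block F2 w)) by apply: Bd_cos; exact: measurable_block.
have B2s : Bd (fun w => sin (block F2 w)) by apply: Bd_sin; exact: measurable_block.
set C := mean (fun w => cos (block F2 w)) in split *.
set D := mean (fun w => sin (block F2 w)) in split *.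
set c1 := mean (fun w => cos (block F1 w + theta)) in split *.
set s1 := mean (fun w => sin (block F1 w + theta)) in split *.
have inner x : `|cos x * C - sin x * D - cos x * e2| <= x2 + A * n2.
  have -> : cos x * C - sin x * D = mean (fun w => cos (block F2 w + x)).
    rewrite /C /D -!meanZ; [|exact: Bd_L1|exact: Bd_L1].
    rewrite -meanB; [|by apply: L1Z; exact: Bd_L1|by apply: L1Z; exact: Bd_L1].
    by apply: eq_mean => w; rewrite -cosD addrC.
  exact: IH2.
have outer : `|c1 * C - s1 * D - c1 * e2| <= x2 + A * n2.
  rewrite (_ : _ - _ = mean (fun w => cos (block F1 w + theta) * C -
     sin (block F1 w + theta) * D - cos (block F1 w + theta) * e2)).
    rewrite -[leRHS](mean_cst P); apply: mean_norm_le => //.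
    - apply: Bd_L1; apply: BdD; [apply: BdD|]; [|apply: BdN|apply: BdN];
      by apply: BdM => //; exact: Bd_cst.
    - exact/Bd_L1/Bd_cst.
  have E f (t : R) : Bd f -> mean f * t = mean (fun w => f w * t).
    move=> Bf; rewrite mulrC -meanZ; last exact: Bd_L1.
    by apply: eq_mean => w; rewrite mulrC.
  rewrite meanB; last 2 first.
  - by apply: L1B; apply: Bd_L1; apply: BdM => //; exact: Bd_cst.
  - by apply: Bd_L1; apply: BdM => //; exact: Bd_cst.
  rewrite meanB; last 2 first.
  - by apply: Bd_L1; apply: BdM => //; exact: Bd_cst.
  - by apply: Bd_L1; apply: BdM => //; exact: Bd_cst.
  by rewrite -!E.
have last1 : `|c1 * e2 - cos theta * (e1 * e2)| <= x1 + A * n1.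
  rewrite (_ : _ - _ = e2 * (c1 - cos theta * e1)); last by ring.
  case/andP: e201 => e20 e21; rewrite normrM (ger0_norm e20).
  by apply: le_trans (IH1 theta); apply: ler_piMl.
rewrite sumE cn prodE mulrDr mulrDr mulr1.
rewrite (eq_mean _ (g := fun w => cos (block F1 w + block F2 w + theta))); last first.
  by move=> w; rewrite (blockID F B).
move: split outer last1; rewrite !ler_norml.
move: (mean _) (cos theta * _) (c1 * C - s1 * D) (c1 * e2) (A * n1) (A * n2).
move=> p q r s t v /andP[? ?] /andP[? ?] /andP[? ?].
by apply/andP; split; lra.
Qed.

End factorization.

(** * Cutting the box into blocks *)

Section cut.
Context {R : realType}.
Variables (M eta : R).
Hypothesis eta_gt0 : 0 < eta.

Let N0 := Num.truncn (M / eta).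

Section fixed_mass.
Variables (m n : nat) (eps : R) (mu : nat -> R).
Hypothesis m_gt0 : (0 < m)%N.
Hypothesis eps_gt0 : 0 < eps.
Hypothesis mu_ge0 : forall j, 0 <= mu j.
Hypothesis muM : \sum_(0 <= j < n) mu j <= M.

Let F j := \sum_(0 <= i < j.+1) mu i.

(* Quantile classes: consecutive positions have the same level unless eta more
   mass has been accumulated. *)
Let level j := Num.truncn (F j / eta).

(** So large that [q * eps > M]: among [q] disjoint windows one has mass at most [eps]. *)
Let q := (Num.truncn (M / eps)).+1.

(** The first position of level [i], where one large mass may have made the level jump. For a level
    that does not occur, [find] returns [n]. *)
Let start i := find (fun j => level j == i) (iota 0 n).

Let slab i a := [&& (a + m <= n)%N, all (fun j => level j == i) (iota a m) &
  \sum_(a <= j < a + m) mu j <= eps].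

Let long i := has (slab i) (iota 0 n.+1).

Let pos i := find (slab i) (iota 0 n.+1).

Let removed j := [exists i : 'I_N0.+1, long i && (pos i <= j < pos i + m)%N].

Let color j := (\sum_(i < N0.+1) (long i && (pos i <= j)))%N.

(** This contains the first position of every level, which may carry a large mass, and by
    [short_level] every level without a cheap gap, since such levels could join many levels under
    one color. *)
Let exceptional := flatten [seq iota (start i) (m * q) | i <- iota 0 N0.+1].

Let F_ge0 j : 0 <= F j.
Proof. exact: sumr_ge0. Qed.

Let F_mono j j' : (j <= j')%N -> F j <= F j'.
Proof.
move=> jj'; rewrite /F [leRHS](big_cat_nat (n := j.+1))//= lerDl.
exact: sumr_ge0.
Qed.

Let level_mono j j' : (j <= j')%N -> (level j <= level j')%N.
Proof.
move=> jj'; apply: le_truncn; rewrite ler_pM2r ?invr_gt0//; exact: F_mono.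
Qed.

Let level_le j : (j < n)%N -> (level j <= N0)%N.
Proof.
move=> jn; apply: le_truncn; rewrite ler_pM2r ?invr_gt0//.
apply: le_trans muM; rewrite [leRHS](big_cat_nat (n := j.+1))//= lerDl.
exact: sumr_ge0.
Qed.

Let level_bounds j : (level j)%:R * eta <= F j < (level j).+1%:R * eta.
Proof.
by rewrite -ler_pdivlMr// -ltr_pdivrMr// truncn_itv// divr_ge0// ltW.
Qed.

Let startP i j : (j < n)%N -> level j = i ->
  (start i <= j)%N /\ level (start i) = i.
Proof.
move=> jn ji; have hs : has (fun j => level j == i) (iota 0 n).
  by apply/hasP; exists j; rewrite ?mem_iota ?ji/= ?eqxx.
have sn : (start i < n)%N by rewrite -[X in (_ < X)%N](size_iota 0 n) -has_find.
split; last by have := nth_find 0%N hs; rewrite nth_iota// => /eqP.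
rewrite leqNgt; apply/negP => js.
by have := before_find 0%N js; rewrite nth_iota//= add0n ji eqxx.
Qed.

Let longP i : long i -> slab i (pos i).
Proof.
move=> li; have := nth_find 0%N li; rewrite nth_iota//.
by rewrite -[X in (_ < X)%N](size_iota 0 n.+1) -has_find.
Qed.

Let pos_level i j : long i -> (pos i <= j < pos i + m)%N -> level j = i.
Proof.
by move=> /longP/and3P[_ /allP h _] jp; apply/eqP/h; rewrite mem_iota.
Qed.

(** After the first position of a level the cumulative mass grows by less than [eta] before the
    level is left; the mass of the first position itself may be large and is not counted. *)
Lemma level_mass i :
  \sum_(0 <= j < n | (level j == i) && (start i < j)%N) mu j <= eta.
Proof.
suff H n' : (n' <= n)%N ->
    \sum_(0 <= j < n' | (level j == i) && (start i < j)%N) mu j <= eta by exact: H.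
elim: n' => [|n' IH] n'n; first by rewrite big_nil ltW.
rewrite big_mkcond big_nat_recr//= -big_mkcond /=.
case: ifPn => [/andP[/eqP ln' sn']|_]; last by rewrite addr0 IH// ltnW.
have [_ ls] := startP n'n ln'.
apply: (@le_trans _ _ (\sum_((start i).+1 <= j < n'.+1) mu j)).
  rewrite [leRHS](big_nat_recr)//= lerD2r.
  rewrite (big_cat_nat (n := (start i).+1))//=.
  rewrite big_nat_cond big1 ?add0r; last first.
    by move=> j /andP[/andP[_ js] /andP[_]]; rewrite ltnNge -ltnS js.
  rewrite big_mkcond/=; apply: ler_sum => j _.
  by case: ifP.
have := level_bounds n'; have := level_bounds (start i).
rewrite ln' ls => /andP[h1 _] /andP[_ h2].
have : F n' = F (start i) + \sum_((start i).+1 <= j < n'.+1) mu j.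
  by rewrite /F [LHS](big_cat_nat (n := (start i).+1))//= ltnW.
by rewrite -natr1 in h2; lra.
Qed.

Lemma short_level i j : ~~ long i -> (j < n)%N -> level j = i ->
  (j < start i + m * q)%N.
Proof.
move=> nl jn ji; have [sj ls] := startP jn ji.
rewrite ltnNge; apply/negP => jq.
(* If the level reached as far as [start i + m * q], each of [q] consecutive windows would fail to
   be a gap and thus have mass above [eps], exceeding [M] in total. *)
have H t : (t <= q)%N ->
    t%:R * eps <= \sum_(start i <= l < start i + m * t) mu l.
  elim: t => [|t IH] tq; first by rewrite mul0r muln0 addn0 big_geq.
  have tq' : (start i + m * t.+1 <= j)%N.
    by apply: leq_trans jq; rewrite leq_add2l leq_mul2l tq orbT.
  rewrite (big_cat_nat (n := (start i + m * t)))//=; [|exact: leq_addr|by rewrite leq_add2l leq_mul2l leqnSn orbT].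
  rewrite -natr1 mulrDl mul1r lerD ?IH ?(ltnW tq)// leNgt; apply/negP => lte.
  move/hasPn : nl => /(_ (start i + m * t)%N); rewrite mem_iota leq0n add0n.
  have -> : (start i + m * t < n.+1)%N by nia.
  move=> /(_ isT)/negP; apply; apply/and3P; split.
  - by nia.
  - apply/allP => l; rewrite mem_iota => /andP[l1 l2]; rewrite eqn_leq.
    rewrite -{1}ji -{1}ls !level_mono//; [|nia..].
    by apply: leq_trans l1; exact: leq_addr.
  - by rewrite -addnA -mulnSr ltW.
have /H : (q <= q)%N by [].
have : \sum_(start i <= l < start i + m * q) mu l <= M.
  apply: le_trans muM; rewrite [leRHS](big_cat_nat (n := (start i)))//=; last first.
    by rewrite (leq_trans sj)// ltnW.
  rewrite [X in _ + X](big_cat_nat (n := (start i + m * q)))//=; [|exact: leq_addr|].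
    rewrite addrCA lerDl addr_ge0//; exact: sumr_ge0.
  by rewrite (leq_trans jq)// ltnW.
move=> h1 h2; have := le_trans h2 h1.
by rewrite -ler_pdivlMr// leNgt truncnS_gt.
Qed.

Lemma color_le j : (color j <= N0.+1)%N.
Proof.
rewrite -[X in (_ <= X)%N](card_ord N0.+1) -sum1_card; apply: leq_sum => i _.
exact: leq_b1.
Qed.

Lemma removed_mass : \sum_(0 <= j < n | removed j) mu j <= N0.+1%:R * eps.
Proof.
apply: (@le_trans _ _ (\sum_(0 <= j < n) \sum_(i < N0.+1 |
    long i && (pos i <= j < pos i + m)%N) mu j)).
  rewrite big_mkcond; apply: ler_sum => j _; case: ifP => [/existsP[i hi]|_].
    by rewrite (bigD1 i)//= lerDl; exact: sumr_ge0.
  exact: sumr_ge0.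
rewrite (exchange_big_dep xpredT)//=.
rewrite mulr_natl -[in leRHS](card_ord N0.+1) -sumr_const; apply: ler_sum => i _.
have [li|_] := boolP (long i); last first.
  by rewrite big_pred0// ltW.
have /and3P[pn _ ple] := longP li; apply: le_trans ple.
rewrite (big_cat_nat (n := (pos i)))//=; last by rewrite (leq_trans _ pn)// leq_addr.
rewrite big_nat_cond big1 ?add0r; last first.
  by move=> j /andP[/andP[_ jp] /andP[pj _]]; rewrite ltnNge pj in jp.
rewrite (big_cat_nat (n := (pos i + m)))//=; last exact: leq_addr.
rewrite [X in _ + X]big_nat_cond [X in _ + X]big1 ?addr0; last first.
  by move=> j /andP[/andP[jp _] /andP[_ pj]]; rewrite ltnNge jp in pj.
rewrite big_mkcond; apply: ler_sum => j _; by case: ifP.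
Qed.

Let color_lt j j' : (color j < color j')%N ->
  exists i : 'I_N0.+1, [/\ long i, (pos i <= j')%N & (j < pos i)%N].
Proof.
move=> cjj'; apply: contrapT => h; move: cjj'; apply/negP; rewrite -leqNgt.
apply: leq_sum => i _; case: (boolP (long i)) => //= li.
case: (leqP (pos i) j') => // pj'; case: (leqP (pos i) j) => // pj.
by exfalso; apply: h; exists i.
Qed.

(** A color increases only across a removed window of width [m]. With [s] the last kept position of
    color below [b], a kept position beyond the window is at least [m] further. *)
Lemma color_sep b : exists s : int, forall j, (j < n)%N -> ~~ removed j ->
  ((color j < b)%N -> j%:Z <= s) /\ ((b <= color j)%N -> s + m%:Z <= j%:Z).
Proof.
pose low j := [&& (j < n)%N, ~~ removed j & (color j < b)%N].
have [[j0 lj0]|nex] := pselect (exists j, low j); last first.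
  (* No kept position has color below [b], so [s + m <= 0] is enough; this case is why [s] is an
     integer. *)
  exists (- m%:Z) => j jn rj; split; last by rewrite addNr.
  by move=> cj; exfalso; apply: nex; exists j; rewrite /low jn rj cj.
have ub j : low j -> (j <= n)%N by case/and3P=> /ltnW.
case: (ex_maxnP (ex_intro _ j0 lj0) ub) => s ls smax.
exists s%:Z => j jn rj; split; first by move=> cj; rewrite lez_nat smax// /low jn rj cj.
move=> bj; have /and3P[_ _ sb] := ls.
have [i [li pj sp]] := color_lt (leq_trans sb bj).
rewrite -PoszD lez_nat; apply: (@leq_trans (pos i + m)); first by rewrite leq_add2r ltnW.
by move/existsPn : rj => /(_ i); rewrite li pj /= -leqNgt.
Qed.

(** Apart from the exceptional positions a color class meets at most two levels, each contributing
    at most [eta] by [level_mass]: a third level between them would be long, and its gap would raise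
    the color. *)
Lemma color_mass p :
  \sum_(0 <= j < n | [&& ~~ removed j, color j == p & j \notin exceptional]) mu j
  <= 2 * eta.
Proof.
pose C j := [&& (j < n)%N, ~~ removed j, color j == p & j \notin exceptional].
have CP j : C j -> long (level j) /\ (start (level j) < j)%N.
  move=> /and4P[jn rj _ /flattenP jH].
  have Hj l : iota (start (level j)) (m * q) = l -> j \in l -> False.
    move=> <- jl; apply: jH; exists (iota (start (level j)) (m * q)) => //.
    by apply/mapP; exists (level j) => //; rewrite mem_iota ltnS level_le.
  have [sj _] := startP jn erefl; split.
    apply: contrapT => /negP nl; apply: (Hj _ erefl); rewrite mem_iota sj /=.
    exact: short_level.
  rewrite ltn_neqAle sj andbT; apply/eqP => sje; apply: (Hj _ erefl).
  by rewrite mem_iota sj -{1}sje /= -[ltnLHS]addn0 ltn_add2l muln_gt0 m_gt0.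
have [[j0 Cj0]|nex] := pselect (exists j, C j); last first.
  rewrite big_nat_cond big1 ?mulr_ge0 ?ltW// => j /andP[/andP[_ jn] cj].
  by exfalso; apply: nex; exists j; rewrite /C jn.
have exC : exists j, C j by exists j0.
have ub j : C j -> (j <= n)%N by case/andP=> /ltnW.
case: (ex_minnP exC) => j1 C1 min1.
case: (ex_maxnP exC ub) => j3 C3 max3.
have two j : C j -> (level j == level j1) || (level j == level j3).
  move=> Cj; apply: contrapT => /negP; rewrite negb_or => /andP[l1 l3].
  have {}l1 : (level j1 < level j)%N by rewrite ltn_neqAle eq_sym l1 level_mono ?min1.
  have {}l3 : (level j < level j3)%N by rewrite ltn_neqAle l3 level_mono ?max3.
  have [lj _] := CP _ Cj.
  have lp : level (pos (level j)) = level j.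
    by apply: pos_level => //; rewrite leqnn -[ltnLHS]addn0 ltn_add2l.
  have p1 : (j1 < pos (level j))%N.
    by rewrite ltnNge; apply/negP => /level_mono; rewrite lp leqNgt l1.
  have p3 : (pos (level j) <= j3)%N.
    by rewrite leqNgt; apply/negP => /ltnW/level_mono; rewrite lp leqNgt l3.
  have /and4P[jn _ /eqP c1 _] := C1; have /and4P[_ _ /eqP c3 _] := C3.
  have : (color j1 < color j3)%N.
    have jn' : (level j < N0.+1)%N by rewrite ltnS level_le//; case/andP: Cj.
    rewrite /color (bigD1 (Ordinal jn'))//= [ltnRHS](bigD1 (Ordinal jn'))//=.
    have np1 : (pos (level j) <= j1)%N = false by rewrite leqNgt p1.
    rewrite lj p3 np1 /= add0n add1n ltnS; apply: leq_sum => i _.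
    case: (long i) => //=; case: (leqP (pos i) j1) => // pj1.
    by rewrite (leq_trans pj1)// ltnW// (leq_trans p1).
  by rewrite c1 c3 ltnn.
apply: (@le_trans _ _
   (\sum_(0 <= j < n | (level j == level j1) && (start (level j1) < j)%N) mu j +
    \sum_(0 <= j < n | (level j == level j3) && (start (level j3) < j)%N) mu j)).
  rewrite [leLHS]big_nat_cond !(big_mkcond (fun j => _ && (_ < j)%N)) -big_split /=.
  rewrite big_mkcond; apply: ler_sum => j _.
  have a0 (b : bool) : 0 <= if b then mu j else 0 by case: b.
  case: ifP => [/andP[jn hj]|_]; last exact: addr_ge0.
  have Cj : C j by rewrite /C jn.
  have [_ sj] := CP _ Cj.
  case/orP: (two _ Cj) => /eqP lE; rewrite -lE eqxx sj /=.
    by rewrite lerDl.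
  by rewrite lerDr.
by have := level_mass (level j1); have := level_mass (level j3); lra.
Qed.

Lemma size_exceptional : size exceptional = (N0.+1 * (m * q))%N.
Proof.
rewrite size_flatten /shape -map_comp sumnE big_map.
rewrite (eq_bigr (fun=> (m * q)%N)); last by move=> i _ /=; rewrite size_iota.
by rewrite big_const_seq count_predT size_iota iter_addn_0 mulnC.
Qed.

Lemma cut_fixed : exists (removed : pred nat) (color : nat -> nat) (H : seq nat),
  [/\ forall j, (color j <= N0.+1)%N,
      \sum_(0 <= j < n | removed j) mu j <= N0.+1%:R * eps,
      forall b, exists s : int, forall j, (j < n)%N -> ~~ removed j ->
        ((color j < b)%N -> j%:Z <= s) /\ ((b <= color j)%N -> s + m%:Z <= j%:Z),
      forall p, \sum_(0 <= j < n | [&& ~~ removed j, color j == p & j \notin H]) mu j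
        <= 2 * eta
    & (size H <= N0.+1 * (m * q))%N].
Proof.
exists removed, color, exceptional; split.
- exact: color_le.
- exact: removed_mass.
- exact: color_sep.
- exact: color_mass.
- by rewrite size_exceptional.
Qed.

End fixed_mass.

(* The color of a position counts the removed gaps of length m to its left, so
   that distinct colors are m apart; H collects the few positions at which a
   color class may still carry a large mass. *)
Lemma cut_line : exists N : nat, forall (m : nat) (eps : R), (0 < m)%N -> 0 < eps ->
  exists K : nat, forall (n : nat) (mu : nat -> R),
  (forall j, 0 <= mu j) -> \sum_(0 <= j < n) mu j <= M ->
  exists (removed : pred nat) (color : nat -> nat) (H : seq nat),
  [/\ forall j, (color j <= N)%N,
      \sum_(0 <= j < n | removed j) mu j <= N%:R * eps,
      forall b, exists s : int, forall j, (j < n)%N -> ~~ removed j ->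
        ((color j < b)%N -> j%:Z <= s) /\ ((b <= color j)%N -> s + m%:Z <= j%:Z),
      forall p, \sum_(0 <= j < n | [&& ~~ removed j, color j == p & j \notin H]) mu j
        <= 2 * eta
    & (size H <= K)%N].
Proof.
exists N0.+1 => m eps m0 e0.
exists (N0.+1 * (m * (Num.truncn (M / eps)).+1))%N => n mu mu0 muM.
exact: cut_fixed.
Qed.

End cut.

(** * Convergence of distribution functions from characteristic functions *)

Lemma Rintegral_dct (R : realType) (d : measure_display) (T : measurableType d)
    (mu : {measure set T -> \bar R}) (D : set T) (f_ : nat -> T -> R) (f g : T -> R) :
  measurable D ->
  (forall n, measurable_fun D (f_ n)) -> measurable_fun D f ->
  mu.-integrable D (EFin \o g) ->
  (forall x, D x -> f_ n x @[n --> \oo] --> f x) ->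
  (forall n x, D x -> `|f_ n x| <= g x) ->
  \int[mu]_(x in D) f_ n x @[n --> \oo] --> \int[mu]_(x in D) f x.
Proof.
move=> mD mf_ mf ig f_f fg.
have [|||||h1 h2 h3] := @dominated_convergence _ _ _ mu D mD
  (fun n x => (f_ n x)%:E) (EFin \o f) (EFin \o g).
- by move=> n; exact/measurable_EFinP.
- exact/measurable_EFinP.
- by apply: aeW => x Dx; apply: cvg_EFin; [exact: nearW|exact: f_f].
- exact: ig.
- by apply: aeW => x n Dx; rewrite lee_fin fg.
by apply: fine_cvg; rewrite fineK//; exact: integrable_fin_num.
Qed.

(** * The characteristic function of the standard normal law *)

Section gauss.
Context {R : realType}.
Local Notation mu := (@lebesgue_measure R).

Let p : R -> R := normal_pdf 0 1.

Lemma normal_pdf01E x : p x = normal_peak 1 * expR (- x ^+ 2 / 2).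
Proof. by rewrite /p normal_pdfE// /normal_fun subr0 expr1n. Qed.

Lemma normal_peak1_le1 : normal_peak (1 : R) <= 1.
Proof.
rewrite /normal_peak expr1n mul1r.
have h : 1 <= Num.sqrt (pi *+ 2) :> R.
  rewrite -[leLHS]sqrtr1; apply: ler_wsqrtr.
  by have := pi_ge2 R; rewrite mulr2n; lra.
by rewrite invf_le1//; exact: lt_le_trans ltr01 h.
Qed.

Lemma is_derive_normal_pdf01 x : is_derive x (1 : R) p (- x * p x).
Proof.
have -> : p = (fun x => normal_peak 1 * expR (- x ^+ 2 / 2)).
  by apply/funext => y; exact: normal_pdf01E.
by apply: is_derive_eq; rewrite /GRing.scale /=; field.
Qed.

(** Half of the exponent is moved into a normal law of doubled variance; the two sides are in fact
    equal. The exponential factor left over beats polynomials, which yields the integrability of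
    [|x| * p x] and the tail bounds. *)
Lemma normal_pdf_widen (h m x : R) : 0 < h ->
  normal_pdf m h x <=
  Num.sqrt 2 * expR (- (x - m) ^+ 2 / (4 * h ^+ 2)) * normal_pdf m (Num.sqrt 2 * h) x.
Proof.
move=> h0; have s20 : 0 < Num.sqrt 2 :> R by rewrite sqrtr_gt0.
have sh0 : 0 < Num.sqrt 2 * h by rewrite mulr_gt0.
rewrite !normal_pdfE ?gt_eqF// /normal_fun /normal_peak exprMn sqr_sqrtr//.
have -> : Num.sqrt (2 * h ^+ 2 * pi *+ 2) = Num.sqrt 2 * Num.sqrt (h ^+ 2 * pi *+ 2).
  by rewrite -sqrtrM// !mulrnAr !mulrA.
have -> : - (x - m) ^+ 2 / (h ^+ 2 *+ 2) =
    - (x - m) ^+ 2 / (4 * h ^+ 2) + - (x - m) ^+ 2 / (2 * h ^+ 2 *+ 2).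
  by field; rewrite gt_eqF.
rewrite expRD.
have b0 : 0 < Num.sqrt (h ^+ 2 * pi *+ 2).
  by rewrite sqrtr_gt0 mulrn_wgt0// mulr_gt0 ?exprn_gt0// pi_gt0.
move: (expR _) (expR _) (Num.sqrt _) (Num.sqrt _) s20 b0 => x1 x2 a b a0 b0.
rewrite le_eqVlt; apply/orP; left; apply/eqP; field.
by rewrite !gt_eqF.
Qed.

Lemma integrable_norm_normal_pdf01 : mu.-integrable setT (EFin \o (fun x => `|x| * p x)).
Proof.
have s20 : 0 < Num.sqrt 2 :> R by rewrite sqrtr_gt0.
have int2 : mu.-integrable setT (EFin \o (fun x => Num.sqrt 2 * normal_pdf 0 (Num.sqrt 2) x)).
  rewrite (_ : _ \o _ = (fun x => (Num.sqrt 2)%:E * (normal_pdf 0 (Num.sqrt 2) x)%:E)%E)//.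
  by apply: integrableZl => //; exact: integrable_normal_pdf.
apply: le_integrable int2 => //.
  by apply/measurable_EFinP; apply: measurable_funM; [exact: normr_measurable|exact: measurable_normal_pdf].
move=> x _ /=; rewrite lee_fin.
rewrite (ger0_norm (mulr_ge0 (normr_ge0 x) (normal_pdf_ge0 0 1 x))).
rewrite (ger0_norm (mulr_ge0 (ltW s20) (normal_pdf_ge0 0 _ x))).
have := normal_pdf_widen 0 x ltr01; rewrite subr0 expr1n !mulr1 => h.
apply: le_trans (ler_wpM2l (normr_ge0 x) h) _.
rewrite mulrA; apply: ler_wpM2r; first exact: normal_pdf_ge0.
rewrite mulrCA; apply: ler_piMr; first exact: ltW.
rewrite mulNr expRN ler_pdivrMr ?expR_gt0// mul1r.
(* The chain is [exp(x^2 / 4) >= 1 + x^2 / 4 >= |x|], the last step being [(|x| - 2)^2 >= 0]. *)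
apply: le_trans (expR_ge1Dx _).
have -> : x ^+ 2 = `|x| ^+ 2 by rewrite real_normK ?num_real.
by have := sqr_ge0 (`|x| - 2); lra.
Qed.

Lemma integrable_bounded_normal_pdf (m h : R) (g : R -> R) : measurable_fun setT g ->
  (forall x, `|g x| <= 1) ->
  mu.-integrable setT (EFin \o (fun x => g x * normal_pdf m h x)).
Proof.
move=> mg g1; apply: le_integrable (integrable_normal_pdf m h) => //.
  by apply/measurable_EFinP; apply: measurable_funM => //; exact: measurable_normal_pdf.
move=> x _ /=; rewrite lee_fin normrM.
by apply: ler_piMl.
Qed.

Lemma measurable_cosMD t theta : measurable_fun setT (fun x : R => cos (t * x + theta)).
Proof.
apply: (measurableT_comp (f := cos)); last exact: measurable_funD.
apply: continuous_measurable_fun; exact: continuous_cos.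
Qed.

Lemma measurable_sinMD t theta : measurable_fun setT (fun x : R => sin (t * x + theta)).
Proof.
apply: (measurableT_comp (f := sin)); last exact: measurable_funD.
apply: continuous_measurable_fun; exact: continuous_sin.
Qed.

Definition gauss_cf (theta t : R) := \int[mu]_x (cos (t * x + theta) * p x).

Lemma is_derive_gauss_cf theta t :
  is_derive t (1 : R) (gauss_cf theta) (\int[mu]_x (- x * sin (t * x + theta) * p x)).
Proof.
have It : `](t - 1), (t + 1)[%classic t.
  by rewrite /= in_itv/= ltrBlDr ltrDl ltr01.
pose f (t x : R) := cos (t * x + theta) * p x.
have intf s : `](t - 1), (t + 1)[%classic s -> mu.-integrable setT (EFin \o f s).
  move=> _; apply: integrable_bounded_normal_pdf; first exact: measurable_cosMD.
  by move=> x; rewrite ler_norml cos_geN1 cos_le1.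
have df (s x : R) : is_derive s 1 (f ^~ x) (- x * sin (s * x + theta) * p x).
  by rewrite /f; apply: is_derive_eq; rewrite /GRing.scale /=; ring.
have derf s x : `](t - 1), (t + 1)[%classic s -> (setT : set R) x ->
    derivable (f ^~ x) s 1 by move=> _ _; case: (df s x).
have G0 x : 0 <= `|x| * p x by rewrite mulr_ge0// normal_pdf_ge0.
have Gub s x : `](t - 1), (t + 1)[%classic s -> (setT : set R) x ->
    `|partial1of2 f s x| <= `|x| * p x.
  move=> _ _; rewrite partial1of2E derive_val normrM normrM normrN -mulrA.
  rewrite ler_wpM2l// (ger0_norm (normal_pdf_ge0 _ _ _)) ler_piMl ?normal_pdf_ge0//.
  by rewrite ler_norml sin_geN1 sin_le1.
have dE := differentiation_under_integral measurableT It intf derf G0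
  integrable_norm_normal_pdf01 Gub.
have dD := derivable_under_integral measurableT It intf derf G0
  integrable_norm_normal_pdf01 Gub.
apply: DeriveDef; first exact: dD.
rewrite -derive1E dE; apply: eq_Rintegral => x _.
by rewrite partial1of2E derive_val.
Qed.

Lemma integrable_xsin theta t :
  mu.-integrable setT (EFin \o (fun x => x * sin (t * x + theta) * p x)).
Proof.
apply: le_integrable integrable_norm_normal_pdf01 => //.
  apply/measurable_EFinP; apply: measurable_funM; last exact: measurable_normal_pdf.
  by apply: measurable_funM => //; exact: measurable_sinMD.
move=> x _ /=; rewrite lee_fin !normrM normr_id; apply: ler_wpM2r => //.
by apply: ler_piMr => //; rewrite ler_norml sin_geN1 sin_le1.
Qed.

(** The derivative [f] of [F] integrates to 0 over the line, since [F] tends to 0 at both ends.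
    Together with [is_derive_gauss_cf] this is the differential equation [g' = - t g]. *)
Lemma gauss_cf_ibp theta t : \int[mu]_x (x * sin (t * x + theta) * p x) = t * gauss_cf theta t.
Proof.
pose F (x : R) := sin (t * x + theta) * p x.
pose f (x : R) := t * (cos (t * x + theta) * p x) - x * sin (t * x + theta) * p x.
have dF (x : R) : is_derive x 1 F (f x).
  rewrite /F; have dp := is_derive_normal_pdf01 x.
  by apply: is_derive_eq; rewrite /f /GRing.scale /=; ring.
have cosp_int : mu.-integrable setT (EFin \o (fun x => cos (t * x + theta) * p x)).
  apply: integrable_bounded_normal_pdf; first exact: measurable_cosMD.
  by move=> x; rewrite ler_norml cos_geN1 cos_le1.
have xsin_int := integrable_xsin theta t.
have tcos_int : mu.-integrable setT (EFin \o (fun x => t * (cos (t * x + theta) * p x))).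
  rewrite (_ : _ \o _ = (fun x => t%:E * (cos (t * x + theta) * p x)%:E)%E)//.
  exact: integrableZl.
have f_int : mu.-integrable setT (EFin \o f).
  exact: (integrableB measurableT tcos_int xsin_int).
suff f0 : \int[mu]_x f x = 0.
  move: f0; rewrite /f RintegralB// RintegralZl// => /eqP; rewrite subr_eq0 => /eqP <-.
  by [].
have mf : measurable_fun setT f by case/integrableP : f_int => /measurable_EFinP.
have cF : continuous F.
  move=> x; apply/differentiable_continuous/derivable1_diffP.
  by case: (dF x).
(* The successor keeps the endpoints away from 0, where the decay bound [Fle] does not apply. *)
pose D (n : nat) : set R := `[- n.+1%:R, n.+1%:R]%classic.
have lim1 : \int[mu]_x ((f \_ (D n)) x) @[n --> \oo] --> \int[mu]_x f x.
  apply: (@Rintegral_dct _ _ _ mu setT _ _ (fun x => `|f x|)) => //.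
  - move=> n; apply/(measurable_restrictT _ (measurable_itv _)).
    exact: measurable_funTS.
  - exact: integrable_norm f_int.
  - move=> x _; apply: cvg_near_cst; near=> n.
    rewrite patchE ifT//; apply/mem_set; rewrite /D /= in_itv/= -ler_norml.
    apply: (@le_trans _ _ n%:R); last by rewrite ler_nat.
    by near: n; exact: nbhs_infty_ger.
  - move=> n x _; rewrite patchE; case: ifP => // _.
    by rewrite normr0.
have FE n : \int[mu]_x ((f \_ (D n)) x) = F n.+1%:R - F (- n.+1%:R).
  rewrite -Rintegral_mkcond /Rintegral (@continuous_FTC2 _ f F)//.
  - by rewrite (@lt_trans _ _ 0)// ?oppr_lt0 ltr0n.
  - apply: continuous_subspaceT => x.
    apply/differentiable_continuous/derivable1_diffP; rewrite /f.
    by have dp := is_derive_normal_pdf01 x; apply: ex_derive.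
  - split; [by move=> x _; case: (dF x)| |].
    + exact: cvg_at_right_filter (cF _).
    + exact: cvg_at_left_filter (cF _).
  - by move=> x _; rewrite derive1E derive_val.
have Fle x : x != 0 -> `|F x| <= 2 / x ^+ 2.
  move=> x0; rewrite normrM (ger0_norm (normal_pdf_ge0 _ _ _)).
  apply: (@le_trans _ _ (p x)).
    by apply: ler_piMl; rewrite ?normal_pdf_ge0// ler_norml sin_geN1 sin_le1.
  rewrite normal_pdf01E; apply: (@le_trans _ _ (expR (- x ^+ 2 / 2))).
    by apply: ler_piMl; [exact: expR_ge0|exact: normal_peak1_le1].
  rewrite mulNr expRN -[leRHS]invf_div lef_pV2 ?posrE ?expR_gt0 ?divr_gt0 ?exprn_even_gt0//.
  by apply: le_trans (expR_ge1Dx _); rewrite lerDr.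
have lim2 : F n.+1%:R - F (- n.+1%:R) @[n --> \oo] --> 0.
  apply: norm_cvg0; apply: (@squeeze_cvgr _ _ _ _ (cst 0) (fun n => 4 * harmonic n)).
  - apply: nearW => n; rewrite normr_ge0/=; apply: le_trans (ler_normB _ _) _.
    have n0 : n.+1%:R != 0 :> R by rewrite pnatr_eq0.
    apply: le_trans (lerD (Fle _ n0) (Fle (- n.+1%:R) _)) _; first by rewrite oppr_eq0.
    rewrite sqrrN -mulrDl -natrD /harmonic /= ler_wpM2l// lef_pV2 ?posrE ?exprn_gt0//.
    by rewrite expr2 ler_peMl// ler1n.
  - exact: cvg_cst.
  - rewrite -(mulr0 (4 : R)); apply: cvgM; [exact: cvg_cst|exact: cvg_harmonic].
rewrite -(cvg_lim (@Rhausdorff R) lim1); apply/cvg_lim => //.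
by under eq_fun do rewrite FE.
Unshelve. all: end_near.
Qed.

(** Multiplied by [exp(t^2 / 2)], a solution of [g' = - t g] is constant, and its value at 0 is
    [cos theta]. *)
Lemma gauss_cfE theta t : gauss_cf theta t = cos theta * expR (- t ^+ 2 / 2).
Proof.
have dg (s : R) : is_derive s 1 (fun s => gauss_cf theta s * expR (s ^+ 2 / 2)) 0.
  have d1 := is_derive_gauss_cf theta s.
  apply: is_derive_eq; rewrite /GRing.scale /=.
  have -> : \int[mu]_x (- x * sin (s * x + theta) * p x) = - (s * gauss_cf theta s).
    rewrite -gauss_cf_ibp -mulN1r -RintegralZl//.
      by apply: eq_Rintegral => x _; ring.
    exact: integrable_xsin.
  by field.
have := is_derive_0_is_cst t 0 dg.
rewrite expr0n mul0r expR0 mulr1.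
have -> : gauss_cf theta 0 = cos theta.
  transitivity (\int[mu]_x (cos theta * p x)).
    by apply: eq_Rintegral => x _; rewrite mul0r add0r.
  rewrite RintegralZl//; last exact: integrable_normal_pdf.
  by rewrite /Rintegral integral_normal_pdf mulr1.
move=> /(congr1 (fun z => z * expR (- t ^+ 2 / 2))).
by rewrite -mulrA -expRD mulNr subrr expR0 mulr1.
Qed.

End gauss.

(** A bound depending on [y] alone gives integrability on the product because [m1] has mass 1. The
    measurability of the partial integrals is returned too, for later integrations. *)
Lemma RFubini (R : realType) (d1 d2 : measure_display) (T1 : measurableType d1)
    (T2 : measurableType d2) (m1 : probability T1 R)
    (m2 : {sigma_finite_measure set T2 -> \bar R}) (f : T1 * T2 -> R) (k : T2 -> R) :
  measurable_fun setT f -> m2.-integrable setT (EFin \o k) ->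
  (forall x y, `|f (x, y)| <= k y) ->
  [/\ \int[m1]_x \int[m2]_y f (x, y) = \int[m2]_y \int[m1]_x f (x, y),
      measurable_fun setT (fun x => \int[m2]_y f (x, y))
    & measurable_fun setT (fun y => \int[m1]_x f (x, y))].
Proof.
move=> mf ik fk.
have mf1 x : measurable_fun setT (fun y => f (x, y)).
  by apply: measurableT_comp => //; exact: measurable_pair1.
have mf2 y : measurable_fun setT (fun x => f (x, y)).
  by apply: measurableT_comp => //; exact: measurable_pair2.
have i1 x : m2.-integrable setT (EFin \o (fun y => f (x, y))).
  apply: le_integrable ik => //; first exact/measurable_EFinP.
  by move=> y _ /=; rewrite lee_fin (le_trans (fk _ _))// ler_norm.
have i2 y : m1.-integrable setT (EFin \o (fun x => f (x, y))).
  by apply: Bd_L1; split => //; exists (k y).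
have if12 : (m1 \x m2)%E.-integrable setT (EFin \o f).
  apply/integrable12ltyP; first exact/measurable_EFinP.
  apply: (@le_lt_trans _ _ (\int[m1]_x \int[m2]_y `|(k y)%:E|)%E).
    apply: ge0_le_integral => //.
    - by move=> x _; exact: integral_ge0.
    - apply: (@measurable_fun_fubini_tonelli_F _ _ _ _ _ _ (fun z => `|(f z)%:E|%E)) => //.
      by apply: measurableT_comp => //; exact/measurable_EFinP.
    - move=> x _; apply: ge0_le_integral => //.
      + by apply: measurableT_comp => //; exact/measurable_EFinP.
      + by apply: measurableT_comp => //; case/integrableP: ik.
      + by move=> y _ /=; rewrite lee_fin (le_trans (fk _ _))// ler_norm.
  have [_] := integrableP _ _ _ ik; rewrite /=; move: (integral _ _ _) => c c_fin.
  by rewrite integral_cst//= probability_setT mule1.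
have F1 x : (\int[m2]_y (f (x, y))%:E = (\int[m2]_y f (x, y))%:E)%E.
  by rewrite /Rintegral fineK//; exact: (integrable_fin_num measurableT (i1 x)).
have F2 y : (\int[m1]_x (f (x, y))%:E = (\int[m1]_x f (x, y))%:E)%E.
  by rewrite /Rintegral fineK//; exact: (integrable_fin_num measurableT (i2 y)).
split.
  have := Fubini if12; rewrite /= => fub.
  have E1 : (\int[m1]_x \int[m2]_y (f (x, y))%:E =
      \int[m1]_x (\int[m2]_y f (x, y))%:E)%E by apply: eq_integral => x _.
  have E2 : (\int[m2]_y \int[m1]_x (f (x, y))%:E =
      \int[m2]_y (\int[m1]_x f (x, y))%:E)%E by apply: eq_integral => y _.
  by rewrite E1 E2 in fub; rewrite [LHS]/Rintegral [RHS]/Rintegral fub.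
  apply/measurable_EFinP; rewrite (_ : _ \o _ = (fun x => \int[m2]_y (f (x, y))%:E)%E).
    exact: measurable_fubini_F if12.
  by apply/funext => x /=; rewrite F1.
apply/measurable_EFinP; rewrite (_ : _ \o _ = (fun y => \int[m1]_x (f (x, y))%:E)%E).
  exact: measurable_fubini_G if12.
by apply/funext => y /=; rewrite F2.
Qed.

(** * Smoothed indicators as functionals of the characteristic function *)

Section smoothing.
Context {R : realType}.
Local Notation mu := (@lebesgue_measure R).
Local Notation N01 := (@normal_prob R 0 1).

(** The change of variables goes through the Radon-Nikodym derivative, which agrees with
    [normal_pdf] almost everywhere. *)
Lemma mean_normal (g : R -> R) : Bd g ->
  mean N01 g = \int[mu]_x (g x * normal_pdf 0 1 x).
Proof.
move=> [mg [M gM]].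
have ig : N01.-integrable setT (EFin \o g) by apply: Bd_L1; split => //; exists M.
have dom := normal_prob_dominates (0 : R) 1.
rewrite /mean /Rintegral -(Radon_Nikodym_change_of_variables dom)//=.
congr fine; apply: ae_eq_integral => //.
- apply: emeasurable_funM; first exact/measurable_EFinP.
  by apply: (measurable_int mu); exact: Radon_Nikodym_integrable.
- by apply/measurable_EFinP; apply: measurable_funM => //; exact: measurable_normal_pdf.
under [X in ae_eq _ _ _ X]eq_fun do rewrite EFinM.
apply: ae_eqe_mul2l => /=.
rewrite Radon_NikodymE//=.
case: cid => /= h [h1 h2 h3].
apply: integral_ae_eq => //=.
- by apply/measurable_EFinP; exact: measurable_normal_pdf.
- by move=> E E01 mE; rewrite -h3.
Qed.

Lemma cf_normal (t theta : R) :
  mean N01 (fun x => cos (t * x + theta)) = cos theta * expR (- t ^+ 2 / 2).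
Proof.
rewrite mean_normal; last first.
  split; first exact: measurable_cosMD.
  by exists 1 => x; rewrite ler_norml cos_geN1 cos_le1.
exact: gauss_cfE.
Qed.

(* The indicator of [a, b] smoothed by a centered normal law of standard
   deviation h; Fourier inversion of the normal density (normal_pdf_cos) turns
   its expectation into the functional smooth_cf of the characteristic function,
   to which dominated convergence applies. *)
Definition smooth (h a b y : R) : R := \int[mu]_(x in `[a, b]) normal_pdf y h x.

(** The Gaussian is its own Fourier transform: up to its peak, the density at [x] is the
    characteristic function of the standard normal law at [(y - x) / h]. *)
Lemma normal_pdf_cos (h y x : R) : 0 < h ->
  normal_pdf y h x =
  normal_peak h * \int[mu]_z (cos (z / h * y - z / h * x) * normal_pdf 0 1 z).
Proof.
move=> h0; rewrite normal_pdfE ?gt_eqF//; congr (_ * _).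
have := gauss_cfE 0 ((y - x) / h); rewrite cos0 mul1r => E.
transitivity (expR (- ((y - x) / h) ^+ 2 / 2)).
  by rewrite /normal_fun; congr expR; field; rewrite gt_eqF.
rewrite -E; apply: eq_Rintegral => z _; rewrite addr0; congr (cos _ * _).
by field; rewrite gt_eqF.
Qed.

Lemma normal_pdfC (h y x : R) : h != 0 -> normal_pdf y h x = normal_pdf x h y.
Proof.
by move=> h0; rewrite !normal_pdfE// /normal_fun -[in RHS]sqrrN opprB.
Qed.

Lemma Bd_normal_pdf (h x : R) : h != 0 -> Bd (fun y : R => normal_pdf y h x).
Proof.
move=> h0; under eq_fun do rewrite normal_pdfC//.
split; first exact: measurable_normal_pdf.
exists (normal_peak h) => y; rewrite ger0_norm ?normal_pdf_ge0//.
exact: normal_pdf_ub.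
Qed.

Definition smooth_cf (h a b : R) (A : R -> R -> R) : R :=
  \int[mu]_(x in `[a, b]) (normal_peak h *
    \int[mu]_z (A (z / h) (- (z / h * x)) * normal_pdf 0 1 z)).

Section one_law.
Context {d : measure_display} {T : measurableType d} (Q : probability T R).
Variables (Y : T -> R) (h : R).
Hypothesis mY : measurable_fun setT Y.
Hypothesis h_gt0 : 0 < h.

Let A t theta := mean Q (fun w => cos (t * Y w + theta)).

Lemma mean_cos_le1 t theta : `|A t theta| <= 1.
Proof.
rewrite -[leRHS](mean_cst Q); apply: mean_norm_le.
- by apply: Bd_L1; apply: Bd_cos; apply: measurable_funD => //; exact: measurable_funM.
- exact/Bd_L1/Bd_cst.
- by move=> w; rewrite ler_norml cos_geN1 cos_le1.
Qed.

Lemma mean_normal_pdf x :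
  mean Q (fun w => normal_pdf (Y w) h x) =
    normal_peak h * \int[mu]_z (A (z / h) (- (z / h * x)) * normal_pdf 0 1 z) /\
  measurable_fun setT (fun z : R => A (z / h) (- (z / h * x)) * normal_pdf 0 1 z).
Proof.
pose f (u : T * R) := cos (u.2 / h * Y u.1 - u.2 / h * x) * normal_pdf 0 1 u.2.
have mf : measurable_fun setT f.
  apply: measurable_funM; last exact: measurableT_comp (measurable_normal_pdf _ _) measurable_snd.
  apply: (measurableT_comp (f := cos)).
    by apply: continuous_measurable_fun; exact: continuous_cos.
  by apply: measurable_funB; apply: measurable_funM => //; [apply: measurable_funM => //|exact: measurableT_comp mY measurable_fst|apply: measurable_funM => //].
have fk w z : `|f (w, z)| <= normal_pdf 0 1 z.
  rewrite normrM (ger0_norm (normal_pdf_ge0 _ _ _)).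
  by apply: ler_piMl; [exact: normal_pdf_ge0|rewrite ler_norml cos_geN1 cos_le1].
have [fub _ mG] := @RFubini R _ _ _ _ Q mu f (normal_pdf 0 1) mf
  (integrable_normal_pdf 0 1) fk.
have inner z : \int[Q]_w f (w, z) = A (z / h) (- (z / h * x)) * normal_pdf 0 1 z.
  rewrite /f /= RintegralZr//.
  apply: Bd_L1; apply: Bd_cos; apply: measurable_funB => //.
  by apply: measurable_funM.
split; last by move: mG; under eq_fun do rewrite inner.
rewrite (eq_mean _ (g := fun w => normal_peak h * \int[mu]_z f (w, z))); last first.
  by move=> w; rewrite normal_pdf_cos.
have mF w : mu.-integrable setT (EFin \o (fun z => f (w, z))).
  apply: le_integrable (integrable_normal_pdf 0 1) => //.
    by apply/measurable_EFinP; apply: measurableT_comp => //; exact: measurable_pair1.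
  by move=> z _ /=; rewrite lee_fin (le_trans (fk _ _))// ler_norm.
have BF : L1 Q (fun w => \int[mu]_z f (w, z)).
  have k0 : normal_peak h != 0 by rewrite gt_eqF// normal_peak_gt0// gt_eqF.
  have hn0 : h != 0 by rewrite gt_eqF.
  rewrite (_ : (fun w => _) = fun w => (normal_peak h)^-1 * normal_pdf (Y w) h x).
    apply: L1Z; apply: Bd_L1; have [mp [M pM]] := Bd_normal_pdf x hn0.
    by split; [exact: measurableT_comp mp mY|exists M => w].
  by apply/funext => w; rewrite normal_pdf_cos// mulKf.
rewrite meanZ// /mean fub; congr (_ * _).
by apply: eq_Rintegral => z _; exact: inner.
Qed.

Lemma measurable_mean_normal_pdf :
  measurable_fun setT (fun x => mean Q (fun w => normal_pdf (Y w) h x)) /\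
  forall a b, measurable_fun setT (fun w => smooth h a b (Y w)) /\
    mean Q (fun w => smooth h a b (Y w)) = smooth_cf h a b A.
Proof.
have hn0 : h != 0 by rewrite gt_eqF.
have mpdf : measurable_fun setT (fun u : T * R => normal_pdf (Y u.1) h u.2).
  under eq_fun do rewrite normal_pdfE// /normal_fun.
  apply: measurable_funM => //; apply: measurableT_comp => //.
  apply: measurable_funM => //; apply: measurableT_comp => //.
  apply: measurable_funX; apply: measurable_funB; first exact: measurable_snd.
  exact: measurableT_comp mY measurable_fst.
have mN : measurable_fun setT (fun x => mean Q (fun w => normal_pdf (Y w) h x)).
  (* [N01] serves as a finite measure for which the constant bound [normal_peak h] is integrable;
     what is wanted is the measurability in [x]. *)
  have [] := @RFubini R _ _ _ _ Q N01 (fun u => normal_pdf (Y u.1) h u.2)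
    (fun=> normal_peak h) mpdf => //.
    by apply: Bd_L1; exact: Bd_cst.
  by move=> w x; rewrite ger0_norm ?normal_pdf_ge0//; exact: normal_pdf_ub.
split => // a b.
pose f (u : T * R) := normal_pdf (Y u.1) h u.2 * \1_(`[a, b]%classic : set R) u.2.
have mf : measurable_fun setT f.
  apply: measurable_funM => //.
  by apply: (measurableT_comp _ measurable_snd); exact: measurable_indic.
pose k (x : R) := normal_peak h * \1_(`[a, b]%classic : set R) x.
have fk w x : `|f (w, x)| <= k x.
  rewrite /f /k normrM (ger0_norm (normal_pdf_ge0 _ _ _)) ger0_norm//.
  by apply: ler_wpM2r => //; exact: normal_pdf_ub.
have ik : mu.-integrable setT (EFin \o k).
  rewrite (_ : _ \o _ = (fun x => (normal_peak h)%:E * (\1_(`[a, b]%classic : set R) x)%:E)%E)//.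
  by apply: integrableZl => //; exact: integrable_indic_itv.
have [fub mF _] := @RFubini R _ _ _ _ Q mu f k mf ik fk.
have smE w : smooth h a b (Y w) = \int[mu]_x f (w, x).
  rewrite /smooth Rintegral_mkcond; apply: eq_Rintegral => x _.
  by rewrite patchE /f/= indicE; case: (_ \in _); rewrite ?mulr1 ?mulr0.
split; first by under eq_fun do rewrite smE.
transitivity (\int[Q]_w \int[mu]_x f (w, x)); first by apply: eq_mean.
rewrite fub /smooth_cf [RHS]Rintegral_mkcond; apply: eq_Rintegral => x _.
rewrite patchE; have [<- _] := mean_normal_pdf x; rewrite /f/= indicE.
case: (_ \in _) => /=.
  by apply: eq_Rintegral => w _; rewrite mulr1.
by under eq_Rintegral do rewrite mulr0; exact: mean_cst.
Qed.

End one_law.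

Section limit.
Context {d : measure_display} {T : measurableType d} (P : probability T R).
Variable Y : nat -> T -> R.
Hypothesis mY : forall n, measurable_fun setT (Y n).
Hypothesis cfY : forall t theta, mean P (fun w => cos (t * Y n w + theta)) @[n --> \oo]
  --> cos theta * expR (- t ^+ 2 / 2).

Let An n t theta := mean P (fun w => cos (t * Y n w + theta)).
Let A0 t theta := mean N01 (fun x => cos (t * x + theta)).

Let A_cvg t theta : An n t theta @[n --> \oo] --> A0 t theta.
Proof. by rewrite /A0 cf_normal; exact: cfY. Qed.

Let mid : measurable_fun setT (fun x : R => x). Proof. exact: measurable_id. Qed.

(** Dominated convergence twice: in [z] against the normal density, then in [x] over the bounded
    interval. *)
Lemma mean_smooth_cvg (h a b : R) : 0 < h ->
  mean P (fun w => smooth h a b (Y n w)) @[n --> \oo] --> mean N01 (smooth h a b).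
Proof.
move=> h0; have k0 : 0 < normal_peak h by rewrite normal_peak_gt0// gt_eqF.
have [m0 E0] := measurable_mean_normal_pdf N01 mid h0; rewrite (E0 a b).2.
under eq_fun do rewrite ((measurable_mean_normal_pdf P (mY _) h0).2 a b).2.
pose G (A : R -> R -> R) x := \int[mu]_z (A (z / h) (- (z / h * x)) * normal_pdf 0 1 z).
have mG n : measurable_fun setT (fun x => normal_peak h * G (An n) x).
  have [mN _] := measurable_mean_normal_pdf P (mY n) h0.
  by move: mN; under eq_fun do rewrite (mean_normal_pdf P (mY n) h0 _).1.
have mG0 : measurable_fun setT (fun x => normal_peak h * G A0 x).
  by move: m0; under eq_fun do rewrite (mean_normal_pdf N01 mid h0 _).1.
have An1 n t theta : `|An n t theta| <= 1 by exact: mean_cos_le1.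
have bd n x z : `|An n (z / h) (- (z / h * x)) * normal_pdf 0 1 z| <= normal_pdf 0 1 z.
  rewrite normrM (ger0_norm (normal_pdf_ge0 _ _ _)).
  by apply: ler_piMl; [exact: normal_pdf_ge0|exact: An1].
have mAn n x := (mean_normal_pdf P (mY n) h0 x).2.
have mA0 x := (mean_normal_pdf N01 mid h0 x).2.
have G_cvg x : G (An n) x @[n --> \oo] --> G A0 x.
  apply: (@Rintegral_dct _ _ _ mu setT _ _ (normal_pdf 0 1)) => //.
  - by move=> n; exact: mAn.
  - exact: mA0.
  - exact: integrable_normal_pdf.
  - move=> z _; apply: cvgM; [exact: A_cvg|exact: cvg_cst].
have G1 n x : `|G (An n) x| <= 1.
  apply: le_trans (le_normr_Rintegral _ _) _ => //.
    by apply: le_integrable (integrable_normal_pdf 0 1) => //;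
      [apply/measurable_EFinP; exact: mAn|move=> z _ /=; rewrite lee_fin (le_trans (bd _ _ _))// ler_norm].
  apply: (@le_trans _ _ (\int[mu]_z normal_pdf 0 1 z)).
    apply: le_Rintegral => //; last exact: integrable_normal_pdf.
    apply: le_integrable (integrable_normal_pdf 0 1) => //.
      by apply/measurable_EFinP; apply: (measurableT_comp (@normr_measurable _ _)); exact: mAn.
    by move=> z _ /=; rewrite lee_fin normr_id (le_trans (bd _ _ _))// ler_norm.
  by rewrite /Rintegral integral_normal_pdf.
rewrite /smooth_cf.
apply: (@Rintegral_dct _ _ _ mu `[a, b]%classic _ _ (fun=> normal_peak h)) => //.
- by move=> n; apply: measurable_funTS; exact: mG.
- by apply: measurable_funTS.
- apply: continuous_compact_integrable; first exact: segment_compact.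
  by apply: continuous_subspaceT => x; exact: cvg_cst.
- by move=> x _; apply: cvgM; [exact: cvg_cst|exact: G_cvg].
- by move=> n x _; rewrite normrM (gtr0_norm k0); apply: ler_piMr; [exact: ltW|exact: G1].
Qed.

End limit.

End smoothing.

(** * From smoothed intervals to distribution functions *)

Section levy.
Context {R : realType}.
Local Notation mu := (@lebesgue_measure R).
Local Notation N01 := (@normal_prob R 0 1).

Lemma normal_prob_fin (m h : R) (A : set R) : measurable A ->
  normal_prob m h A = (fine (normal_prob m h A))%:E.
Proof. by move=> mA; rewrite fineK// fin_num_measure. Qed.

Lemma tail_bound_ge0 (h delta : R) : 0 <= Num.sqrt 2 * (4 * h ^+ 2 / delta ^+ 2).
Proof.
apply: mulr_ge0; first exact: sqrtr_ge0.
by apply: divr_ge0; [apply: mulr_ge0 => //|]; exact: sqr_ge0.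
Qed.

(** On [A] the exponential factor of [normal_pdf_widen] is at most [4 h^2 / delta^2], as
    [exp(-y) <= 1 / y] for positive [y]. *)
Lemma normal_prob_far (m h delta : R) (A : set R) : 0 < h -> 0 < delta -> measurable A ->
  (forall x, A x -> delta ^+ 2 <= (x - m) ^+ 2) ->
  fine (normal_prob m h A) <= Num.sqrt 2 * (4 * h ^+ 2 / delta ^+ 2).
Proof.
move=> h0 d0 mA farA.
have s20 : 0 < Num.sqrt 2 :> R by rewrite sqrtr_gt0.
have d2 : 0 < delta ^+ 2 by rewrite exprn_gt0.
have h2 : 0 < 4 * h ^+ 2 by rewrite mulr_gt0// exprn_gt0.
set gamma := _ * _.
have g0 : 0 <= gamma by rewrite mulr_ge0 ?divr_ge0// ltW.
have le1 : fine (normal_prob m (Num.sqrt 2 * h) A) <= 1.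
  by rewrite -lee_fin -normal_prob_fin//; exact: probability_le1.
apply: (@le_trans _ _ (gamma * fine (normal_prob m (Num.sqrt 2 * h) A))); last exact: ler_piMr.
rewrite -lee_fin EFinM -!normal_prob_fin// /normal_prob -ge0_integralZl//.
- apply: ge0_le_integral => //.
  + by move=> x _; rewrite lee_fin normal_pdf_ge0.
  + by apply/measurable_EFinP/measurable_funTS; exact: measurable_normal_pdf.
  + by apply: measurable_funeM; apply/measurable_EFinP/measurable_funTS; exact: measurable_normal_pdf.
  + move=> x Ax; rewrite lee_fin; apply: le_trans (normal_pdf_widen _ _ h0) _.
    apply: ler_wpM2r; first exact: normal_pdf_ge0.
    rewrite /gamma ler_pM2l// mulNr expRN -[leRHS]invf_div.
    rewrite lef_pV2 ?posrE ?expR_gt0 ?divr_gt0//.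
    apply: le_trans (expR_ge1Dx _); apply: ler_wpDl => //.
    by rewrite ler_pM2r ?invr_gt0//; exact: farA.
- by apply/measurable_EFinP/measurable_funTS; exact: measurable_normal_pdf.
- by move=> x _; rewrite lee_fin normal_pdf_ge0.
Qed.

Lemma prob_subU (d : measure_display) (T : measurableType d) (Q : probability T R)
    (A B C : set T) : measurable A -> measurable B -> measurable C ->
  A `<=` B `|` C -> fine (Q A) <= fine (Q B) + fine (Q C).
Proof.
move=> mA mB mC ABC; rewrite -lee_fin EFinD !fineK ?fin_num_measure//.
apply: (le_trans _ (measureU2 _ mB mC)); apply: le_measure => //; apply/mem_set => //.
exact: measurableU.
Qed.

Lemma prob_setC (d : measure_display) (T : measurableType d) (Q : probability T R)
    (A : set T) : measurable A -> fine (Q (~` A)) = 1 - fine (Q A).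
Proof. by move=> mA; rewrite probability_setC// fineB// fin_num_measure. Qed.

Lemma smoothE (h a b y : R) : smooth h a b y = fine (normal_prob y h `[a, b]%classic).
Proof. by []. Qed.

Lemma smooth_ge0 (h a b y : R) : 0 <= smooth h a b y.
Proof. by apply: Rintegral_ge0 => x _; exact: normal_pdf_ge0. Qed.

Lemma smooth_le1 (h a b y : R) : smooth h a b y <= 1.
Proof. by rewrite smoothE -lee_fin -normal_prob_fin//; exact: probability_le1. Qed.

(** If [y] is outside the enlarged interval, all of [[a, b]] lies at distance at least [delta] from
    [y] and [normal_prob_far] applies. *)
Lemma smooth_upper (h a b delta y : R) : 0 < h -> 0 < delta ->
  smooth h a b y <= \1_(`](a - delta), (b + delta)[%classic : set R) y +
    Num.sqrt 2 * (4 * h ^+ 2 / delta ^+ 2).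
Proof.
move=> h0 d0; have g0 := tail_bound_ge0 h delta.
rewrite indicE; case: (boolP (_ \in _)) => [_|] /=.
  by have := smooth_le1 h a b y; lra.
move=> /negP yab; rewrite add0r smoothE; apply: normal_prob_far => // x /=.
rewrite in_itv/= => /andP[ax xb].
have [ya|ay] := leP y (a - delta); first by nra.
have [yb|byd] := ltP y (b + delta); last by nra.
by exfalso; apply: yab; apply/mem_set; rewrite /= in_itv/= ay.
Qed.

Lemma smooth_lower (h a b delta y : R) : 0 < h -> 0 < delta ->
  \1_(`[(a + delta), (b - delta)]%classic : set R) y -
    Num.sqrt 2 * (4 * h ^+ 2 / delta ^+ 2) <= smooth h a b y.
Proof.
move=> h0 d0; have g0 := tail_bound_ge0 h delta.
rewrite indicE; case: (boolP (_ \in _)) => [|_] /=; last first.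
  by have := smooth_ge0 h a b y; lra.
move=> /set_mem; rewrite /= in_itv/= => /andP[ay yb].
have mI : measurable (`[a, b]%classic : set R) by exact: measurable_itv.
have far : fine (normal_prob y h (~` `[a, b]%classic)) <= Num.sqrt 2 * (4 * h ^+ 2 / delta ^+ 2).
  apply: normal_prob_far => //; first exact: measurableC.
  move=> x /= /negP; rewrite in_itv/= negb_and -!ltNge => /orP[xa|bx]; nra.
by move: far; rewrite prob_setC// smoothE; lra.
Qed.

Lemma normal_prob_itv_le (c l : R) : 0 <= l ->
  fine (N01 `[c, (c + l)]%classic) <= l.
Proof.
move=> l0; rewrite -lee_fin -normal_prob_fin// /normal_prob.
apply: (@le_trans _ _ (\int[mu]_(x in `[c, (c + l)%R]) cst (1%R%:E : \bar R) x)%E).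
  apply: ge0_le_integral => //.
  - by move=> x _; rewrite lee_fin normal_pdf_ge0.
  - by apply/measurable_EFinP/measurable_funTS; exact: measurable_normal_pdf.
  - move=> x _ /=; rewrite lee_fin; apply: le_trans (@normal_peak1_le1 R).
    exact: normal_pdf_ub.
rewrite integral_cst//= mul1e lebesgue_measure_itv/= lte_fin ltrDl.
by case: ltP => _; rewrite -?EFinB lee_fin// addrAC subrr add0r.
Qed.

(** The two end pieces have length [2 * delta] and the density is at most 1. *)
Lemma normal_cover (a b delta : R) : 0 < delta ->
  fine (N01 `[a, b]%classic) <=
    fine (N01 `[(a + delta + delta), (b - delta - delta)]%classic) + 4 * delta.
Proof.
move=> d0.
have mI (c c' : R) : measurable (`[c, c']%classic : set R) by exact: measurable_itv.
have l2 : 0 <= 2 * delta by lra.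
have i1 := normal_prob_itv_le a l2; have i2 := normal_prob_itv_le (b - 2 * delta) l2.
have sub : (`[a, b] `<=` `[(a + delta + delta), (b - delta - delta)] `|`
    (`[a, (a + 2 * delta)] `|` `[(b - 2 * delta), (b - 2 * delta + 2 * delta)]))%classic.
  move=> x /=; rewrite !in_itv/= => /andP[ax xb].
  have [h1|h1] := leP x (a + 2 * delta); first by right; left; rewrite ax.
  have [h2|h2] := leP (b - 2 * delta) x; first by right; right; apply/andP; split; lra.
  by left; apply/andP; split; lra.
have := prob_subU N01 (mI _ _) (mI _ _) (measurableU _ _ (mI _ _) (mI _ _)) sub.
have := prob_subU N01 (measurableU _ _ (mI _ _) (mI _ _)) (mI _ _) (mI _ _)
  (@subset_refl _ (`[a, (a + 2 * delta)] `|` `[(b - 2 * delta), (b - 2 * delta + 2 * delta)])%classic).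
by lra.
Qed.

Section limit.
Context {d : measure_display} {T : measurableType d} (P : probability T R).
Variable Y : nat -> T -> R.
Hypothesis mY : forall n, measurable_fun setT (Y n).
Hypothesis cfY : forall t theta, mean P (fun w => cos (t * Y n w + theta)) @[n --> \oo]
  --> cos theta * expR (- t ^+ 2 / 2).

Lemma measurable_preimage n (A : set R) : measurable A -> measurable (Y n @^-1` A).
Proof. by move=> mA; rewrite -[X in measurable X]setTI; exact: mY. Qed.

Lemma interval_liminf (a b e : R) : 0 < e ->
  \forall n \near \oo, fine (N01 `[a, b]%classic) - e <=
    fine (P (Y n @^-1` `]a, b[%classic)).
Proof.
(* The choice of [h] below makes the tail bound [gamma] at most [delta]. The losses are [4 * delta]
   from [normal_cover], [gamma] twice and [delta] once from the convergence, which is less than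
   [16 * delta = e]. *)
move=> e0; pose delta := e / 16; have d0 : 0 < delta by rewrite divr_gt0.
pose h := delta * Num.sqrt (delta / 8).
have h0 : 0 < h by rewrite mulr_gt0// sqrtr_gt0 divr_gt0.
set a' := a + delta; set b' := b - delta.
have g1 : Num.sqrt 2 * (4 * h ^+ 2 / delta ^+ 2) <= delta.
  rewrite /h exprMn sqr_sqrtr; last by rewrite divr_ge0// ltW.
  have s2 : Num.sqrt 2 <= 2 :> R.
    rewrite -[leRHS]ger0_norm// -sqrtr_sqr ler_wsqrtr//.
    by rewrite expr2 ler_peMl// ler1n.
  rewrite (_ : 4 * _ / _ = delta / 2); last by field; rewrite gt_eqF.
  by apply: le_trans (ler_wpM2r _ s2) _; [lra|lra].
set gamma := Num.sqrt 2 * _ in g1.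
have := mean_smooth_cvg mY cfY (a := a') (b := b') h0.
move=> /cvgrPdist_le/(_ _ d0); apply: filterS => n /ler_normlW close.
have mI (c c' : R) : measurable (`[c, c']%classic : set R) by exact: measurable_itv.
have up : mean P (fun w => smooth h a' b' (Y n w)) <=
    fine (P (Y n @^-1` `]a, b[%classic)) + gamma.
  have mYn := measurable_preimage n (measurable_itv `]a, b[).
  rewrite -(mean_indic P mYn)/= -[X in _ + X](mean_cst P) -meanD; last 2 first.
  - by apply: Bd_L1; exact: Bd_indic.
  - exact/Bd_L1/Bd_cst.
  apply: mean_le.
  - have [_ /(_ a' b')[ms _]] := measurable_mean_normal_pdf P (mY n) h0.
    apply: Bd_L1; split => //; exists 1 => w.
    by rewrite ger0_norm ?smooth_ge0 ?smooth_le1.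
  - by apply: L1D; apply: Bd_L1; [exact: Bd_indic|exact: Bd_cst].
  move=> w; have := smooth_upper a' b' (Y n w) h0 d0.
  by rewrite /a' /b' addrK subrK.
have low : fine (N01 `[(a' + delta), (b' - delta)]%classic) - gamma <=
    mean N01 (smooth h a' b').
  rewrite -(mean_indic N01 (mI _ _))/= -[X in _ - X](mean_cst N01) -meanB; last 2 first.
  - by apply: Bd_L1; exact: Bd_indic.
  - exact/Bd_L1/Bd_cst.
  apply: mean_le.
  - by apply: L1B; apply: Bd_L1; [exact: Bd_indic|exact: Bd_cst].
  - have [_ /(_ a' b')[ms _]] := @measurable_mean_normal_pdf _ _ _ N01 id h (@measurable_id _ _ _) h0.
    apply: Bd_L1; split => //; exists 1 => w.
    by rewrite ger0_norm ?smooth_ge0 ?smooth_le1.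
  by move=> y; exact: smooth_lower.
have cover := normal_cover a b d0.
rewrite -/a' -/b' in cover.
have de : e = 16 * delta by rewrite /delta; field.
move: (mean N01 _) low close => M1 low close.
move: (mean P _) up close => M2 up close.
move: (fine (N01 `[_ + _, _]%classic)) low cover => p1 low cover.
move: (fine (N01 _)) cover => p2 cover.
move: (fine (P _)) up => p3 up.
by clear -up low cover close g1 de d0; clearbody gamma h delta; lra.
Qed.

(** Lower bounds for open intervals on both sides of [x] suffice: the one for []x, delta[] bounds
    the distribution function at [x] from above by passing to the complement. One [e] comes from
    [interval_liminf], the other from the normal tail beyond [delta]. *)
Lemma levy_cdf (x e : R) : 0 < e ->
  \forall n \near \oo, `|fine (N01 `]-oo, x]%classic) -
    fine (P (Y n @^-1` `]-oo, x]%classic))| <= 2 * e.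
Proof.
(* The tail bound with deviation 1 is at most [8 / delta^2 <= 8 / delta <= e], where [delta >= 1] is
   used; the term [|x|] puts [x] strictly inside. *)
move=> e0; pose delta := `|x| + 8 / e + 1.
have e80 : 0 < 8 / e by rewrite divr_gt0.
have d1 : 1 <= delta by rewrite /delta; have := normr_ge0 x; lra.
have d0 : 0 < delta by exact: lt_le_trans ltr01 d1.
have xd : `|x| < delta by rewrite /delta; lra.
have /andP[dx xd'] : - delta < x < delta by rewrite -ltr_norml.
have s2 : Num.sqrt 2 <= 2 :> R.
  rewrite -[leRHS]ger0_norm// -sqrtr_sqr ler_wsqrtr//.
  by rewrite expr2 ler_peMl// ler1n.
have g1 : Num.sqrt 2 * (4 * 1 ^+ 2 / delta ^+ 2) <= e.
  rewrite expr1n mulr1; apply: (@le_trans _ _ (8 / delta)).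
    rewrite mulrA; apply: ler_pM; rewrite ?mulr_ge0 ?invr_ge0 ?sqr_ge0//; first by lra.
    by rewrite lef_pV2 ?posrE ?exprn_gt0// expr2 ler_peMl// ltW.
  rewrite ler_pdivrMr// mulrC -ler_pdivrMr// /delta.
  by have := normr_ge0 x; lra.
have mI (i : interval R) : measurable ([set` i] : set R) by exact: measurable_itv.
have tail1 : fine (N01 `]-oo, - delta[%classic) <= e.
  apply: le_trans g1; apply: normal_prob_far => // y /=; rewrite in_itv/= => yd.
  by rewrite subr0; nra.
have tail2 : fine (N01 `]delta, +oo[%classic) <= e.
  apply: le_trans g1; apply: normal_prob_far => // y /=; rewrite in_itv/= andbT => yd.
  by rewrite subr0; nra.
have cov : fine (N01 `]-oo, x]%classic) <=
    fine (N01 `]-oo, - delta[%classic) + fine (N01 `[- delta, x]%classic).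
  apply: prob_subU => // y /=; rewrite !in_itv/= => yx.
  by case: (ltP y (- delta)) => h; [left|right; apply/andP].
have cov' : fine (N01 (~` `]-oo, x]%classic)) <=
    fine (N01 `[x, delta]%classic) + fine (N01 `]delta, +oo[%classic).
  apply: prob_subU => //; first exact: measurableC.
  move=> y /= /negP; rewrite !in_itv/= -ltNge andbT => xy.
  by case: (ltP delta y) => h; [right|left; apply/andP; split => //; exact: ltW].
rewrite prob_setC// in cov'.
have L1 := interval_liminf (- delta) x e0; have L2 := interval_liminf x delta e0.
near=> n.
have l1 : fine (N01 `[- delta, x]%classic) - e <= fine (P (Y n @^-1` `]- delta, x[%classic)).
  by near: n.
have l2 : fine (N01 `[x, delta]%classic) - e <= fine (P (Y n @^-1` `]x, delta[%classic)).
  by near: n.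
have mP (i : interval R) : measurable (Y n @^-1` [set` i]) by exact: measurable_preimage.
have s1 : fine (P (Y n @^-1` `]- delta, x[%classic)) <= fine (P (Y n @^-1` `]-oo, x]%classic)).
  have := prob_subU P (mP `]- delta, x[) (mP `]-oo, x]) measurable0.
  rewrite measure0/= addr0; apply => w /=; rewrite !in_itv/= => /andP[_ /ltW]; by left.
have s2' : fine (P (Y n @^-1` `]x, delta[%classic)) <= 1 - fine (P (Y n @^-1` `]-oo, x]%classic)).
  rewrite -prob_setC//.
  have := prob_subU P (mP `]x, delta[) (measurableC (mP `]-oo, x])) measurable0.
  rewrite measure0/= addr0; apply => w /=; rewrite !in_itv/= => /andP[xy _]; left.
  by apply/negP; rewrite -ltNge.
rewrite ler_norml; apply/andP; split; lra.
Unshelve. all: end_near.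
Qed.

End limit.
End levy.

(** * Characteristic function of the blocked, truncated sum *)

Section taylor.
Context {R : realType}.
Implicit Types x y : R.

(** Used as a ladder: starting from [1 - cos >= 0], the lemmas [sin_le], [cos_ge], [sin_ge] and
    [cos_le] each integrate the preceding bound. *)
Lemma ge0_of_derive (f df : R -> R) : f 0 = 0 ->
  (forall x, is_derive x (1 : R) f (df x)) -> (forall x, 0 <= x -> 0 <= df x) ->
  forall x, 0 <= x -> 0 <= f x.
Proof.
move=> f0 fdf df0 x x0.
have cf : {within `[0, x], continuous f}.
  apply: continuous_subspaceT => y.
  by apply/differentiable_continuous/derivable1_diffP; case: (fdf y).
have [c /andP[c0 _] E] := MVT_segment x0 (fun y _ => fdf y) cf.
rewrite bnd_simp in c0.
have -> : f x = df c * (x - 0) by rewrite -E f0 subr0.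
by rewrite mulr_ge0 ?subr_ge0//; exact: df0.
Qed.

Lemma sin_le x : 0 <= x -> sin x <= x.
Proof.
move=> x0; rewrite -subr_ge0.
apply: (@ge0_of_derive (fun y => y - sin y) (fun y => 1 - cos y)) => //.
- by rewrite sin0 subr0.
Qed.

Lemma cos_ge x : 1 - x ^+ 2 / 2 <= cos x.
Proof.
wlog x0 : x / 0 <= x => [h|].
  have [|/ltW x0] := leP 0 x; first exact: h.
  by rewrite -sqrrN -cosN h// oppr_ge0.
rewrite -subr_ge0.
apply: (@ge0_of_derive (fun y => cos y - (1 - y ^+ 2 / 2)) (fun y => y - sin y)) => //.
- by rewrite cos0 expr0n mul0r subr0 subrr.
- by move=> y; apply: is_derive_eq; rewrite /GRing.scale /=; field.
- by move=> y y0; rewrite subr_ge0 sin_le.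
Qed.

Lemma sin_ge x : 0 <= x -> x - x ^+ 3 / 6 <= sin x.
Proof.
move=> x0; rewrite -subr_ge0.
apply: (@ge0_of_derive (fun y => sin y - (y - y ^+ 3 / 6))
  (fun y => cos y - (1 - y ^+ 2 / 2))) => //.
- by rewrite sin0 expr0n mul0r !subr0.
- by move=> y; apply: is_derive_eq; rewrite /GRing.scale /=; field.
- by move=> y _; rewrite subr_ge0 cos_ge.
Qed.

Lemma sin_taylor x : `|sin x - x| <= `|x| ^+ 3 / 6.
Proof.
wlog x0 : x / 0 <= x => [h|].
  have [|/ltW x0] := leP 0 x; first exact: h.
  by have := h (- x); rewrite sinN -opprD !normrN; apply; rewrite oppr_ge0.
rewrite (ger0_norm x0) ler_norml; have := sin_le x0; have := sin_ge x0.
have : 0 <= x ^+ 3 by rewrite exprn_ge0.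
by move=> h1 h2 h3; apply/andP; split; lra.
Qed.

Lemma cos_le x : cos x <= 1 - x ^+ 2 / 2 + x ^+ 4 / 24.
Proof.
wlog x0 : x / 0 <= x => [h|].
  have [|/ltW x0] := leP 0 x; first exact: h.
  rewrite -cosN -sqrrN (_ : x ^+ 4 = (- x) ^+ 4); last by rewrite exprNn -signr_odd mul1r.
  by rewrite h// oppr_ge0.
rewrite -subr_ge0.
apply: (@ge0_of_derive (fun y => 1 - y ^+ 2 / 2 + y ^+ 4 / 24 - cos y)
  (fun y => sin y - (y - y ^+ 3 / 6))) => //.
- by rewrite cos0 !expr0n /= !mul0r subr0 addr0 subrr.
- by move=> y; apply: is_derive_eq; rewrite /GRing.scale /=; field.
- by move=> y y0; rewrite subr_ge0 sin_ge.
Qed.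

Lemma cos_taylor x : `|cos x - (1 - x ^+ 2 / 2)| <= x ^+ 4 / 24.
Proof.
have : 0 <= x ^+ 4 by rewrite exprn_even_ge0.
have := cos_le x; have := cos_ge x; rewrite ler_norml.
by move=> h1 h2 h3; apply/andP; split; lra.
Qed.

Lemma expRN_le y : 0 <= y -> expR (- y) <= 1 - y + y ^+ 2 / 2.
Proof.
move=> y0; rewrite -subr_ge0.
apply: (@ge0_of_derive (fun y => 1 - y + y ^+ 2 / 2 - expR (- y))
  (fun y => expR (- y) - (1 - y))) => //.
- by rewrite !oppr0 expR0 expr0n /= mul0r !addr0 subrr.
- by move=> z; apply: is_derive_eq; rewrite /GRing.scale /=; field.
- by move=> z _; rewrite subr_ge0; exact: expR_ge1Dx.
Qed.

Lemma expRN_taylor y : 0 <= y -> `|expR (- y) - (1 - y)| <= y ^+ 2 / 2.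
Proof.
move=> y0; have := expRN_le y0; have := expR_ge1Dx (- y).
have := sqr_ge0 y; rewrite ler_norml.
by move=> h1 h2 h3; apply/andP; split; lra.
Qed.

Lemma cos_lipschitz x y : `|cos x - cos y| <= `|x - y|.
Proof.
wlog yx : x y / y <= x => [h|].
  by have [|/ltW] := leP y x; [exact: h|move=> xy; rewrite distrC [leRHS]distrC; exact: h].
have cc : {within `[y, x], continuous (@cos R)}.
  by apply: continuous_subspaceT; exact: continuous_cos.
have [c _ ->] := MVT_segment yx (fun z _ => is_derive_cos z) cc.
rewrite normrM normrN; apply: ler_piMl => //.
by rewrite ler_norml sin_geN1 sin_le1.
Qed.

(** This trades the third absolute moment in the remainder of the sine for second and fourth
    moments; [b] is made small later, so that the second moment contributes little. *)
Lemma cubic_le (b x : R) : 0 < b -> `|x| ^+ 3 <= (b * x ^+ 2 + b^-1 * x ^+ 4) / 2.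
Proof.
move=> b0; have e2 : x ^+ 2 = `|x| ^+ 2 by rewrite real_normK ?num_real.
have -> : x ^+ 4 = `|x| ^+ 4 by rewrite -normrX ger0_norm// exprn_even_ge0.
rewrite e2; move: `|x| => z.
have : 0 <= b^-1 * (z * (z - b)) ^+ 2 by rewrite mulr_ge0 ?sqr_ge0// invr_ge0 ltW.
rewrite (_ : b^-1 * _ = b^-1 * z ^+ 4 - 2 * (b^-1 * b) * z ^+ 3 + (b^-1 * b) * b * z ^+ 2); last by ring.
by rewrite mulVf ?gt_eqF//; lra.
Qed.

End taylor.

(** * Second order expansion for one block *)

Section single_block.
Context {R : realType} {disp : measure_display} {T : measurableType disp}.
Variable P : probability T R.
Local Notation mean := (mean P).

(** The cosine part supplies the second order term, and the sine part is of third order because [Y]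
    is centered. The exponential is expanded too, with a remainder bounded by the fourth moment
    through [v ^+ 2 <= q]; the coefficient is [1/24 + 1/8 = 1/6]. *)
Lemma mean_cos_bounded (Y : T -> R) (t theta b : R) : Bd Y -> mean Y = 0 -> 0 < b ->
  `|mean (fun w => cos (t * Y w + theta)) -
    cos theta * expR (- (t ^+ 2 * mean (fun w => Y w ^+ 2) / 2))| <=
  t ^+ 4 * mean (fun w => Y w ^+ 4) / 6 +
  `|t| ^+ 3 * (b * mean (fun w => Y w ^+ 2) + b^-1 * mean (fun w => Y w ^+ 4)) / 12.
Proof.
move=> BY Y0 b0.
set v := mean (fun w => Y w ^+ 2); set q := mean (fun w => Y w ^+ 4).
have B2 := BdX 2 BY; have B4 := BdX 4 BY.
have BtY : Bd (fun w => t * Y w) by apply: BdM => //; exact: Bd_cst.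
have v0 : 0 <= v by apply: mean_ge0 => w; exact: sqr_ge0.
have vq : v ^+ 2 <= q.
  apply: le_trans (mean_sqr_le (Bd_L2 P B2)) _; rewrite le_eqVlt; apply/orP; left.
  by apply/eqP/eq_mean => w; rewrite -exprM.
have mtY : measurable_fun setT (fun w => t * Y w) by case: BtY.
have Bc : Bd (fun w => cos (t * Y w)) by exact: Bd_cos.
have Bs : Bd (fun w => sin (t * Y w)) by exact: Bd_sin.
have hc : `|mean (fun w => cos (t * Y w)) - (1 - t ^+ 2 * v / 2)| <= t ^+ 4 * q / 24.
  have -> : 1 - t ^+ 2 * v / 2 = mean (fun w => 1 - t ^+ 2 / 2 * Y w ^+ 2).
    rewrite meanB; [|exact/Bd_L1/Bd_cst|exact/L1Z/Bd_L1].
    by rewrite mean_cst meanZ; [rewrite -/v; ring|exact: Bd_L1].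
  have BB : Bd (fun w => 1 - t ^+ 2 / 2 * Y w ^+ 2).
    by apply: BdD; [exact: Bd_cst|apply: BdN; apply: BdM => //; exact: Bd_cst].
  rewrite -meanB; [|exact: Bd_L1|exact: Bd_L1].
  have -> : t ^+ 4 * q / 24 = mean (fun w => t ^+ 4 / 24 * Y w ^+ 4).
    by rewrite meanZ; [rewrite -/q; ring|exact: Bd_L1].
  apply: mean_norm_le.
  - by apply: Bd_L1; apply: BdD => //; exact: BdN.
  - by apply: L1Z; exact: Bd_L1.
  move=> w; have := cos_taylor (t * Y w); rewrite !exprMn.
  rewrite (_ : t ^+ 2 * Y w ^+ 2 / 2 = t ^+ 2 / 2 * Y w ^+ 2); last by ring.
  by rewrite (_ : t ^+ 4 * Y w ^+ 4 / 24 = t ^+ 4 / 24 * Y w ^+ 4); last by ring.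
have hs : `|mean (fun w => sin (t * Y w))| <= `|t| ^+ 3 * (b * v + b^-1 * q) / 12.
  have -> : mean (fun w => sin (t * Y w)) = mean (fun w => sin (t * Y w) - t * Y w).
    rewrite meanB; [|exact: Bd_L1|exact: Bd_L1].
    by rewrite meanZ; [rewrite Y0 mulr0 subr0|exact: Bd_L1].
  have -> : `|t| ^+ 3 * (b * v + b^-1 * q) / 12 =
      mean (fun w => `|t| ^+ 3 / 12 * (b * Y w ^+ 2 + b^-1 * Y w ^+ 4)).
    rewrite meanZ; last by apply: L1D; apply: L1Z; exact: Bd_L1.
    rewrite meanD; [|by apply: L1Z; exact: Bd_L1|by apply: L1Z; exact: Bd_L1].
    by rewrite !meanZ; [rewrite -/v -/q; ring|exact: Bd_L1|exact: Bd_L1].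
  apply: mean_norm_le.
  - by apply: Bd_L1; apply: BdD => //; exact: BdN.
  - by apply: L1Z; apply: L1D; apply: L1Z; exact: Bd_L1.
  move=> w; apply: le_trans (sin_taylor _) _; rewrite normrM exprMn.
  have := ler_wpM2l (exprn_ge0 3 (normr_ge0 t)) (cubic_le (Y w) b0).
  by move: (`|t| ^+ 3) (`|Y w| ^+ 3) (Y w ^+ 2) (Y w ^+ 4) (b^-1) => z1 z2 z3 z4 z5; lra.
have he : `|expR (- (t ^+ 2 * v / 2)) - (1 - t ^+ 2 * v / 2)| <= t ^+ 4 * q / 8.
  apply: le_trans (expRN_taylor _) _.
    by rewrite mulr_ge0// mulr_ge0// sqr_ge0.
  have t4 : 0 <= t ^+ 4 by rewrite exprn_even_ge0.
  rewrite (_ : (t ^+ 2 * v / 2) ^+ 2 / 2 = t ^+ 4 * v ^+ 2 / 8); last by field.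
  by rewrite ler_wpM2r// ler_wpM2l.
rewrite (eq_mean _ (g := fun w => cos theta * cos (t * Y w) + - sin theta * sin (t * Y w))); last first.
  by move=> w; rewrite cosD; ring.
rewrite meanD; [|by apply: L1Z; exact: Bd_L1|by apply: L1Z; exact: Bd_L1].
rewrite !meanZ; [|exact: Bd_L1|exact: Bd_L1].
set c := mean (fun w => cos _) in hc *; set s := mean (fun w => sin _) in hs *.
set e := expR _ in he *; set l := 1 - _ in hc he *.
rewrite (_ : _ - _ = cos theta * ((c - l) - (e - l)) - sin theta * s); last by ring.
apply: (le_trans (ler_normB _ _)); rewrite !normrM.
have c1 : `|cos theta| <= 1 by rewrite ler_norml cos_geN1 cos_le1.
have s1 : `|sin theta| <= 1 by rewrite ler_norml sin_geN1 sin_le1.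
apply: (le_trans (lerD (ler_piMl (normr_ge0 _) c1) (ler_piMl (normr_ge0 _) s1))).
apply: lerD => //; apply: (le_trans (ler_normB _ _)); apply: (le_trans (lerD hc he)).
by rewrite -!mulrDr; move: (t ^+ 4 * q) => z; lra.
Qed.

End single_block.

(** * Truncation and recentering *)

Section truncation.
Context {R : realType}.
Implicit Types e x : R.

(** The closed condition is complementary to the strict inequality in the Lindeberg sum, as
    [trunc_tail_sqr] requires. *)
Definition trunc e x := x * \1_[set y | `|y| <= e] x.

Lemma truncE e x : trunc e x = if `|x| <= e then x else 0.
Proof.
rewrite /trunc indicE; have [h|h] := boolP (`|x| <= e).
  by rewrite mem_set//= mulr1.
by rewrite memNset//= ?mulr0//; exact/negP.
Qed.

Lemma measurable_trunc e : measurable_fun setT (trunc e).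
Proof.
apply: measurable_funM => //; apply: measurable_indic.
rewrite (_ : [set y | _] = `[- e, e]%classic)//.
by apply/seteqP; split => y /=; rewrite in_itv/= ler_norml.
Qed.

Lemma trunc_norm_le e x : 0 <= e -> `|trunc e x| <= e.
Proof. by move=> e0; rewrite truncE; case: ifPn; rewrite ?normr0. Qed.

Lemma trunc_sqr_le e x : trunc e x ^+ 2 <= x ^+ 2.
Proof. by rewrite truncE; case: ifPn => // _; rewrite expr0n sqr_ge0. Qed.

Lemma trunc_tail_sqr e x : (x - trunc e x) ^+ 2 = x ^+ 2 * \1_[set y | e < `|y|] x.
Proof.
rewrite truncE indicE; have [h|h] := leP `|x| e.
  by rewrite subrr memNset/= ?mulr0 ?expr0n//; apply/negP; rewrite -leNgt.
by rewrite subr0 mem_set//= mulr1.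
Qed.

Lemma trunc_sqrD e x : x ^+ 2 = trunc e x ^+ 2 + (x - trunc e x) ^+ 2.
Proof.
by rewrite truncE; case: ifPn => _; rewrite ?subrr ?subr0 ?expr0n/= ?addr0 ?add0r.
Qed.

End truncation.

Section centered_truncation.
Context {R : realType} {disp : measure_display} {T : measurableType disp}.
Variable P : probability T R.
Local Notation mean := (mean P).
Local Notation L2 := (L2 P).
Variables (e : R) (f : T -> R).
Hypothesis e_ge0 : 0 <= e.
Hypothesis f_L2 : L2 f.

Definition ctrunc : T -> R := fun w => trunc e (f w) - mean (fun w => trunc e (f w)).

Lemma Bd_trunc : Bd (fun w => trunc e (f w)).
Proof.
split; last by exists e => w; exact: trunc_norm_le.
by apply: measurableT_comp; [exact: measurable_trunc|case: f_L2].
Qed.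

Lemma Bd_ctrunc : Bd ctrunc.
Proof. by apply: BdD; [exact: Bd_trunc|exact: (Bd_cst (- _))]. Qed.

Lemma mean_ctrunc : mean ctrunc = 0.
Proof. by apply: mean_center; apply: Bd_L1; exact: Bd_trunc. Qed.

Lemma ctrunc_norm_le w : `|ctrunc w| <= 2 * e.
Proof.
apply: (le_trans (ler_normB _ _)); rewrite mulrDl mul1r; apply: lerD.
  exact: trunc_norm_le.
rewrite -[leRHS](mean_cst P); apply: mean_norm_le.
- by apply: Bd_L1; exact: Bd_trunc.
- by apply: Bd_L1; exact: Bd_cst.
- by move=> v; exact: trunc_norm_le.
Qed.

Lemma mean_ctrunc_sqr_le : mean (fun w => ctrunc w ^+ 2) <= mean (fun w => f w ^+ 2).
Proof.
apply: (@le_trans _ _ (mean (fun w => trunc e (f w) ^+ 2))).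
  by rewrite mean_center_sqr ?gerBl ?sqr_ge0//; apply: Bd_L2; exact: Bd_trunc.
apply: mean_le; first by apply/Bd_L1/BdX; exact: Bd_trunc.
  exact: L2_sqr.
by move=> w; exact: trunc_sqr_le.
Qed.

Lemma mean_ctrunc_pow4_le :
  mean (fun w => ctrunc w ^+ 4) <= 4 * e ^+ 2 * mean (fun w => f w ^+ 2).
Proof.
apply: (@le_trans _ _ (4 * e ^+ 2 * mean (fun w => ctrunc w ^+ 2))); last first.
  by apply: ler_wpM2l; [rewrite mulr_ge0// sqr_ge0|exact: mean_ctrunc_sqr_le].
rewrite -meanZ; last by apply/Bd_L1/BdX; exact: Bd_ctrunc.
apply: mean_le.
- by apply/Bd_L1/BdX; exact: Bd_ctrunc.
- by apply/L1Z/Bd_L1/BdX; exact: Bd_ctrunc.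
move=> w; rewrite (_ : 4%N = (2 + 2)%N)// exprD; apply: ler_wpM2r; first exact: sqr_ge0.
have := ctrunc_norm_le w; rewrite -(real_normK (num_real (ctrunc w))).
by have := normr_ge0 (ctrunc w); move: `|ctrunc w| => z; nra.
Qed.

(** As [f] is centered, [f - ctrunc] is the tail [f - trunc] minus its mean, and centering does not
    increase a second moment. *)
Lemma mean_sub_ctrunc_sqr_le : mean f = 0 ->
  mean (fun w => (f w - ctrunc w) ^+ 2) <= mean (fun w => (f w - trunc e (f w)) ^+ 2).
Proof.
move=> f0; have Lt := Bd_L2 P Bd_trunc.
have L2d : L2 (fun w => f w - trunc e (f w)) by exact: L2B.
have fd : mean (fun w => f w - trunc e (f w)) = - mean (fun w => trunc e (f w)).
  by rewrite meanB; [rewrite f0 sub0r|exact: L2_L1|exact: L2_L1].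
rewrite (eq_mean _ (g := fun w => (f w - trunc e (f w) -
    mean (fun w => f w - trunc e (f w))) ^+ 2)); last first.
  by move=> w; rewrite fd /ctrunc; ring.
by rewrite (mean_center_sqr L2d) gerBl sqr_ge0.
Qed.

(** This turns the Lindeberg condition into uniform smallness of the single variances. *)
Lemma mean_sqr_trunc_le :
  mean (fun w => f w ^+ 2) <= e ^+ 2 + mean (fun w => (f w - trunc e (f w)) ^+ 2).
Proof.
have Lt := Bd_L2 P Bd_trunc.
have L2d : L2 (fun w => f w - trunc e (f w)) by exact: L2B.
rewrite (eq_mean _ (fun w => trunc_sqrD e (f w))) meanD; [|exact: L2_sqr|exact: L2_sqr].
rewrite lerD2r -[leRHS](mean_cst P); apply: mean_le; first exact: L2_sqr.
  by apply: Bd_L1; exact: Bd_cst.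
move=> w; rewrite -[trunc _ _ ^+ 2]real_normK ?num_real//.
by rewrite lerXn2r ?nnegrE//; exact: trunc_norm_le.
Qed.

End centered_truncation.

(** * Coloring the sites by cuts in all directions *)

Section cut_lattice.
Context {R : realType}.
Variable d : nat.
Implicit Types (S : seq (lattice d)) (V : lattice d -> R).

Lemma sum_fiber_nat (I : eqType) (s : seq I) (f : I -> nat) (V : I -> R) n (Q : pred nat) :
  (forall k, k \in s -> (f k < n)%N) ->
  \sum_(0 <= j < n | Q j) \sum_(k <- s | f k == j) V k = \sum_(k <- s | Q (f k)) V k.
Proof.
move=> fn; rewrite (exchange_big_dep (fun k => Q (f k)))/=; last first.
  by move=> j k Qj /eqP ->.
rewrite big_seq_cond [RHS]big_seq_cond; apply: eq_bigr => k /andP[ks Qk].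
rewrite (eq_bigl (fun j => j == f k)); last first.
  by move=> j; rewrite eq_sym; case: eqP => [->|]; rewrite ?Qk ?andbF.
by rewrite big_nat1_eq fn.
Qed.

Lemma ler_sum_sub (I : eqType) (s : seq I) (A B : pred I) (V : I -> R) :
  (forall k, 0 <= V k) -> (forall k, k \in s -> A k -> B k) ->
  \sum_(k <- s | A k) V k <= \sum_(k <- s | B k) V k.
Proof.
move=> V0 AB; rewrite big_seq_cond [leRHS]big_seq_cond big_mkcond [leRHS]big_mkcond.
apply: ler_sum => k _; case: ifP => [/andP[ks Ak]|_]; first by rewrite ks AB.
by case: ifP.
Qed.

Lemma ler_sum_cover (I J : eqType) (s : seq I) (r : seq J) (A : pred I) (B : J -> pred I)
    (V : I -> R) : (forall k, 0 <= V k) ->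
  (forall k, k \in s -> A k -> has (B^~ k) r) ->
  \sum_(k <- s | A k) V k <= \sum_(u <- r) \sum_(k <- s | B u k) V k.
Proof.
move=> V0 AB; elim: r A AB => [|u r IH] A AB.
  rewrite big_nil big_seq_cond big_pred0// => k.
  by apply/negP => /andP[ks /(AB _ ks)].
rewrite big_cons (bigID (B u))/=; apply: lerD.
  by apply: ler_sum_sub => // k _ /andP[].
by apply: IH => k ks /andP[/(AB _ ks) /= /orP[->|]].
Qed.

(** A site with all coordinates listed in [H] is determined by their indices in the lists;
    nonnegativity lets [|k u|] stand for [k u]. *)
Lemma grid_size S (H : 'I_d -> seq nat) (K : nat) : uniq S ->
  (forall k u, k \in S -> 0 <= k u) -> (forall u, (size (H u) <= K)%N) ->
  (size [seq k : lattice d <- S | [forall u, `|k u|%N \in H u]] <= K.+1 ^ d)%N.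
Proof.
move=> uS S0 HK; pose g (k : lattice d) : {ffun 'I_d -> 'I_K.+1} :=
  [ffun u => inord (index `|k u|%N (H u))].
set s := [seq _ <- S | _].
have -> : (K.+1 ^ d = #|{: {ffun 'I_d -> 'I_K.+1}}|)%N.
  by rewrite card_ffun !card_ord.
rewrite -(size_map g); rewrite cardE; apply: uniq_leq_size; last first.
  by move=> x _; rewrite mem_enum.
rewrite map_inj_in_uniq ?filter_uniq// => k l; rewrite !mem_filter.
move=> /andP[/forallP kH kS] /andP[/forallP lH lS] kl; apply/ffunP => u.
have := congr1 (fun f : {ffun 'I_d -> 'I_K.+1} => f u : nat) kl.
rewrite !ffunE !inordK; last 2 first.
  - by rewrite ltnS (leq_trans (index_size _ _)).
  - by rewrite ltnS (leq_trans (index_size _ _)).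
move=> /(congr1 (nth 0%N (H u))); rewrite !nth_index// => /(congr1 Posz).
by rewrite !gez0_abs ?S0.
Qed.

(** [cut_line] is applied in each direction to the marginal masses. A kept site of a given color
    either has a coordinate outside the exceptional list of its direction, and is covered by the
    [2 * eta] of that direction, or is one of at most [K.+1 ^ d] grid sites of mass at most [v]. *)
Lemma cut_lattice (M eta : R) : 0 < eta -> exists N : nat,
  forall (m : nat) (eps : R), (0 < m)%N -> 0 < eps -> exists K : nat,
  forall S V (v : R), 0 <= v -> uniq S -> (forall k u, k \in S -> 0 <= k u) ->
  (forall k, 0 <= V k) -> \sum_(k <- S) V k <= M ->
  (forall k, k \in S -> V k <= v) ->
  exists (kept : pred (lattice d)) (c : lattice d -> {ffun 'I_d -> 'I_N.+1}),
  [/\ \sum_(k <- S | ~~ kept k) V k <= d%:R * (N%:R * eps),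
      forall u (b : nat), exists j : int, forall k, k \in S -> kept k ->
        ((c k u < b)%N -> k u <= j) /\ ((b <= c k u)%N -> j + m%:Z <= k u)
    & forall p, \sum_(k <- S | kept k && (c k == p)) V k <= d%:R * (2 * eta) + K%:R * v].
Proof.
move=> eta0; have [N HN] := cut_line M eta0; exists N => m eps m0 eps0.
have [K HK] := HN m eps m0 eps0; exists (K.+1 ^ d)%N => S V v v0 uS S0 V0 VM Vv.
(* A strict upper bound for every coordinate of every site. *)
pose n := (\sum_(k <- S) \sum_u `|(k : lattice d) u|%N).+1.
have Sn u k : k \in S -> (`|k u| < n)%N.
  move=> kS; rewrite ltnS (big_rem k)//= (bigD1 u)//= -addnA leq_addr//.
have fib u (Q : pred nat) : \sum_(0 <= j < n | Q j) \sum_(k <- S | `|(k : lattice d) u|%N == j) V k =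
    \sum_(k <- S | Q `|(k : lattice d) u|%N) V k.
  by apply: (sum_fiber_nat (f := fun k : lattice d => `|k u|%N)) => k; exact: Sn.
have cutu (u : 'I_d) := HK n (fun j => \sum_(k <- S | `|(k : lattice d) u|%N == j) V k)
  (fun j => sumr_ge0 _ (fun k _ => V0 k)).
have /choice[g Hg] : forall u : 'I_d, exists g : pred nat * (nat -> nat) * seq nat,
  [/\ forall j, (g.1.2 j <= N)%N,
      \sum_(k <- S | g.1.1 `|(k : lattice d) u|%N) V k <= N%:R * eps,
      forall b, exists s : int, forall j, (j < n)%N -> ~~ g.1.1 j ->
        ((g.1.2 j < b)%N -> j%:Z <= s) /\ ((b <= g.1.2 j)%N -> s + m%:Z <= j%:Z),
      forall p, \sum_(k <- S | [&& ~~ g.1.1 `|(k : lattice d) u|%N, g.1.2 `|k u|%N == p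
          & `|k u|%N \notin g.2]) V k <= 2 * eta
    & (size g.2 <= K)%N].
  move=> u; have /(_ _)[|rem [col [H [h1 h2 h3 h4 h5]]]] := cutu u.
    by rewrite (fib u xpredT).
  exists (rem, col, H); split => //; first by rewrite -(fib u).
  by move=> p; rewrite -(fib u (fun j => [&& ~~ rem j, col j == p & j \notin H])).
pose kept (k : lattice d) := [forall u, ~~ (g u).1.1 `|k u|%N].
pose c (k : lattice d) : {ffun 'I_d -> 'I_N.+1} := [ffun u => inord ((g u).1.2 `|k u|%N)].
have cE k u : c k u = (g u).1.2 `|k u|%N :> nat.
  by rewrite ffunE inordK// ltnS; case: (Hg u) => + _ _ _ _; exact.
exists kept, c; split.
- apply: (@le_trans _ _ (\sum_(u : 'I_d) \sum_(k <- S | (g u).1.1 `|(k : lattice d) u|%N) V k)).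
    apply: ler_sum_cover => // k _ /forallPn[u /negPn gu].
    by apply/hasP; exists u => //; rewrite mem_index_enum.
  rewrite -[d in leRHS]card_ord mulr_natl -sumr_const; apply: ler_sum => u _.
  by case: (Hg u).
- move=> u b; have [_ _ /(_ b)[s Hs] _ _] := Hg u; exists s => k kS /forallP/(_ u) ku.
  by have := Hs _ (Sn u k kS) ku; rewrite -cE gez0_abs ?S0.
- move=> p; rewrite (bigID (fun k : lattice d => [forall u, `|k u|%N \in (g u).2]))/=.
  rewrite addrC; apply: lerD.
    apply: (@le_trans _ _ (\sum_(u : 'I_d) \sum_(k <- S | [&& ~~ (g u).1.1 `|(k : lattice d) u|%N,
       (g u).1.2 `|k u|%N == p u & `|k u|%N \notin (g u).2]) V k)).
      apply: ler_sum_cover => // k kS /andP[/andP[/forallP kk /eqP ckp] /forallPn[u ku]].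
      apply/hasP; exists u; first by rewrite mem_index_enum.
      by rewrite kk ku -cE ckp eqxx.
    rewrite -[d in leRHS]card_ord mulr_natl -sumr_const; apply: ler_sum => u _.
    by case: (Hg u).
  apply: (@le_trans _ _ (\sum_(k <- S | [forall u, `|(k : lattice d) u|%N \in (g u).2]) V k)).
    by apply: ler_sum_sub => // k _ /andP[].
  rewrite -big_filter; apply: (@le_trans _ _ (\sum_(k <- [seq k : lattice d <- S |
      [forall u, `|k u|%N \in (g u).2]]) v)).
    rewrite big_seq [leRHS]big_seq; apply: ler_sum => k.
    by rewrite mem_filter => /andP[_]; exact: Vv.
  rewrite big_const_seq iter_addr_0 count_predT -[leLHS]mulr_natl; apply: ler_wpM2r => //.
  by rewrite ler_nat; apply: grid_size => // u; case: (Hg u).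
Qed.

End cut_lattice.

(** * Approximation by the blocked sum *)

Section block_sums.
Context {R : realType} {disp : measure_display} {T : measurableType disp}.
Variable P : probability T R.
Local Notation mean := (mean P).
Local Notation L2 := (L2 P).

Variables (d m0 : nat) (r : R).
Hypothesis m0_gt0 : (0 < m0)%N.
Hypothesis r01 : 0 <= r < 1.
Let kappa2 := var_const m0 d r.
Let kappa4 := mom4_const m0 d r.

(** [V] stands for the variances before truncation, by which the blocks are cut; [h] compares fourth
    with second moments, and [g] bounds the mass of a block. They combine into a Lyapunov bound: the
    fourth moments of all blocks add up to at most [kappa4 * (M * (h + g))]. *)
Lemma block_sums_cf (X zeta : lattice d -> T -> R) (N m : nat) (a M h g : R)
    (S : seq (lattice d)) (V : lattice d -> R)
    (c : lattice d -> {ffun 'I_d -> 'I_N.+1}) :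
  (rho'_field P X m0 <= r%:E)%E ->
  (0 < m)%N -> (alpha_field P X m <= a%:E)%E -> 0 <= a -> 0 <= h ->
  (forall k, Gmeas (gen X [set k]) (zeta k)) ->
  (forall k, Bd (zeta k)) -> (forall k, mean (zeta k) = 0) -> uniq S ->
  (forall u (b : nat), exists j : int, forall k, k \in S ->
        ((c k u < b)%N -> k u <= j) /\ ((b <= c k u)%N -> j + m%:Z <= k u)) ->
  (forall k, mean (fun w => zeta k w ^+ 2) <= V k) ->
  (forall k, mean (fun w => zeta k w ^+ 4) <= h * V k) ->
  \sum_(k <- S) V k <= M ->
  (forall p, \sum_(k <- S | c k == p) V k <= g) ->
  exists2 w0, 0 <= w0 <= kappa2 * M & forall t theta b, 0 < b ->
  `|mean (fun w => cos (t * (\sum_(k <- S) zeta k w) + theta)) -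
    cos theta * expR (- (t ^+ 2 * w0 / 2))| <=
  t ^+ 4 * (kappa4 * (M * (h + g))) / 6 +
  `|t| ^+ 3 * (b * (kappa2 * M) + b^-1 * (kappa4 * (M * (h + g)))) / 12 +
  8 * a * (N.+1 ^ d)%:R.
Proof.
move=> rhoX m_gt0 alphaX a0 h0 mz Bz z0 uS sepc zV2 zV4 VM Vg.
have V0 k : 0 <= V k by apply: le_trans (zV2 k); apply: mean_ge0 => w; exact: sqr_ge0.
have k2 : 0 <= kappa2 by exact: var_const_ge0.
have k4 : 0 <= kappa4 by exact: mom4_const_ge0.
pose Y p w := \sum_(k <- S | c k == p) zeta k w.
have BY p : Bd (Y p) by apply: Bd_sum => k _ _; exact: Bz.
have Y0 p : mean (Y p) = 0.
  rewrite mean_sum; last by move=> k _ _; exact: Bd_L1.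
  by rewrite big1.
have sumV : \sum_p \sum_(k <- S | c k == p) V k <= M.
  by apply: le_trans VM; rewrite [leRHS](partition_big c xpredT)//=.
pose v p := mean (fun w => Y p w ^+ 2); pose q p := mean (fun w => Y p w ^+ 4).
have v0 p : 0 <= v p by apply: mean_ge0 => w; exact: sqr_ge0.
have vle p : v p <= kappa2 * \sum_(k <- S | c k == p) V k.
  rewrite /v /Y -[in leRHS]big_filter; under eq_fun do rewrite -big_filter.
  apply: le_trans (lattice_sqr m0_gt0 r01 rhoX mz _ _ _) _ => //.
  - exact: filter_uniq.
  - by move=> k _; exact: Bd_L2.
  - by apply: ler_wpM2l => //; apply: ler_sum.
have qle p : q p <= kappa4 * ((h + g) * \sum_(k <- S | c k == p) V k).
  rewrite /q /Y; apply: (@le_trans _ _ (kappa4 * (h * (\sum_(k <- S | c k == p) V k) +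
      (\sum_(k <- S | c k == p) V k) ^+ 2))).
    rewrite -[in leRHS]big_filter; under eq_fun do rewrite -big_filter.
    apply: le_trans (lattice_pow4 m0_gt0 r01 rhoX mz _ _ _) _ => //.
      exact: filter_uniq.
    apply: ler_wpM2l => //; apply: lerD.
      by rewrite mulr_sumr; apply: ler_sum.
    rewrite lerXn2r ?nnegrE ?sumr_ge0//; last by apply: ler_sum.
    by move=> k _; apply: mean_ge0 => w; exact: sqr_ge0.
  apply: ler_wpM2l => //; rewrite mulrDl lerD2l expr2.
  by apply: ler_wpM2r => //; apply: sumr_ge0.
have sumv : \sum_p v p <= kappa2 * M.
  apply: (@le_trans _ _ (\sum_p kappa2 * \sum_(k <- S | c k == p) V k)).
    exact: ler_sum.
  by rewrite -mulr_sumr ler_wpM2l.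
have g0 : 0 <= g by apply: le_trans (Vg [ffun=> ord0]); exact: sumr_ge0.
have sumq : \sum_p q p <= kappa4 * (M * (h + g)).
  apply: (@le_trans _ _ (\sum_p kappa4 * ((h + g) * \sum_(k <- S | c k == p) V k))).
    exact: ler_sum.
  rewrite -mulr_sumr; apply: ler_wpM2l => //; rewrite -mulr_sumr mulrC.
  by apply: ler_wpM2r => //; exact: addr_ge0.
exists (\sum_p v p); first by rewrite sumr_ge0//= => p _.
move=> t theta b b0.
(* The factorization concerns plain block sums, so [t] is absorbed into the variables. *)
pose tz k w := t * zeta k w.
have mtz k : Gmeas (gen X [set k]) (tz k) by apply: GmeasM => //; exact: Gmeas_cst.
have Btz k : Bd (tz k) by apply: BdM => //; exact: Bd_cst.
pose err p := t ^+ 4 * q p / 6 + `|t| ^+ 3 * (b * v p + b^-1 * q p) / 12.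
pose e p := expR (- (t ^+ 2 * v p / 2)).
have e01 p : 0 <= e p <= 1.
  by rewrite expR_ge0 expR_le1 oppr_le0 divr_ge0// mulr_ge0// sqr_ge0.
have single p th : `|mean (fun w => cos (block tz S c [set p]%SET w + th)) - cos th * e p| <= err p.
  rewrite (eq_mean _ (g := fun w => cos (t * Y p w + th))); last first.
    move=> w; rewrite /block /Y mulr_sumr; congr (cos (_ + th)).
    by apply: eq_bigl => k; rewrite inE.
  exact: mean_cos_bounded.
have mtz' k : k \in S -> measurable_fun setT (tz k) by move=> _; case: (Btz k).
have := block_factorization m_gt0 alphaX mtz mtz' sepc e01 single [set: _]%SET theta.
rewrite -expR_sum /=.
rewrite (eq_mean _ (g := fun w => cos (t * (\sum_(k <- S) zeta k w) + theta))); last first.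
  move=> w; rewrite /block mulr_sumr; congr (cos (_ + theta)).
  by apply: eq_bigl => k; rewrite inE.
rewrite (_ : \sum_(i in _) - _ = - (t ^+ 2 * (\sum_p v p) / 2)); last first.
  rewrite mulr_sumr mulr_suml sumrN; congr (- _).
  by apply: eq_bigl => k; rewrite inE.
move/le_trans; apply; apply: lerD; last first.
  apply: ler_wpM2l; first by rewrite mulr_ge0.
  rewrite ler_nat (leq_trans (leq_pred _))// cardsT card_ffun !card_ord//.
rewrite (_ : \sum_(i in _) _ = t ^+ 4 * (\sum_p q p) / 6 +
    `|t| ^+ 3 * (b * \sum_p v p + b^-1 * \sum_p q p) / 12); last first.
  rewrite (eq_bigl xpredT); last by move=> k; rewrite inE.
  rewrite big_split/= -!mulr_suml -!mulr_sumr big_split/=.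
  by rewrite -!mulr_sumr.
have t4 : 0 <= t ^+ 4 by rewrite exprn_even_ge0.
apply: lerD; apply: ler_wpM2r => //; apply: ler_wpM2l => //.
apply: lerD; apply: ler_wpM2l => //; first exact: ltW.
by rewrite invr_ge0 ltW.
Qed.

(** [Y] is the sum of the recentered truncations over the kept sites. Its error splits into the
    truncation error over all of [S] and the truncated variables on removed sites, both bounded by
    [lattice_sqr]. [N] is fixed before [m] and [eps], whereas [K] may depend on them. *)
Lemma block_approx (M eta : R) : 0 < eta -> exists N : nat,
  forall (m : nat) (eps : R), (0 < m)%N -> 0 < eps -> exists K : nat,
  forall (X xi : lattice d -> T -> R) (S : seq (lattice d)) (a e v lam : R),
  (rho'_field P X m0 <= r%:E)%E ->
  (alpha_field P X m <= a%:E)%E -> 0 <= a -> 0 <= e -> 0 <= v ->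
  (forall k, Gmeas (gen X [set k]) (xi k)) ->
  (forall k, L2 (xi k)) -> (forall k, mean (xi k) = 0) -> uniq S ->
  (forall k u, k \in S -> 0 <= k u) ->
  \sum_(k <- S) mean (fun w => xi k w ^+ 2) <= M ->
  (forall k, k \in S -> mean (fun w => xi k w ^+ 2) <= v) ->
  \sum_(k <- S) mean (fun w => (xi k w - trunc e (xi k w)) ^+ 2) <= lam ->
  exists Y w0, let g := d%:R * (2 * eta) + K%:R * v in
  [/\ Bd Y, 0 <= w0 <= kappa2 * M,
    mean (fun w => ((\sum_(k <- S) xi k w) - Y w) ^+ 2) <=
      2 * kappa2 * (d%:R * (N%:R * eps) + lam),
    mean (fun w => Y w ^+ 4) <= kappa4 * (4 * e ^+ 2 * M + M ^+ 2)
  & forall t theta b, 0 < b ->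
    `|mean (fun w => cos (t * Y w + theta)) - cos theta * expR (- (t ^+ 2 * w0 / 2))| <=
    t ^+ 4 * (kappa4 * (M * (4 * e ^+ 2 + g))) / 6 +
    `|t| ^+ 3 * (b * (kappa2 * M) + b^-1 * (kappa4 * (M * (4 * e ^+ 2 + g)))) / 12 +
    8 * a * (N.+1 ^ d)%:R].
Proof.
move=> eta0; have [N HN] := cut_lattice d M eta0; exists N => m eps m_gt0 eps0.
have [K HK] := HN m eps m_gt0 eps0; exists K.
move=> X xi S a e v lam rhoX alphaX a0 e0 v0 mxi xi2 xi0 uS S0 VM Vv Hlam.
pose V k := mean (fun w => xi k w ^+ 2).
have V0 k : 0 <= V k by apply: mean_ge0 => w; exact: sqr_ge0.
have k2 : 0 <= kappa2 by exact: var_const_ge0.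
have k4 : 0 <= kappa4 by exact: mom4_const_ge0.
have [kept [c [Hrem Hsep Hblock]]] := HK S V v v0 uS S0 V0 VM Vv.
pose zeta k := ctrunc P e (xi k).
have Bz k : Bd (zeta k) by exact: Bd_ctrunc.
have z0 k : mean (zeta k) = 0 by exact: mean_ctrunc.
have mz k : Gmeas (gen X [set k]) (zeta k).
  by apply: GmeasB; [apply: Gmeas_comp => //; exact: measurable_trunc|exact: Gmeas_cst].
have zV k : mean (fun w => zeta k w ^+ 2) <= V k by exact: mean_ctrunc_sqr_le.
have zV4 k : mean (fun w => zeta k w ^+ 4) <= 4 * e ^+ 2 * V k by exact: mean_ctrunc_pow4_le.
pose S' := [seq k <- S | kept k].
have uS' : uniq S' by exact: filter_uniq.
have e2 : 0 <= 4 * e ^+ 2 by rewrite mulr_ge0// sqr_ge0.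
have VM' : \sum_(k <- S') V k <= M.
  by apply: le_trans VM; rewrite big_filter; apply: ler_sum_sub.
have M0 : 0 <= M by apply: le_trans VM'; apply: sumr_ge0.
have sep' u (b : nat) : exists j : int, forall k, k \in S' ->
    ((c k u < b)%N -> k u <= j) /\ ((b <= c k u)%N -> j + m%:Z <= k u).
  have [j Hj] := Hsep u b; exists j => k; rewrite mem_filter => /andP[kk kS].
  exact: Hj.
have Hb' p : \sum_(k <- S' | c k == p) V k <= d%:R * (2 * eta) + K%:R * v.
  by rewrite big_filter_cond.
have [w0 w0M Hw0] := block_sums_cf rhoX m_gt0 alphaX a0 e2 mz Bz z0 uS' sep' zV zV4 VM' Hb'.
have BY : Bd (fun w => \sum_(k <- S') zeta k w) by apply: Bd_sum => k _ _; exact: Bz.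
exists (fun w => \sum_(k <- S') zeta k w), w0; split => //; last first.
  apply: le_trans (lattice_pow4 m0_gt0 r01 rhoX mz _ _ _) _ => //.
  apply: ler_wpM2l => //; apply: lerD.
    apply: (@le_trans _ _ (\sum_(k <- S') 4 * e ^+ 2 * V k)).
      by apply: ler_sum => k _; exact: zV4.
    by rewrite -mulr_sumr; apply: ler_wpM2l.
  rewrite lerXn2r ?nnegrE ?sumr_ge0//.
    by move=> k _; apply: mean_ge0 => w; exact: sqr_ge0.
  by apply: le_trans VM'; apply: ler_sum => k _; exact: zV.
pose S'' := [seq k <- S | ~~ kept k].
have uS'' : uniq S'' by exact: filter_uniq.
have L2d k : L2 (fun w => xi k w - zeta k w) by apply: L2B => //; exact: Bd_L2.
have mzd k : Gmeas (gen X [set k]) (fun w => xi k w - zeta k w) by exact: GmeasB.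
have d0 k : mean (fun w => xi k w - zeta k w) = 0.
  by rewrite meanB; [rewrite xi0 z0 subrr|exact: L2_L1|exact: Bd_L1].
have L2D1 : L2 (fun w => \sum_(k <- S) (xi k w - zeta k w)).
  by apply: L2_sum => k _ _; exact: L2d.
have L2D2 : L2 (fun w => \sum_(k <- S'') zeta k w).
  by apply: L2_sum => k _ _; exact: Bd_L2.
rewrite (eq_mean _ (g := fun w => (\sum_(k <- S) (xi k w - zeta k w) +
    \sum_(k <- S'') zeta k w) ^+ 2)); last first.
  move=> w; congr (_ ^+ 2); rewrite [X in _ = X + _]sumrB [X in _ = _ - X + _](bigID kept)/= !big_filter.
  by rewrite opprD addrA subrK.
apply: (@le_trans _ _ (2 * (mean (fun w => (\sum_(k <- S) (xi k w - zeta k w)) ^+ 2) +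
    mean (fun w => (\sum_(k <- S'') zeta k w) ^+ 2)))).
  rewrite -meanD; [|exact: L2_sqr|exact: L2_sqr].
  rewrite -meanZ; last by apply: L1D; exact: L2_sqr.
  apply: mean_le; first by apply: L2_sqr; exact: L2D.
    by apply: L1Z; apply: L1D; exact: L2_sqr.
  by move=> w; exact: sqrD_le.
rewrite -mulrA; apply: ler_wpM2l => //; rewrite mulrDr addrC; apply: lerD.
  apply: le_trans (lattice_sqr m0_gt0 r01 rhoX mz _ _ _) _ => //.
    by move=> k _; exact: Bd_L2.
  apply: ler_wpM2l => //; apply: le_trans Hrem; rewrite big_filter.
  by apply: ler_sum => k _; exact: zV.
apply: le_trans (lattice_sqr m0_gt0 r01 rhoX mzd _ _ _) _ => //.
apply: ler_wpM2l => //; apply: le_trans Hlam.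
by apply: ler_sum => k _; exact: mean_sub_ctrunc_sqr_le.
Qed.

End block_sums.

Lemma expRN_lipschitz (R : realType) (x y : R) : 0 <= x -> 0 <= y ->
  `|expR (- x) - expR (- y)| <= `|x - y|.
Proof.
wlog xy : x y / x <= y => [h|x0 y0].
  move=> x0 y0; have [|/ltW yx] := leP x y; first by move=> xy; exact: h.
  by rewrite distrC [leRHS]distrC; exact: h.
have -> : expR (- y) = expR (- x) * expR (- (y - x)) by rewrite -expRD; congr expR; ring.
have E1 : expR (- x) <= 1 by rewrite expR_le1 oppr_le0.
have E0 := expR_ge0 (- x); have F := expR_ge1Dx (- (y - x)).
have F1 : expR (- (y - x)) <= 1 by rewrite expR_le1 oppr_le0 subr_ge0.
rewrite -[X in `|X - _|]mulr1 -mulrBr normrM (ger0_norm E0) distrC [leRHS]distrC.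
rewrite -normrN opprB ger0_norm ?subr_ge0// [leRHS]ger0_norm ?subr_ge0//.
by apply: (@le_trans _ _ (1 - expR (- (y - x)))); [apply: ler_piMl => //; rewrite subr_ge0|lra].
Qed.

(** * Identification of the variance *)

Section gaussian_close.
Context {R : realType} {disp : measure_display} {T : measurableType disp}.
Variable P : probability T R.
Local Notation mean := (mean P).
Local Notation L2 := (L2 P).

(** Small constants are chosen through this lemma; [c + 1] covers the case [c = 0], and the cap 1
    keeps powers below the constant itself. *)
Lemma small_scale (c x : R) : 0 <= c -> 0 < x -> exists2 y, 0 < y <= 1 & c * y <= x.
Proof.
move=> c0 x0; have c1 : 0 < c + 1 by lra.
exists (Num.min 1 (x / (c + 1))); first by rewrite lt_min ltr01 divr_gt0// ge_min lexx.
apply: (@le_trans _ _ (c * (x / (c + 1)))).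
  by apply: ler_wpM2l => //; rewrite ge_min lexx orbT.
by rewrite mulrCA ger_pMr// ler_pdivrMr//; lra.
Qed.

Lemma mean_abs_le (f : T -> R) (b : R) : L2 f -> 0 < b ->
  mean (fun w => `|f w|) <= (b + b^-1 * mean (fun w => f w ^+ 2)) / 2.
Proof.
move=> f2 b0; have f1 := L2_L1 f2; have fs := L2_sqr f2.
apply: (@le_trans _ _ (mean (fun w => b / 2 + b^-1 / 2 * f w ^+ 2))); last first.
  rewrite meanD; [|exact/Bd_L1/Bd_cst|exact: L1Z].
  by rewrite mean_cst meanZ//; lra.
apply: mean_le; first exact: L1_norm.
  by apply: L1D; [exact/Bd_L1/Bd_cst|exact: L1Z].
move=> w; rewrite -[f w ^+ 2]real_normK ?num_real//; move: `|f w| => z.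
have : 0 <= b^-1 * (z - b) ^+ 2 by rewrite mulr_ge0 ?sqr_ge0// invr_ge0 ltW.
rewrite (_ : b^-1 * _ = b^-1 * z ^+ 2 - 2 * (b^-1 * b) * z + (b^-1 * b) * b); last by ring.
by rewrite mulVf ?gt_eqF//; move: (b^-1) => c; nra.
Qed.

(* Comparing the second order expansions of both sides at a small argument
   forces [w0] to be close to 1. *)
Lemma gaussian_close (Q W t gamma : R) : 0 <= Q -> 0 < gamma ->
  exists2 tau, 0 < tau & exists2 delta, 0 < delta &
  forall (Z Y : T -> R) (w0 : R), L2 Z -> mean (fun w => Z w ^+ 2) = 1 -> Bd Y ->
  0 <= w0 <= W -> mean (fun w => (Z w - Y w) ^+ 2) <= delta ->
  mean (fun w => Y w ^+ 4) <= Q ->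
  (forall t theta, `|mean (fun w => cos (t * Y w + theta)) -
      cos theta * expR (- (t ^+ 2 * w0 / 2))| <= tau * (t ^+ 4 + `|t| ^+ 3 + 1)) ->
  forall theta, `|mean (fun w => cos (t * Z w + theta)) -
      cos theta * expR (- (t ^+ 2 / 2))| <= gamma.
Proof.
move=> Q0 gamma0.
(* The fourth order coefficient in the difference of the two expansions: [Q / 24] from the cosine
   and [W ^+ 2 / 8] from the exponential. *)
pose q := Q / 24 + W ^+ 2 / 8.
have q0 : 0 <= q by rewrite /q; have := sqr_ge0 W; lra.
pose A := t ^+ 4 + `|t| ^+ 3 + t ^+ 2 + `|t| + 1.
have t4 : 0 <= t ^+ 4 by rewrite exprn_even_ge0.
have t3 : 0 <= `|t| ^+ 3 by rewrite exprn_ge0.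
have t2 := sqr_ge0 t; have t1 := normr_ge0 t.
have A0 : 0 <= A by rewrite /A; lra.
(* [b] is the L1 distance allowed between [Z] and [Y], and [s2] is the square of the small argument;
   [tau] is chosen after [s2] because [hw] divides it by [s2]. *)
have [b /andP[b0 b1] Ab] : exists2 b, 0 < b <= 1 & A * b <= gamma / 8.
  by apply: small_scale => //; lra.
have [s2 /andP[s0 s1] As] : exists2 s, 0 < s <= 1 & (A * q) * s <= gamma / 8.
  by apply: small_scale; [exact: mulr_ge0|lra].
have [tau /andP[tau0 tau1] Atau] : exists2 tau, 0 < tau <= 1 & A * tau <= s2 * gamma / 24.
  by apply: small_scale => //; have := mulr_gt0 s0 gamma0; lra.
exists tau => //; exists (b ^+ 2); first by rewrite exprn_gt0.
move=> Z Y w0 Z2 Z1 BY /andP[w00 w0W] ZY Y4 cfY theta.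
have Y2 := Bd_L2 P BY; have D2 : L2 (fun w => Z w - Y w) by exact: L2B.
pose y2 := mean (fun w => Y w ^+ 2).
have absD : mean (fun w => `|Z w - Y w|) <= b.
  apply: le_trans (mean_abs_le D2 b0) _.
  have : b^-1 * mean (fun w => (Z w - Y w) ^+ 2) <= b^-1 * b ^+ 2.
    by apply: ler_wpM2l => //; rewrite invr_ge0 ltW.
  by rewrite expr2 mulKf ?gt_eqF//; lra.
have hy2 : `|y2 - 1| <= 3 * b.
  have L1ub : L1 P (fun w => b * Z w ^+ 2 + (b^-1 + 1) * (Z w - Y w) ^+ 2).
    by apply: L1D; apply: L1Z; exact: L2_sqr.
  rewrite -Z1 /y2 -meanB; [|exact: L2_sqr|exact: L2_sqr].
  apply: (@le_trans _ _ (mean (fun w => b * Z w ^+ 2 + (b^-1 + 1) * (Z w - Y w) ^+ 2))).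
    apply: mean_norm_le => //; first by apply: L1B; exact: L2_sqr.
    move=> w; rewrite [X in `|X - _|](_ : _ = (Z w - (Z w - Y w)) ^+ 2); last first.
      by congr (_ ^+ 2); ring.
    move: (Z w) (Z w - Y w) => z x.
    have h1 : 0 <= b^-1 * (b * z - x) ^+ 2 by rewrite mulr_ge0 ?sqr_ge0// invr_ge0 ltW.
    have h2 : 0 <= b^-1 * (b * z + x) ^+ 2 by rewrite mulr_ge0 ?sqr_ge0// invr_ge0 ltW.
    rewrite (_ : b^-1 * _ = (b^-1 * b) * b * z ^+ 2 - 2 * (b^-1 * b) * z * x + b^-1 * x ^+ 2) in h1; last by ring.
    rewrite (_ : b^-1 * _ = (b^-1 * b) * b * z ^+ 2 + 2 * (b^-1 * b) * z * x + b^-1 * x ^+ 2) in h2; last by ring.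
    rewrite mulVf ?gt_eqF// !mul1r mulr1 in h1 h2.
    have h3 := sqr_ge0 x.
    rewrite (_ : (z - x) ^+ 2 - z ^+ 2 = x ^+ 2 - 2 * z * x); last by ring.
    rewrite mulrDl mul1r ler_norml.
    by apply/andP; split; lra.
  rewrite meanD; [|by apply: L1Z; exact: L2_sqr|by apply: L1Z; exact: L2_sqr].
  rewrite !meanZ; [|exact: L2_sqr|exact: L2_sqr]; rewrite Z1 mulr1.
  have : (b^-1 + 1) * mean (fun w => (Z w - Y w) ^+ 2) <= (b^-1 + 1) * b ^+ 2.
    by apply: ler_wpM2l => //; rewrite addr_ge0// invr_ge0 ltW.
  rewrite [X in _ <= X -> _](_ : _ = b + b * b); last by rewrite mulrDl expr2 mulKf ?gt_eqF// mul1r.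
  by have : b * b <= b * 1 by [apply: ler_wpM2l => //; exact: ltW]; lra.
have hw : `|w0 - y2| <= 2 * (s2 * q) + 6 * (tau / s2).
  pose s := Num.sqrt s2; have s_ge0 : 0 <= s by exact: sqrtr_ge0.
  have sE : s ^+ 2 = s2 by rewrite sqr_sqrtr ?ltW.
  have s_le1 : s <= 1 by rewrite -[leRHS]sqrtr1 ler_wsqrtr.
  have s4 : s ^+ 4 = s2 ^+ 2 by rewrite -sE -exprM.
  have h1 : `|mean (fun w => cos (s * Y w)) - (1 - s2 / 2 * y2)| <= s2 ^+ 2 * Q / 24.
    have BsY : Bd (fun w => 1 - s2 / 2 * Y w ^+ 2).
      apply: BdD; first exact: Bd_cst.
      by apply: BdN; apply: BdM; [exact: Bd_cst|exact: BdX].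
    have Bc : Bd (fun w => cos (s * Y w)).
      by apply: Bd_cos; apply: measurable_funM => //; case: BY.
    have -> : 1 - s2 / 2 * y2 = mean (fun w => 1 - s2 / 2 * Y w ^+ 2).
      rewrite meanB; [|exact/Bd_L1/Bd_cst|by apply: L1Z; exact: L2_sqr].
      by rewrite mean_cst meanZ//; exact: L2_sqr.
    rewrite -meanB; [|exact: Bd_L1|exact: Bd_L1].
    apply: (@le_trans _ _ (mean (fun w => s2 ^+ 2 / 24 * Y w ^+ 4))); last first.
      rewrite meanZ; last by apply/Bd_L1/BdX.
      rewrite [leRHS]mulrAC; apply: ler_wpM2l => //.
      by rewrite divr_ge0// sqr_ge0.
    apply: mean_norm_le.
    - by apply: Bd_L1; apply: BdD => //; exact: BdN.
    - by apply: L1Z; apply/Bd_L1/BdX.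
    move=> w; have := cos_taylor (s * Y w); rewrite !exprMn sE s4.
    rewrite (_ : s2 * Y w ^+ 2 / 2 = s2 / 2 * Y w ^+ 2); last by ring.
    by rewrite (_ : s2 ^+ 2 * Y w ^+ 4 / 24 = s2 ^+ 2 / 24 * Y w ^+ 4); last by ring.
  have h2 : `|expR (- (s2 * w0 / 2)) - (1 - s2 * w0 / 2)| <= s2 ^+ 2 * W ^+ 2 / 8.
    apply: le_trans (expRN_taylor _) _; first by rewrite divr_ge0// mulr_ge0// ltW.
    rewrite (_ : (s2 * w0 / 2) ^+ 2 / 2 = s2 ^+ 2 * w0 ^+ 2 / 8); last by field.
    apply: ler_wpM2r => //; apply: ler_wpM2l; first exact: sqr_ge0.
    by rewrite lerXn2r ?nnegrE// (le_trans w00).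
  have e3 : mean (fun w => cos (s * Y w + 0)) = mean (fun w => cos (s * Y w)).
    by apply: eq_mean => w; rewrite addr0.
  have h3 := cfY s 0; rewrite e3 cos0 mul1r sE s4 in h3.
  have h4 : tau * (s2 ^+ 2 + `|s| ^+ 3 + 1) <= 3 * tau.
    rewrite mulrC; apply: ler_wpM2r; first exact: ltW.
    have : s2 ^+ 2 <= 1 by rewrite exprn_ile1// ltW.
    have : `|s| ^+ 3 <= 1 by rewrite ger0_norm// exprn_ile1.
    by lra.
  (* At the argument [s] the three estimates leave the difference of the second order terms;
     division by [s2 / 2] gives [hw]. *)
  have h5 : s2 / 2 * `|w0 - y2| <= s2 ^+ 2 * q + 3 * tau.
    have s22 : 0 <= s2 / 2 by rewrite divr_ge0// ltW.
    rewrite -[X in X * `|_|](ger0_norm s22) -normrM.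
    set c := mean _ in h1 h3; set e := expR _ in h2 h3.
    rewrite (_ : s2 / 2 * (w0 - y2) = (e - (1 - s2 * w0 / 2)) + (c - e) - (c - (1 - s2 / 2 * y2))); last by ring.
    apply: (le_trans (ler_normB _ _)); apply: (le_trans (lerD (ler_normD _ _) (lexx _))).
    rewrite /q mulrDr; move: h1 h2 h3 h4; clear.
    by move: `|_ - _| `|_ - _| `|_ - _| (tau * _) => x y z u; lra.
  rewrite -(ler_pM2l (_ : 0 < s2 / 2)); last by rewrite divr_gt0.
  apply: (le_trans h5); rewrite [leRHS]mulrDr; apply: lerD.
    by rewrite le_eqVlt; apply/orP; left; apply/eqP; field.
  by rewrite le_eqVlt; apply/orP; left; apply/eqP; field; rewrite gt_eqF.
have hS : `|mean (fun w => cos (t * Z w + theta)) - mean (fun w => cos (t * Y w + theta))| <= `|t| * b.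
  have BcZ : Bd (fun w => cos (t * Z w + theta)).
    apply: Bd_cos; apply: measurable_funD => //; apply: measurable_funM => //.
    exact: L2_measurable Z2.
  have BcY : Bd (fun w => cos (t * Y w + theta)).
    apply: Bd_cos; apply: measurable_funD => //; apply: measurable_funM => //.
    exact: L2_measurable Y2.
  rewrite -meanB; [|exact: Bd_L1|exact: Bd_L1].
  apply: (@le_trans _ _ (mean (fun w => `|t| * `|Z w - Y w|))).
    apply: mean_norm_le.
    - by apply: Bd_L1; apply: BdD => //; exact: BdN.
    - by apply: L1Z; apply: L1_norm; exact: L2_L1.
    move=> w; apply: le_trans (cos_lipschitz _ _) _.
    by rewrite -normrM (_ : _ - _ = t * (Z w - Y w)); last by ring.
  rewrite meanZ; last by apply: L1_norm; exact: L2_L1.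
  exact: ler_wpM2l.
have he : `|cos theta * expR (- (t ^+ 2 * w0 / 2)) - cos theta * expR (- (t ^+ 2 / 2))|
   <= t ^+ 2 / 2 * `|w0 - 1|.
  rewrite -mulrBr normrM; apply: le_trans (ler_piMl (normr_ge0 _) _) _.
    by rewrite ler_norml cos_geN1 cos_le1.
  apply: le_trans (expRN_lipschitz _ _) _.
  - by rewrite divr_ge0// mulr_ge0.
  - by rewrite divr_ge0.
  rewrite (_ : _ - _ = t ^+ 2 / 2 * (w0 - 1)); last by field.
  by rewrite normrM ger0_norm// divr_ge0.
have hw1 : `|w0 - 1| <= 2 * (s2 * q) + 6 * (tau / s2) + 3 * b.
  rewrite (_ : w0 - 1 = (w0 - y2) + (y2 - 1)); last by ring.
  by apply: (le_trans (ler_normD _ _)); exact: lerD.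
have hcf := cfY t theta.
set cZ := mean _ in hS *; set cY := mean _ in hS hcf.
set eY := cos theta * _ in hcf he; set eZ := cos theta * _ in he *.
rewrite (_ : cZ - eZ = (cZ - cY) + (cY - eY) + (eY - eZ)); last by ring.
apply: (le_trans (ler_normD _ _)); apply: (le_trans (lerD (ler_normD _ _) (lexx _))).
apply: (@le_trans _ _ (`|t| * b + tau * (t ^+ 4 + `|t| ^+ 3 + 1) +
    t ^+ 2 / 2 * (2 * (s2 * q) + 6 * (tau / s2) + 3 * b))).
  apply: lerD; first exact: lerD.
  by apply: le_trans he _; apply: ler_wpM2l => //; rewrite divr_ge0.
have k1 : `|t| * b <= A * b by apply: ler_wpM2r; [exact: ltW|rewrite /A; lra].
have k2 : t ^+ 2 * b <= A * b by apply: ler_wpM2r; [exact: ltW|rewrite /A; lra].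
have k3 : tau * (t ^+ 4 + `|t| ^+ 3 + 1) <= A * tau.
  by rewrite mulrC; apply: ler_wpM2r; [exact: ltW|rewrite /A; lra].
have k4 : t ^+ 2 * (s2 * q) <= A * q * s2.
  rewrite [s2 * q]mulrC mulrA; apply: ler_wpM2r; first exact: ltW.
  by apply: ler_wpM2r => //; rewrite /A; lra.
have k5 : t ^+ 2 * (tau / s2) <= gamma / 24.
  rewrite mulrA ler_pdivrMr//; apply: (@le_trans _ _ (A * tau)).
    by apply: ler_wpM2r; [exact: ltW|rewrite /A; lra].
  by apply: (le_trans Atau); rewrite [leRHS]mulrC mulrA.
have k6 : s2 * gamma <= gamma by rewrite ger_pMl.
rewrite [X in _ + X](_ : _ = t ^+ 2 * (s2 * q) + 3 * (t ^+ 2 * (tau / s2)) +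
    3 / 2 * (t ^+ 2 * b)); last by field; rewrite gt_eqF.
move: k1 k2 k3 k4 k5 k6 Ab As Atau; clear -gamma0.
move: (`|t| * b) (t ^+ 2 * b) (tau * _) (t ^+ 2 * (s2 * q)) (t ^+ 2 * (tau / s2)) => x1 x2 x3 x4 x5.
move: (A * b) (A * q * s2) (A * tau) (s2 * gamma) => y1 y2 y3 y4.
by move: gamma0; move: (gamma) => g; clear; lra.
Qed.

End gaussian_close.

(** * Choice of the constants *)

Section cf_close.
Context {R : realType} {disp : measure_display} {T : measurableType disp}.
Variable P : probability T R.
Local Notation mean := (mean P).
Local Notation L2 := (L2 P).

(** The order of the quantifiers matters: [a] depends on the number of colors and will determine [m]
    through alpha-mixing, while [lam] and [v] may depend on [m] and are reached for large [n] by the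
    Lindeberg condition. *)
Lemma cf_close (d m0 : nat) (r M t gamma : R) : (0 < m0)%N -> 0 <= r < 1 -> 0 <= M ->
  0 < gamma ->
  exists2 e : R, 0 < e & exists2 a : R, 0 < a & forall m, (0 < m)%N ->
  exists2 lam : R, 0 < lam & exists2 v : R, 0 < v &
  forall (X xi : lattice d -> T -> R) (S : seq (lattice d)),
  (rho'_field P X m0 <= r%:E)%E -> (alpha_field P X m <= a%:E)%E ->
  (forall k, Gmeas (gen X [set k]) (xi k)) ->
  (forall k, L2 (xi k)) -> (forall k, mean (xi k) = 0) -> uniq S ->
  (forall k u, k \in S -> 0 <= k u) ->
  \sum_(k <- S) mean (fun w => xi k w ^+ 2) <= M ->
  mean (fun w => (\sum_(k <- S) xi k w) ^+ 2) = 1 ->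
  (forall k, k \in S -> mean (fun w => xi k w ^+ 2) <= v) ->
  \sum_(k <- S) mean (fun w => (xi k w - trunc e (xi k w)) ^+ 2) <= lam ->
  forall theta, `|mean (fun w => cos (t * (\sum_(k <- S) xi k w) + theta)) -
      cos theta * expR (- (t ^+ 2 / 2))| <= gamma.
Proof.
move=> m0_gt0 r01 M0 gamma0.
pose k2 := var_const m0 d r; pose k4 := mom4_const m0 d r.
have k20 : 0 <= k2 by exact: var_const_ge0.
have k40 : 0 <= k4 by exact: mom4_const_ge0.
(* A bound for [E Y^4] valid for all truncation levels [e <= 1]; it has to precede [e] because
   [gaussian_close] takes it as input. *)
pose Q := k4 * (4 * M + M ^+ 2).
have Q0 : 0 <= Q by apply: mulr_ge0 => //; apply: addr_ge0; [exact: mulr_ge0|exact: sqr_ge0].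
have [tau tau0 [delta delta0 close]] := gaussian_close P (k2 * M) t Q0 gamma0.
have k2M : 0 <= k2 * M by exact: mulr_ge0.
have k4M : 0 <= k4 * M by exact: mulr_ge0.
have [b /andP[b0 b1] bk] := small_scale k2M tau0.
(* The third order term divides [beta] by [b], so [beta] has to be at most [tau * b]; truncation
   level, block mass and exceptional sites take one third each. *)
pose bb := tau * b.
have bb0 : 0 < bb by exact: mulr_gt0.
have bb_tau : bb <= tau by rewrite /bb ger_pMr.
have bbV : b^-1 * bb = tau by rewrite /bb mulrCA mulVf ?mulr1// gt_eqF.
have bb3 : 0 < bb / 3 by exact: divr_gt0.
have [eta /andP[eta0 _] Heta] : exists2 y, 0 < y <= 1 & (k4 * M * (d%:R * 2)) * y <= bb / 3.
  by apply: small_scale => //; rewrite mulr_ge0// mulr_ge0// ?ler0n.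
have [e /andP[e0 e1] He] : exists2 y, 0 < y <= 1 & (k4 * M * 4) * y <= bb / 3.
  by apply: small_scale => //; rewrite mulr_ge0.
have e2 : e ^+ 2 <= e by rewrite expr2 ger_pMr.
have [N HN] := block_approx P d m0_gt0 r01 M eta0.
have [a /andP[a0 _] Ha] : exists2 y, 0 < y <= 1 & (8 * (N.+1 ^ d)%:R) * y <= tau.
  by apply: small_scale => //; rewrite mulr_ge0// ?ler0n.
exists e => //; exists a => // m m_gt0.
have delta2 : 0 < delta / 2 by exact: divr_gt0.
have [eps /andP[eps0 _] Heps] : exists2 y, 0 < y <= 1 &
    (2 * k2 * (d%:R * N%:R)) * y <= delta / 2.
  apply: small_scale => //; apply: mulr_ge0; [exact: mulr_ge0|by rewrite -natrM ler0n].
have [lam /andP[lam0 _] Hlam] : exists2 y, 0 < y <= 1 & (2 * k2) * y <= delta / 2.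
  by apply: small_scale => //; rewrite mulr_ge0.
have [K HK] := HN m eps m_gt0 eps0.
have [v /andP[v0 _] Hv] : exists2 y, 0 < y <= 1 & (k4 * M * K%:R) * y <= bb / 3.
  by apply: small_scale => //; rewrite mulr_ge0// ?ler0n.
exists lam => //; exists v => // X xi S rhoX alphaX mxi xi2 xi0 uS S0 VM var1 Vv Hl theta.
have [Y [w0 [BY w0M HD HY Hcf]]] := HK X xi S a e v lam rhoX alphaX (ltW a0) (ltW e0)
  (ltW v0) mxi xi2 xi0 uS S0 VM Vv Hl.
have Z2 : L2 (fun w => \sum_(k <- S) xi k w) by apply: L2_sum => k _ _; exact: xi2.
apply: (close _ Y w0) => //.
- apply: (le_trans HD); rewrite -/k2; move: Heps Hlam; clear.
  rewrite (_ : 2 * k2 * (_ + lam) = 2 * k2 * (d%:R * N%:R) * eps + 2 * k2 * lam); last by ring.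
  by move: (_ * eps) (_ * lam) => x y; lra.
- apply: (le_trans HY); rewrite -/k4 /Q; apply: ler_wpM2l => //; rewrite lerD2r.
  apply: ler_wpM2r => //; rewrite ger_pMr//; exact: le_trans e2 e1.
move=> t' th; apply: (le_trans (Hcf t' th b b0)); rewrite -/k2 -/k4.
set beta := k4 * _.
have betab : beta <= bb.
  rewrite (_ : beta = k4 * M * 4 * e ^+ 2 + k4 * M * (d%:R * 2) * eta + k4 * M * K%:R * v); last first.
    by rewrite /beta; ring.
  have : k4 * M * 4 * e ^+ 2 <= k4 * M * 4 * e by apply: ler_wpM2l => //; rewrite mulr_ge0.
  move: He Heta Hv; clear.
  by move: (_ * e) (_ * eta) (_ * v) (_ * e ^+ 2) => x y z u; lra.
have t4 : 0 <= t' ^+ 4 by rewrite exprn_even_ge0.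
have t3 : 0 <= `|t'| ^+ 3 by rewrite exprn_ge0.
rewrite [leRHS]mulrDr [X in _ <= X + _]mulrDr mulr1; apply: lerD; last first.
  by move: Ha; rewrite mulrAC.
apply: lerD.
  rewrite -[leLHS]mulrA [leRHS]mulrC; apply: ler_wpM2l => //.
  move: bb_tau betab tau0; clear; move: beta => x; lra.
rewrite -[leLHS]mulrA [leRHS]mulrC; apply: ler_wpM2l => //.
have : b^-1 * beta <= tau by rewrite -bbV; apply: ler_wpM2l => //; rewrite invr_ge0 ltW.
move: bk; rewrite [k2 * M * b]mulrC; move: tau0; clear.
by move: (b * _) (b^-1 * _) => x y; lra.
Qed.

End cf_close.

(** * The theorem *)

Section array.
Context {R : realType} {disp : measure_display} {T : measurableType disp}.
Variable P : probability T R.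
Local Notation mean := (mean P).
Local Notation L2 := (L2 P).

Lemma expectation_mean (f : T -> R) : L1 P f -> ('E_P[f])%E = (mean f)%:E.
Proof.
move=> f1; rewrite -fine_expectation fineK//.
by rewrite unlock; exact: integrable_fin_num.
Qed.

Lemma L2_of_second_moment (f : T -> R) : measurable_fun setT f ->
  ('E_P[fun w => (f w ^+ 2)%R] < +oo)%E -> L2 f.
Proof.
move=> mf f2; split => //; apply/integrableP; split.
  by apply/measurable_EFinP; apply: measurable_funX.
rewrite unlock in f2; apply: le_lt_trans f2; rewrite le_eqVlt; apply/orP; left; apply/eqP.
by apply: eq_integral => w _ /=; rewrite ger0_norm// sqr_ge0.
Qed.

Lemma Gmeas_gen (d : nat) (X : lattice d -> T -> R) k : Gmeas (gen X [set k]) (X k).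
Proof.
by move=> _ B mB; rewrite setTI; apply: sub_sigma_algebra; exists k => //; exists B; rewrite ?setTI.
Qed.

Variables (d : nat) (L : 'I_d -> nat) (X : lattice d -> {RV P >-> R}).
Hypothesis X_centered : forall k, box L k -> ('E_P[X k] = 0)%E.
Hypothesis X_L2 : forall k, box L k -> ('E_P[fun w => (X k w ^+ 2)%R] < +oo)%E.

Let Z := zero_extension L X.
Let S : seq (lattice d) := fset_set (box L).

Let memS k : (k \in S) = (k \in box L).
Proof. by rewrite /S in_fset_set//; exact: finite_box. Qed.

Let ZE k : k \in S -> Z k = X k.
Proof. by rewrite memS /Z /zero_extension => ->. Qed.

Lemma zero_extension_L2 k : L2 (Z k).
Proof.
rewrite /Z /zero_extension; case: ifPn => [/set_mem kL|_]; last exact: L2_cst.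
by apply: L2_of_second_moment => //; exact: X_L2.
Qed.

Lemma zero_extension_mean k : mean (Z k) = 0.
Proof.
rewrite /Z /zero_extension; case: ifPn => [/set_mem kL|_]; last exact: mean_cst.
by rewrite -fine_expectation X_centered.
Qed.

Lemma partial_sumE (B : set (lattice d)) : B `<=` box L ->
  partial_sum X B = fun w => \sum_(k <- fset_set B) Z k w.
Proof.
move=> BL; have fB : finite_set B by apply: sub_finite_set BL _; exact: finite_box.
apply/funext => w; rewrite /partial_sum fsbig_finite// big_seq [RHS]big_seq.
apply: eq_bigr => k; rewrite in_fset_set// => /set_mem/BL kL.
by rewrite ZE// memS; exact/mem_set.
Qed.

Lemma sigma_sum_sqr :
  sigma_sum L X ^+ 2 = mean (fun w => (\sum_(k <- S) Z k w) ^+ 2).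
Proof.
rewrite /sigma_sum fine_expectation partial_sumE// sqr_sqrtr//.
by apply: mean_ge0 => w; exact: sqr_ge0.
Qed.

Lemma sum_expectation_sqr : (\sum_(k \in box L) 'E_P[fun w => (X k w ^+ 2)%R])%E =
  (\sum_(k <- S) mean (fun w => Z k w ^+ 2))%:E.
Proof.
rewrite fsbig_finite; last exact: finite_box.
rewrite -sumEFin big_seq [RHS]big_seq; apply: eq_bigr => k kS.
by rewrite -(ZE kS) expectation_mean//; apply: L2_sqr; exact: zero_extension_L2.
Qed.

Variable C : R.
Hypothesis C_gt0 : 0 < C.
Hypothesis X_nondegenerate : exists2 k, box L k &
      (0 < 'E_P[fun w => (X k w ^+ 2)%R])%E.
Hypothesis variance_lower_bound : 
  (C%:E * \sum_(k \in box L) 'E_P[fun w => (X k w ^+ 2)%R]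
         <= 'E_P[fun w => (partial_sum X (box L) w ^+ 2)%R])%E.

Let s := sigma_sum L X.

Lemma sum_sqr_le_sigma : C * \sum_(k <- S) mean (fun w => Z k w ^+ 2) <= s ^+ 2.
Proof.
move: variance_lower_bound; rewrite sum_expectation_sqr -EFinM expectation_mean.
  by rewrite lee_fin /s sigma_sum_sqr partial_sumE.
apply: L2_sqr; rewrite partial_sumE//; apply: L2_sum => k _ _.
exact: zero_extension_L2.
Qed.

Lemma sigma_gt0 : 0 < s.
Proof.
rewrite lt_neqAle eq_sym sqrtr_ge0 andbT -sqrf_eq0 gt_eqF//.
apply: lt_le_trans sum_sqr_le_sigma; rewrite mulr_gt0//.
have [k kL] := X_nondegenerate.
have kS : k \in S by rewrite memS; exact/mem_set.
rewrite -(ZE kS) expectation_mean ?lte_fin; last by apply: L2_sqr; exact: zero_extension_L2.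
move/lt_le_trans; apply; rewrite (big_rem k)//= lerDl sumr_ge0// => l _.
by apply: mean_ge0 => w; exact: sqr_ge0.
Qed.

Definition normalized k w := s^-1 * Z k w.

Lemma normalized_L2 k : L2 (normalized k).
Proof. by apply: L2Z; exact: zero_extension_L2. Qed.

Lemma normalized_mean k : mean (normalized k) = 0.
Proof.
by rewrite meanZ ?zero_extension_mean ?mulr0//; apply: L2_L1; exact: zero_extension_L2.
Qed.

Lemma normalized_Gmeas k : Gmeas (gen Z [set k]) (normalized k).
Proof. by apply: GmeasM; [exact: Gmeas_cst|exact: Gmeas_gen]. Qed.

Lemma normalized_sumE w : normalized_sum L X w = \sum_(k <- S) normalized k w.
Proof. by rewrite /normalized_sum partial_sumE// mulr_sumr. Qed.

Lemma normalized_sum_sqr : mean (fun w => (\sum_(k <- S) normalized k w) ^+ 2) = 1.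
Proof.
rewrite (eq_mean _ (g := fun w => s ^- 2 * (\sum_(k <- S) Z k w) ^+ 2)); last first.
  by move=> w; rewrite -mulr_sumr exprMn exprVn.
rewrite meanZ; last by apply: L2_sqr; apply: L2_sum => k _ _; exact: zero_extension_L2.
by rewrite -sigma_sum_sqr mulVf// sqrf_eq0 gt_eqF// sigma_gt0.
Qed.

Lemma normalized_sqr_sum_le : \sum_(k <- S) mean (fun w => normalized k w ^+ 2) <= C^-1.
Proof.
rewrite (eq_bigr (fun k => s ^- 2 * mean (fun w => Z k w ^+ 2))); last first.
  move=> k _; rewrite -meanZ; last by apply: L2_sqr; exact: zero_extension_L2.
  by apply: eq_mean => w; rewrite exprMn exprVn.
have s2 : 0 < s ^+ 2 by rewrite exprn_gt0// sigma_gt0.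
rewrite -mulr_sumr mulrC ler_pdivrMr// -(ler_pM2l C_gt0) mulrA divff ?gt_eqF// mul1r.
exact: sum_sqr_le_sigma.
Qed.

(** Division by [s] turns the threshold [e * s] into [e] and absorbs the factor [s ^- 2]. *)
Lemma lindeberg_sumE e : 0 <= e -> lindeberg_sum e L X =
  (\sum_(k <- S) mean (fun w => (normalized k w - trunc e (normalized k w)) ^+ 2))%:E.
Proof.
move=> e0; have sp := sigma_gt0.
rewrite /lindeberg_sum fsbig_finite; last exact: finite_box.
rewrite -/s -/S.
rewrite (eq_big_seq (fun k => (s ^+ 2 * mean (fun w =>
    (normalized k w - trunc e (normalized k w)) ^+ 2))%:E)); last first.
  move=> k kS; have nk2 : L2 (fun w => normalized k w - trunc e (normalized k w)).
    apply: L2B; first exact: normalized_L2.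
    by apply: Bd_L2; apply: Bd_trunc => //; exact: normalized_L2.
  rewrite -meanZ; last exact: L2_sqr.
  rewrite -expectation_mean; last by apply: L1Z; exact: L2_sqr.
  congr expectation; apply/funext => w.
  rewrite trunc_tail_sqr /normalized exprMn exprVn mulrA mulrA divff ?mul1r; last first.
    by rewrite sqrf_eq0 gt_eqF.
  rewrite (ZE kS); congr (_ * _); rewrite !indicE; congr (nat_of_bool _)%:R.
  have eqs : (e * s < `|X k w|) = (e < `|s^-1 * X k w|).
    by rewrite normrM gtr0_norm ?invr_gt0// -ltr_pdivrMl ?invr_gt0// invrK mulrC.
  by apply/idP/idP => /set_mem/= h; apply/mem_set => /=; [rewrite -eqs|rewrite -/s eqs].
rewrite (etrans (congr1 (fun x => ((s ^+ 2)^-1%:E * x)%E) (sumEFin _ _ _)) (erefl _)).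
rewrite -mulr_sumr -EFinM mulrA mulVf ?mul1r//.
by rewrite sqrf_eq0 gt_eqF.
Qed.

End array.

(** * Constants extracted from the mixing assumptions *)

Section mixing.
Context {R : realType} {disp : measure_display} {T : measurableType disp}.
Variable P : probability T R.
Variables (d : nat) (L : nat -> 'I_d -> nat) (X : nat -> lattice d -> {RV P >-> R}).

Lemma slab_separatedW (m n : nat) (Q S : set (lattice d)) : (m <= n)%N ->
  slab_separated n Q S -> slab_separated m Q S.
Proof.
move=> mn [u [A [B [AB [ABn QA SB]]]]]; exists u, A, B; split => //; split => //.
by move=> a b Aa Bb; apply: le_trans (ABn a b Aa Bb); rewrite lez_nat.
Qed.

Lemma rho'_array_nonincreasing : nonincreasing_seq (rho'_array L X).
Proof.
move=> m n mn; apply: ge_ereal_sup => _ [i _ <-].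
apply: (@le_trans _ _ (rho'_field P (zero_extension (L i) (X i)) m)); last first.
  by apply: ereal_sup_ubound; exists i.
apply: ge_ereal_sup => _ [QS [ne fin dis sep] <-]; apply: ereal_sup_ubound.
by exists QS => //; split => //; exact: slab_separatedW sep.
Qed.

(** A nonincreasing sequence converges to its infimum, so some term is already below 1. *)
Lemma rho'_array_bound : (limn (rho'_array L X) < 1)%E ->
  exists m0 (r : R), [/\ (0 < m0)%N, 0 <= r < 1 &
    forall n, (rho'_field P (zero_extension (L n) (X n)) m0 <= r%:E)%E].
Proof.
have := ereal_nonincreasing_cvgn rho'_array_nonincreasing.
move=> /cvg_lim ->// /ereal_inf_lt[_ [m _ <-] rm].
(* The index is raised by one to make it positive. *)
have rm1 : (rho'_array L X m.+1 < 1)%E.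
  by apply: le_lt_trans rm; exact: rho'_array_nonincreasing.
have bound n : (rho'_field P (zero_extension (L n) (X n)) m.+1 <= rho'_array L X m.+1)%E.
  by apply: ereal_sup_ubound; exists n.
exists m.+1; move: rm1 bound; case: (rho'_array _ _ _) => [q|//|] q1 bound.
  (* The maximum with 0 gives [0 <= r] whatever the sign of [q]; the value -oo is met with
     [r = 0]. *)
  exists (Num.max 0 q); split => //; first by rewrite le_max lexx/= gt_max ltr01.
  by move=> n; apply: le_trans (bound n) _; rewrite lee_fin le_max lexx orbT.
by exists 0; split => //; [rewrite lexx ltr01|move=> n; apply: le_trans (bound n) _; exact: leNye].
Qed.

Lemma alpha_array_bound (a : R) : 0 < a ->
  alpha_array L X m @[m --> \oo] --> 0%E ->
  exists2 m, (0 < m)%N & forall n, (alpha_field P (zero_extension (L n) (X n)) m <= a%:E)%E.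
Proof.
move=> a0 /fine_cvgP[fin /cvgrPdist_le/(_ a a0) cv].
have [m [[mf ma] m0]] : exists m, (alpha_array L X m \is a fin_num /\
    `|0 - fine (alpha_array L X m)| <= a) /\ (0 < m)%N.
  have : \forall m \near \oo, (alpha_array L X m \is a fin_num /\
    `|0 - fine (alpha_array L X m)| <= a) /\ (0 < m)%N.
    near=> m; split; last by near: m; exact: nbhs_infty_gt.
    by split; near: m.
  by case=> N _ HN; exists N; exact: HN (leqnn N).
exists m => // n; apply: (@le_trans _ _ (alpha_array L X m)).
  by apply: ereal_sup_ubound; exists n.
by rewrite -(fineK mf) lee_fin (le_trans (ler_norm _))// -normrN -sub0r.
Unshelve. all: end_near. Qed.

End mixing.

Lemma cvg_of_fine (R : realType) (u : nat -> \bar R) (l : \bar R) :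
  l \is a fin_num -> (forall n, u n \is a fin_num) ->
  (forall e : R, 0 < e -> \forall n \near \oo, `|fine l - fine (u n)| <= 2 * e) ->
  u n @[n --> \oo] --> l.
Proof.
move=> lf uf ul; rewrite -(fineK lf); apply/fine_cvgP; split.
  by near=> n; exact: uf.
apply/cvgrPdist_le => e e0; have e2 : 0 < e / 2 by exact: divr_gt0.
near=> n; rewrite [leRHS](_ : e = 2 * (e / 2)); last by field.
by near: n; exact: ul.
Unshelve. all: end_near. Qed.

Theorem theorem6p1 (R : realType) (disp : measure_display)
    (T : measurableType disp) (P : probability T R)
    (d : nat) (d_gt0 : (0 < d)%N)
    (L : nat -> 'I_d -> nat) (L_gt0 : forall n u, (0 < L n u)%N)
    (X : nat -> lattice d -> {RV P >-> R})
    (X_centered : forall n k, box (L n) k -> ('E_P[X n k] = 0)%E)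
    (X_L2 : forall n k, box (L n) k ->
      ('E_P[fun w => (X n k w ^+ 2)%R] < +oo)%E)
    (X_nondegenerate : forall n, exists2 k, box (L n) k &
      (0 < 'E_P[fun w => (X n k w ^+ 2)%R])%E)
    (alpha_cvg0 : alpha_array L X m @[m --> \oo] --> 0%E)
    (rho'_lim_lt1 : (limn (rho'_array L X) < 1)%E)
    (C : R) (C_gt0 : 0 < C)
    (variance_lower_bound : forall n (S : set (lattice d)),
      S !=set0 -> S `<=` box (L n) ->
      (C%:E * \sum_(k \in S) 'E_P[fun w => (X n k w ^+ 2)%R]
         <= 'E_P[fun w => (partial_sum (X n) S w ^+ 2)%R])%E)
    (lindeberg : forall eps : R, 0 < eps ->
      lindeberg_sum eps (L n) (X n) @[n --> \oo] --> 0%E) :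
  cvg_in_distribution P
    (fun n => normalized_sum (L n) (X n) : {RV P >-> R}) (normal_prob 0 1).
Proof.
have [m0 [r [m00 r01 rhoX]]] := rho'_array_bound rho'_lim_lt1.
pose Z n := zero_extension (L n) (X n).
pose S n : seq (lattice d) := fset_set (box (L n)).
have fullvar n : (C%:E * \sum_(k \in box (L n)) 'E_P[fun w => (X n k w ^+ 2)%R]
         <= 'E_P[fun w => (partial_sum (X n) (box (L n)) w ^+ 2)%R])%E.
  by apply: variance_lower_bound => //; have [k kL _] := X_nondegenerate n; exists k.
pose xi n := normalized (P := P) (L n) (X n).
have sumE n w : normalized_sum (L n) (X n) w = \sum_(k <- S n) xi n k w.
  exact: normalized_sumE.
have xi2 n k : L2 P (xi n k) by apply: normalized_L2 => // l; exact: X_L2.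
have Lam e : 0 < e ->
    (\sum_(k <- S n) mean P (fun w => (xi n k w - trunc e (xi n k w)) ^+ 2))
      @[n --> \oo] --> 0.
  move=> e0; have := lindeberg e e0.
  rewrite (_ : (fun n => _) = (fun n => (\sum_(k <- S n) mean P
     (fun w => (xi n k w - trunc e (xi n k w)) ^+ 2))%:E)); last first.
    apply/funext => n; apply: (lindeberg_sumE _ C_gt0) => //; last exact: ltW.
    exact: X_L2.
  by move/fine_cvg.
have cf t theta : mean P (fun w => cos (t * normalized_sum (L n) (X n) w + theta))
    @[n --> \oo] --> cos theta * expR (- t ^+ 2 / 2).
  apply/cvgrPdist_le => gamma gamma0.
  have C0 : 0 <= C^-1 by rewrite invr_ge0 ltW.
  (* [C^-1] bounds the total variance of the normalized variables, by [normalized_sqr_sum_le]. *)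
  have [e e0 [a a0 Hcf]] := cf_close P d t m00 r01 C0 gamma0.
  have [m m1 alphaX] := alpha_array_bound a0 alpha_cvg0.
  have [lam lam0 [v v0 {}Hcf]] := Hcf m m1.
  have v2 : 0 < v / 2 by exact: divr_gt0.
  (* At this second truncation level the Lindeberg sum is eventually at most [v / 2], so every
     normalized variance is at most [e' ^+ 2 + v / 2 = v]. *)
  pose e' := Num.sqrt (v / 2).
  have e'0 : 0 < e' by rewrite sqrtr_gt0.
  have e'2 : e' ^+ 2 = v / 2 by rewrite sqr_sqrtr// ltW.
  have /cvgrPdist_le/(_ lam lam0) H1 := Lam e e0.
  have /cvgrPdist_le/(_ (v / 2) v2) H2 := Lam e' e'0.
  near=> n.
  have h1 : `|0 - \sum_(k <- S n) mean P
     (fun w => (xi n k w - trunc e (xi n k w)) ^+ 2)| <= lam by near: n.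
  have h2 : `|0 - \sum_(k <- S n) mean P
     (fun w => (xi n k w - trunc e' (xi n k w)) ^+ 2)| <= v / 2 by near: n.
  rewrite distrC (eq_mean P (g := fun w => cos (t * (\sum_(k <- S n) xi n k w) + theta))); last first.
    by move=> w; rewrite sumE.
  rewrite mulNr; apply: (Hcf (Z n) (xi n) (S n)) => //.
  - exact: rhoX.
  - exact: alphaX.
  - by move=> k; exact: normalized_Gmeas.
  - by move=> k; apply: normalized_mean => // l; [exact: X_centered|exact: X_L2].
  - exact: fset_uniq.
  - move=> k u; rewrite in_fset_set; last exact: finite_box.
    by move=> /set_mem/(_ u)/andP[+ _]; exact: le_trans.
  - by apply: normalized_sqr_sum_le => // l; exact: X_L2.
  - by apply: (normalized_sum_sqr _ C_gt0) => // l; exact: X_L2.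
  - move=> k kS; apply: le_trans (mean_sqr_trunc_le (ltW e'0) (xi2 n k)) _.
    rewrite e'2 [leRHS]splitr lerD2l; move: h2; rewrite sub0r normrN => h2.
    apply: le_trans (le_trans (ler_norm _) h2); rewrite (big_rem k)//= lerDl sumr_ge0// => l _.
    by apply: mean_ge0 => w; exact: sqr_ge0.
  - by move: h1; rewrite sub0r normrN; apply: le_trans; exact: ler_norm.
move=> x _.
have mY n : measurable_fun setT (normalized_sum (P := P) (L n) (X n)).
  exact: measurable_normalized_sum.
apply: cvg_of_fine => [|n|e e0]; [exact: fin_num_measure|exact: fin_num_measure|].
exact: (levy_cdf mY cf).
Unshelve. all: end_near. Qed.
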